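(* Suppose $G\rightrightarrows G_0$ and $H\rightrightarrows H_0$ are continuous groupoids, each endowed with a right Haar system. If $G$ and $H$ are Morita equivalent and there exists a Morita $G$-$H$-bibundle that admits left and right Dirac sequences, then the representation categories $\mathbf{Rep}(G)$ and $\mathbf{Rep}(H)$ are equivalent.
   Context: A continuous groupoid is a topological groupoid; base spaces are locally compact Hausdorff. Source and target are $s,t$; $G_m=s^{-1}(m)$, $G^m=t^{-1}(m)$. A right Haar system is a right-invariant continuous family of measures $\{\lambda_m\}$, $\lambda_m$ on $G_m$; $\lambda^m$ denotes the image of $\lambda_m$ under inversion, a measure on $G^m$. A left action of $G$ on $J:N\to G_0$ has $g\cdot n$ defined when $s(g)=J(n)$, with $J(g\cdot n)=t(g)$; a right action of $H$ on $J_H:N\to H_0$ has $n\cdot h$ defined when $t(h)=J_H(n)$, with $J_H(n\cdot h)=s(h)$. A left action is left principal if $(g,n)\mapsto(g\cdot n,n)$ is a homeomorphism $G\times_{G_0}N\to N\times_{G\backslash N}N$, with $G\backslash N$ carrying the quotient topology; right principal is analogous. A $G$-$H$-bibundle is a space $N$ with continuous commuting left $G$-action on $J_G:N\to G_0$ and right $H$-action on $J_H:N\to H_0$, with $J_H(g\cdot n)=J_H(n)$ and $J_G(n\cdot h)=J_G(n)$. It is a Morita bibundle if it is left and right principal and $J_G$, $J_H$ induce homeomorphisms $N/H\simeq G_0$ and $G\backslash N\simeq H_0$; $G$ and $H$ are Morita equivalent if such a bibundle exists. A left action of $G$ on $J:N\to G_0$ has left Dirac sequences if for each $n\in N$ there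 is a sequence of functions $(\delta_k^n)_{k\in\mathbb N}$ on $N$ such that (i) $\delta_k^n\ge0$ on $J^{-1}(J(n))$; (ii) $\int_{G_{J(n)}}\delta_k^n(g\cdot n)\,\lambda_{J(n)}(dg)=1$ for all $k$; (iii) for every open neighborhood $U\subset G_{J(n)}$ of $1_{J(n)}$ and every $\varepsilon>0$ there is $K\in\mathbb N$ such that for $k>K$, $\int_{U^c}\delta_k^n(g\cdot n)\,\lambda_{J(n)}(dg)<\varepsilon$. Right Dirac sequences for a right action of $H$ are defined analogously, integrating $h\mapsto\delta_k^n(n\cdot h)$ over $H^{J_H(n)}$. Continuous field of Hilbert spaces over $M$: a pair $(\mathcal H,\Delta)$, with Hilbert spaces $\{\mathcal H_m\}_{m\in M}$ and a linear space of sections $\Delta\subset\prod_m\mathcal H_m$ such that (i) $\{\xi(m):\xi\in\Delta\}=\mathcal H_m$ for all $m$; (ii) $m\mapsto\|\xi(m)\|$ is in $C_0(M)$ for all $\xi\in\Delta$; (iii) if $\xi\in\prod_m\mathcal H_m$ and for each $\varepsilon>0$ and $m$ there is $\eta\in\Delta$ with $\|\xi(n)-\eta(n)\|<\varepsilon$ for $n$ in a neighborhood of $m$, then $\xi\in\Delta$. The total space $\mathcal H=\coprod_m\mathcal H_m$, with projection $p$, has the topology with basis $U(\varepsilon,\xi,V)=\{h: p(h)\in V,\ \|h-\xi(p(h))\|<\varepsilon\}$. $\mathbf{Rep}(G)$ is the category of continuous unitary representations of $G$: continuous fields $(\mathcal H,\Delta)$ over $G_0$ with unitary operators $\pi(g):\mathcal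 H_{s(g)}\to\mathcal H_{t(g)}$ such that $\pi(1_m)=\mathrm{id}$, $\pi(gg')=\pi(g)\pi(g')$, $\pi(g^{-1})=\pi(g)^{-1}$ and $(g,h)\mapsto\pi(g)h$ is continuous on $\{(g,h):s(g)=p(h)\}$. Morphisms are families of linear maps $\Psi_m:\mathcal H^1_m\to\mathcal H^2_m$ with $\Psi\circ\xi\in\Delta^2$ for $\xi\in\Delta^1$, $m\mapsto\|\Psi_m\|$ locally bounded, and $\Psi_{t(g)}\pi_1(g)=\pi_2(g)\Psi_{s(g)}$.
   Formalization: Condition (iii) of a continuous field is required only for sections whose norm is in C_0(M), since literally (ii) and (iii) clash over noncompact M and make the claim false; Haar systems are read as Radon measures on a locally compact Hausdorff groupoid. *)

(* Defs.v *)
From HB Require Import structures.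
From mathcomp Require Import all_boot all_order all_algebra.
From mathcomp Require Import sesquilinear generic_quotient complex.
From mathcomp Require Import all_classical all_reals all_analysis.

Set Implicit Arguments.
Unset Strict Implicit.
Unset Printing Implicit Defensive.

Import Order.TTheory GRing.Theory Num.Theory.
Import numFieldNormedType.Exports.

Local Open Scope classical_set_scope.
Local Open Scope ring_scope.
Local Open Scope quotient_scope.
Local Open Scope complex_scope.

Definition homeomorphism (X Y : topologicalType) (f : X -> Y) : Prop :=
  continuous f /\
  exists f' : Y -> X, [/\ continuous f', cancel f f' & cancel f' f].

(* f restricts to a homeomorphism between the subspaces A and B; only the     *)
(* values of f on A and of its inverse on B are constrained.                  *)
Definition homeomorphism_on (X Y : topologicalType) (A : set X) (B : set Y)
    (f : X -> Y) : Prop :=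
  [/\ {within A, continuous f}, set_fun A B f &
   exists f' : Y -> X, [/\ {within B, continuous f'}, set_fun B A f',
     {in A, cancel f f'} & {in B, cancel f' f}]].

(* The product gmul g h is meaningful only when gsrc g = gtgt h; it is a      *)
(* total function, arbitrary elsewhere.                                       *)
Record continuous_groupoid := ContinuousGroupoid {
  gbase : topologicalType;
  garr :> topologicalType;
  gsrc : garr -> gbase;
  gtgt : garr -> gbase;
  gunit : gbase -> garr;
  ginv : garr -> garr;
  gmul : garr -> garr -> garr;
  gsrc_unit : forall m, gsrc (gunit m) = m;
  gtgt_unit : forall m, gtgt (gunit m) = m;
  gsrc_inv : forall g, gsrc (ginv g) = gtgt g;
  gtgt_inv : forall g, gtgt (ginv g) = gsrc g;
  gsrc_mul : forall g h, gsrc g = gtgt h -> gsrc (gmul g h) = gsrc h;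
  gtgt_mul : forall g h, gsrc g = gtgt h -> gtgt (gmul g h) = gtgt g;
  gmulA : forall g h k, gsrc g = gtgt h -> gsrc h = gtgt k ->
    gmul g (gmul h k) = gmul (gmul g h) k;
  gmul1 : forall g, gmul g (gunit (gsrc g)) = g;
  g1mul : forall g, gmul (gunit (gtgt g)) g = g;
  gmulV : forall g, gmul g (ginv g) = gunit (gtgt g);
  gVmul : forall g, gmul (ginv g) g = gunit (gsrc g);
  gsrc_continuous : continuous gsrc;
  gtgt_continuous : continuous gtgt;
  gunit_continuous : continuous gunit;
  ginv_continuous : continuous ginv;
  gmul_continuous : {within [set x : garr * garr | gsrc x.1 = gtgt x.2],
    continuous (fun x : garr * garr => gmul x.1 x.2)};
  gbase_hausdorff : hausdorff_space gbase;
  gbase_locally_compact : locally_compact [set: gbase]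
}.

Section fibers.
Variable G : continuous_groupoid.
Implicit Types m : gbase G.

(* G_m and G^m, with the subspace topology. *)
Definition src_fiber m : Type := set_type [set g : G | gsrc g = m].
Definition tgt_fiber m : Type := set_type [set g : G | gtgt g = m].

HB.instance Definition _ m := Topological.on (src_fiber m).
HB.instance Definition _ m := Topological.on (tgt_fiber m).

Definition src_fiber_of m (g : G) (e : gsrc g = m) : src_fiber m :=
  exist _ g (mem_set (e : [set g : G | gsrc g = m] g)).
Definition tgt_fiber_of m (g : G) (e : gtgt g = m) : tgt_fiber m :=
  exist _ g (mem_set (e : [set g : G | gtgt g = m] g)).

Lemma src_fiberP m (g : src_fiber m) : gsrc (set_val g) = m.
Proof. exact: (set_mem (proj2_sig g)). Qed.

Definition src_fiber1 m : src_fiber m := src_fiber_of (gsrc_unit m).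
Definition tgt_fiber1 m : tgt_fiber m := tgt_fiber_of (gtgt_unit m).

HB.instance Definition _ m := isPointed.Build (src_fiber m) (src_fiber1 m).
HB.instance Definition _ m := isPointed.Build (tgt_fiber m) (tgt_fiber1 m).

Definition right_translation (g : G) (h : src_fiber (gtgt g)) :
    src_fiber (gsrc g) :=
  src_fiber_of (gsrc_mul (src_fiberP h)).

Definition fiber_inv m (g : src_fiber m) : tgt_fiber m :=
  tgt_fiber_of (etrans (gtgt_inv (set_val g)) (src_fiberP g)).

End fibers.

Notation borel X := (g_sigma_algebraType (@open X)).

Definition radon (R : realType) (X : ptopologicalType)
    (mu : set (borel X) -> \bar R) : Prop :=
  [/\ forall K : set X, compact K -> (mu K < +oo)%E,
      forall A : set X, measurable (A : set (borel X)) ->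
        mu A = ereal_inf [set mu U | U in [set U : set X | open U /\ A `<=` U]]
    & forall U : set X, open U ->
        mu U = ereal_sup [set mu K | K in [set K : set X | compact K /\ K `<=` U]]].

(* As usual, a Haar system lives on a locally compact Hausdorff groupoid and  *)
(* consists of Radon measures; continuity of the family is tested on C_c(G).  *)
(* The supports are not assumed to be full.                                   *)
Record right_haar_system (R : realType) (G : continuous_groupoid) := HaarSystem {
  haar :> forall m : gbase G, {measure set (borel (src_fiber m)) -> \bar R};
  haar_hausdorff : hausdorff_space G;
  haar_locally_compact : locally_compact [set: G];
  haar_radon : forall m, radon (haar m);
  haar_invariant : forall (g : G) (A : set (borel (src_fiber (gsrc g)))),
    measurable A ->
    pushforward (haar (gtgt g)) (@right_translation G g :
      borel (src_fiber (gtgt g)) -> borel (src_fiber (gsrc g))) A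
    = haar (gsrc g) A;
  haar_continuous : forall f : G -> R, continuous f ->
    compact (closure [set g | f g != 0]) ->
    continuous (fun m => \int[haar m]_(g in [set: borel (src_fiber m)])
                           f (set_val g) : R)
}.

Definition inverse_haar (R : realType) (G : continuous_groupoid)
    (lam : right_haar_system R G) (m : gbase G) :
    set (borel (tgt_fiber m)) -> \bar R :=
  pushforward (lam m)
    (@fiber_inv G m : borel (src_fiber m) -> borel (tgt_fiber m)).
Arguments inverse_haar {R G} lam m.

(* As for gmul, the actions are total functions, meaningful only on the       *)
(* fibered product.                                                           *)
Record left_action (G : continuous_groupoid) (N : topologicalType) := LeftAction {
  lJ : N -> gbase G;
  lact : G -> N -> N;
  lJ_act : forall g n, gsrc g = lJ n -> lJ (lact g n) = gtgt g;
  lact1 : forall n, lact (gunit (lJ n)) n = n;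
  lactM : forall g h n, gsrc g = gtgt h -> gsrc h = lJ n ->
    lact (gmul g h) n = lact g (lact h n);
  lJ_continuous : continuous lJ;
  lact_continuous : {within [set x : G * N | gsrc x.1 = lJ x.2],
    continuous (fun x : G * N => lact x.1 x.2)}
}.

Record right_action (H : continuous_groupoid) (N : topologicalType) := RightAction {
  rJ : N -> gbase H;
  ract : N -> H -> N;
  rJ_act : forall n h, gtgt h = rJ n -> rJ (ract n h) = gsrc h;
  ract1 : forall n, ract n (gunit (rJ n)) = n;
  ractM : forall n g h, gtgt g = rJ n -> gsrc g = gtgt h ->
    ract n (gmul g h) = ract (ract n g) h;
  rJ_continuous : continuous rJ;
  ract_continuous : {within [set x : N * H | gtgt x.2 = rJ x.1],
    continuous (fun x : N * H => ract x.1 x.2)}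
}.

Section left_quotient.
Variables (G : continuous_groupoid) (N : topologicalType) (a : left_action G N).

Definition lorbit (n n' : N) : bool :=
  `[< exists g : G, gsrc g = lJ a n /\ lact a g n = n' >].

Lemma lorbit_refl : reflexive lorbit.
Proof.
move=> n; apply/asboolP; exists (gunit (lJ a n)).
by rewrite gsrc_unit lact1.
Qed.

Lemma lorbit_sym : symmetric lorbit.
Proof.
suff H n n' : lorbit n n' -> lorbit n' n by move=> n n'; apply/idP/idP; apply: H.
move=> /asboolP[g [gn <-]]; apply/asboolP; exists (ginv g).
by rewrite gsrc_inv lJ_act// -lactM ?gsrc_inv// gVmul gn lact1.
Qed.

Lemma lorbit_trans : transitive lorbit.
Proof.
move=> y x z /asboolP[g [gx <-]] /asboolP[h [hg <-]]; apply/asboolP.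
rewrite lJ_act// in hg; exists (gmul h g).
by rewrite gsrc_mul// lactM.
Qed.

Definition lorbit_equiv := EquivRel lorbit lorbit_refl lorbit_sym lorbit_trans.

Definition left_quotient := quotient_topology {eq_quot lorbit_equiv}.

Definition left_principal : Prop :=
  homeomorphism_on
    [set x : G * N | gsrc x.1 = lJ a x.2]
    [set y : N * N | \pi_left_quotient y.1 = \pi_left_quotient y.2]
    (fun x : G * N => (lact a x.1 x.2, x.2)).

End left_quotient.

Section right_quotient.
Variables (H : continuous_groupoid) (N : topologicalType) (a : right_action H N).

Definition rorbit (n n' : N) : bool :=
  `[< exists h : H, gtgt h = rJ a n /\ ract a n h = n' >].

Lemma rorbit_refl : reflexive rorbit.
Proof.
move=> n; apply/asboolP; exists (gunit (rJ a n)).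
by rewrite gtgt_unit ract1.
Qed.

Lemma rorbit_sym : symmetric rorbit.
Proof.
suff W n n' : rorbit n n' -> rorbit n' n by move=> n n'; apply/idP/idP; apply: W.
move=> /asboolP[h [hn <-]]; apply/asboolP; exists (ginv h).
by rewrite gtgt_inv rJ_act// -ractM ?gtgt_inv// gmulV hn ract1.
Qed.

Lemma rorbit_trans : transitive rorbit.
Proof.
move=> y x z /asboolP[g [gx <-]] /asboolP[h [hg <-]]; apply/asboolP.
rewrite rJ_act// in hg; exists (gmul g h).
by rewrite gtgt_mul// ractM.
Qed.

Definition rorbit_equiv := EquivRel rorbit rorbit_refl rorbit_sym rorbit_trans.

Definition right_quotient := quotient_topology {eq_quot rorbit_equiv}.

Definition right_principal : Prop :=
  homeomorphism_on
    [set x : N * H | gtgt x.2 = rJ a x.1]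
    [set y : N * N | \pi_right_quotient y.1 = \pi_right_quotient y.2]
    (fun x : N * H => (x.1, ract a x.1 x.2)).

End right_quotient.

Record bibundle (G H : continuous_groupoid) := Bibundle {
  bispace :> topologicalType;
  bileft : left_action G bispace;
  biright : right_action H bispace;
  bi_rJ_lact : forall g n, gsrc g = lJ bileft n ->
    rJ biright (lact bileft g n) = rJ biright n;
  bi_lJ_ract : forall n h, gtgt h = rJ biright n ->
    lJ bileft (ract biright n h) = lJ bileft n;
  bi_commute : forall g n h, gsrc g = lJ bileft n -> gtgt h = rJ biright n ->
    ract biright (lact bileft g n) h = lact bileft g (ract biright n h)
}.

(* The moment maps are invariant, so evaluating them at representatives gives *)
(* the maps they induce on the quotients.                                     *)
Definition is_morita (G H : continuous_groupoid) (N : bibundle G H) : Prop :=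
  [/\ left_principal (bileft N),
      right_principal (biright N),
      homeomorphism
        (fun q : right_quotient (biright N) => lJ (bileft N) (repr q))
    & homeomorphism
        (fun q : left_quotient (bileft N) => rJ (biright N) (repr q))].

Definition morita_equivalent (G H : continuous_groupoid) : Prop :=
  exists N : bibundle G H, is_morita N.

Definition left_dirac (R : realType) (G : continuous_groupoid)
    (lam : right_haar_system R G) (N : topologicalType) (a : left_action G N) :
    Prop :=
  forall n : N, exists delta : nat -> N -> R,
    let d k (g : borel (src_fiber (lJ a n))) := delta k (lact a (set_val g) n) in
    [/\ forall k n', lJ a n' = lJ a n -> 0 <= delta k n',
        forall k, measurable_fun [set: borel (src_fiber (lJ a n))] (d k),
        forall k, (\int[lam (lJ a n)]_(g in [set: borel (src_fiber (lJ a n))])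
                     (d k g)%:E = 1)%E
      & forall U : set (src_fiber (lJ a n)), open U -> U (src_fiber1 (lJ a n)) ->
        forall eps : R, 0 < eps -> exists K : nat, forall k, (K < k)%N ->
        (\int[lam (lJ a n)]_(g in ~` (U : set (borel (src_fiber (lJ a n)))))
            (d k g)%:E < eps%:E)%E].

Definition right_dirac (R : realType) (H : continuous_groupoid)
    (lam : right_haar_system R H) (N : topologicalType) (a : right_action H N) :
    Prop :=
  forall n : N, exists delta : nat -> N -> R,
    let d k (h : borel (tgt_fiber (rJ a n))) := delta k (ract a n (set_val h)) in
    [/\ forall k n', rJ a n' = rJ a n -> 0 <= delta k n',
        forall k, measurable_fun [set: borel (tgt_fiber (rJ a n))] (d k),
        forall k, (\int[inverse_haar lam (rJ a n)]_(h in
                     [set: borel (tgt_fiber (rJ a n))]) (d k h)%:E = 1)%E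
      & forall U : set (tgt_fiber (rJ a n)), open U -> U (tgt_fiber1 (rJ a n)) ->
        forall eps : R, 0 < eps -> exists K : nat, forall k, (K < k)%N ->
        (\int[inverse_haar lam (rJ a n)]_(h in
            ~` (U : set (borel (tgt_fiber (rJ a n))))) (d k h)%:E < eps%:E)%E].

Record hilbert (R : realType) := Hilbert {
  hcarrier :> completeNormedModType R[i];
  hdot : {dot hcarrier for Num.conj};
  hdot_norm : forall v, hdot v v = `|v| ^+ 2
}.

(* The norm of a normed module over R[i] takes values in R[i]. *)
Definition hnorm (R : realType) (E : hilbert R) (v : E) : R := complex.Re `|v|.

Definition C0 (R : realType) (M : topologicalType) (f : M -> R) : Prop :=
  continuous f /\
  forall eps : R, 0 < eps ->
    exists2 K : set M, compact K & forall m, ~ K m -> `|f m| < eps.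

(* field_closed is local uniform closure among the sections whose norm lies   *)
(* in C_0(M). Without that restriction it would clash with field_C0 over a    *)
(* noncompact base: for the trivial line field over the real line it would    *)
(* put the constant section 1 in field_sec.                                   *)
Record hilbert_field (R : realType) (M : topologicalType) := HilbertField {
  field_fiber :> M -> hilbert R;
  field_sec : set (forall m, field_fiber m);
  field_sec0 : field_sec (fun=> 0);
  field_secD : forall xi eta, field_sec xi -> field_sec eta ->
    field_sec (fun m => xi m + eta m);
  field_secZ : forall (c : R[i]) xi, field_sec xi ->
    field_sec (fun m => c *: xi m);
  field_full : forall m (v : field_fiber m), exists2 xi, field_sec xi & xi m = v;
  field_C0 : forall xi, field_sec xi -> C0 (fun m => hnorm (xi m));
  field_closed : forall xi : forall m, field_fiber m,
    C0 (fun m => hnorm (xi m)) ->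
    (forall eps : R, 0 < eps -> forall m : M, exists2 eta, field_sec eta &
       \forall n \near m, hnorm (xi n - eta n) < eps) ->
    field_sec xi
}.

(* A record rather than {m : M & E m}, whose canonical topology is that of    *)
(* the disjoint union.                                                        *)
Record total_space (R : realType) (M : topologicalType) (E : hilbert_field R M) :=
  Total { total_pt : M; total_vec : E total_pt }.

Section hnorm_theory.
Variables (R : realType) (E : hilbert R).
Implicit Types u v : E.

Lemma hnormE v : (hnorm v)%:C = `|v|.
Proof. by rewrite /hnorm RRe_real. Qed.

Lemma hnorm_le u (r : R) : (hnorm u <= r) = (`|u| <= r%:C).
Proof. by rewrite -hnormE lecR. Qed.

Lemma hnorm_ge0 v : 0 <= hnorm v.
Proof. by rewrite -lecR hnormE (normr_ge0 v). Qed.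

Lemma hnorm0 : hnorm (0 : E) = 0.
Proof. by rewrite /hnorm normr0. Qed.

Lemma hnormD u v : hnorm (u + v) <= hnorm u + hnorm v.
Proof. by rewrite hnorm_le rmorphD/= !hnormE ler_normD. Qed.

Lemma hnorm_eq0 v : hnorm v = 0 -> v = 0.
Proof. by move=> v0; apply/eqP; rewrite -normr_eq0 -hnormE v0. Qed.

Lemma hnormZ (r : R) v : 0 <= r -> hnorm (r%:C *: v) = r * hnorm v.
Proof.
move=> r0; apply: (@complexI R); rewrite rmorphM/= !hnormE normrZ.
by rewrite ger0_norm// lecR.
Qed.

End hnorm_theory.

Section total_topology.
Variables (R : realType) (M : topologicalType) (E : hilbert_field R M).

HB.instance Definition _ := gen_eqMixin (total_space E).
HB.instance Definition _ := gen_choiceMixin (total_space E).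

Definition tube (eps : R) (xi : forall m, E m) (V : set M) :
    set (total_space E) :=
  [set h | V (total_pt h) /\ hnorm (total_vec h - xi (total_pt h)) < eps].

(* The topology with basis the tubes over open sets around sections of E.     *)
Definition total_open (A : set (total_space E)) : Prop :=
  forall h, A h -> exists eps xi V,
    [/\ 0 < eps, field_sec xi, open V, tube eps xi V h & tube eps xi V `<=` A].

Lemma total_openT : total_open setT.
Proof.
move=> [m v] _; have [xi sxi xim] := field_full v.
exists 1, xi, setT; split => //; first exact: openT.
by split => //=; rewrite xim subrr hnorm0.
Qed.

Lemma tube_shrink (eps : R) xi V (m : M) (v : E m) eta :
  field_sec xi -> open V -> tube eps xi V (Total v) ->
  field_sec eta -> eta m = v ->
  exists2 d : R, 0 < d & exists2 W : set M, open_nbhs m W &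
    tube d eta W `<=` tube eps xi V.
Proof.
move=> sxi oV [/= Vm veps] seta etam.
pose s x : R := hnorm (eta x - xi x).
have /(_ m) cs : continuous s.
  have sN : field_sec (fun x => eta x - xi x).
    have -> : (fun x => eta x - xi x) = (fun x => eta x + (-1) *: xi x).
      by apply: functional_extensionality_dep => x; rewrite scaleN1r.
    by apply: field_secD => //; exact: field_secZ.
  by have [] := field_C0 sN.
pose d := (eps - s m) / 2.
have sm : s m < eps by rewrite /s etam.
have d0 : 0 < d by rewrite divr_gt0// subr_gt0.
exists d => //.
have : nbhs m (V `&` [set x | s x < s m + d]).
  apply: filterI; first exact: open_nbhs_nbhs.
  apply: (cs [set y : R | y < s m + d]); apply: open_nbhs_nbhs.
  by split; [exact: open_lt|rewrite /= ltrDl].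
rewrite nbhsE => -[W oW WV]; exists W => //.
move=> [x w] [/= /WV[/= Vx sx] wd]; split => //=.
have -> : w - xi x = (w - eta x) + (eta x - xi x) by rewrite addrA subrK.
apply: le_lt_trans (hnormD _ _) _; rewrite -/(s x).
apply: (@lt_le_trans _ _ (d + (s m + d))); first exact: ltrD.
by rewrite addrCA -mulr2n -mulr_natr /d divfK// addrC subrK.
Qed.

Lemma total_openI : setI_closed total_open.
Proof.
move=> A B oA oB [m v] [Ah Bh].
have [e1 [x1 [V1 [_ s1 o1 t1 A1]]]] := oA _ Ah.
have [e2 [x2 [V2 [_ s2 o2 t2 B2]]]] := oB _ Bh.
have [eta seta etam] := field_full v.
have [d1 d10 [W1 [oW1 W1m] tW1]] := tube_shrink s1 o1 t1 seta etam.
have [d2 d20 [W2 [oW2 W2m] tW2]] := tube_shrink s2 o2 t2 seta etam.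
exists (Num.min d1 d2), eta, (W1 `&` W2); split => //.
- by rewrite lt_min d10.
- exact: openI.
- by split => //=; rewrite etam subrr hnorm0 lt_min d10.
- move=> h [[W1h W2h]]; rewrite lt_min => /andP[hd1 hd2].
  by split; [apply/A1/tW1|apply/B2/tW2].
Qed.

Lemma total_open_bigU (I : Type) (f : I -> set (total_space E)) :
  (forall i, total_open (f i)) -> total_open (\bigcup_i f i).
Proof.
move=> of_ h [i _ /of_[e [xi [V [e0 sxi oV tV tf]]]]].
by exists e, xi, V; split => // h' /tf ?; exists i.
Qed.

HB.instance Definition _ := isOpenTopological.Build (total_space E)
  total_openT total_openI total_open_bigU.

End total_topology.

Record category := Category {
  obj :> Type;
  hom : obj -> obj -> Type;
  idm : forall x, hom x x;
  comp : forall x y z, hom y z -> hom x y -> hom x z;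
  comp1m : forall x y (f : hom x y), comp (idm y) f = f;
  compm1 : forall x y (f : hom x y), comp f (idm x) = f;
  compA : forall x y z w (f : hom z w) (g : hom y z) (h : hom x y),
    comp f (comp g h) = comp (comp f g) h
}.

Record functor (C D : category) := Functor {
  fobj :> C -> D;
  fmap : forall x y, hom x y -> hom (fobj x) (fobj y);
  fmap1 : forall x, fmap (idm x) = idm (fobj x);
  fmapM : forall x y z (f : hom y z) (g : hom x y),
    fmap (comp f g) = comp (fmap f) (fmap g)
}.

Definition functor_id (C : category) : functor C C :=
  @Functor C C id (fun _ _ f => f) (fun=> erefl) (fun _ _ _ _ _ => erefl).

Definition functor_comp (C D E : category) (K : functor D E) (F : functor C D) :
  functor C E :=
  @Functor C E (fun x => K (F x)) (fun x y f => fmap K (fmap F f))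
    (fun x => etrans (congr1 (@fmap _ _ K _ _) (fmap1 F x)) (fmap1 K (F x)))
    (fun x y z f g => etrans (congr1 (@fmap _ _ K _ _) (fmapM F f g))
                             (fmapM K (fmap F f) (fmap F g))).

Definition naturally_isomorphic (C D : category) (F K : functor C D) : Prop :=
  exists (eta : forall x, hom (F x) (K x)) (eta' : forall x, hom (K x) (F x)),
    [/\ forall x y (f : hom x y),
          comp (eta y) (fmap F f) = comp (fmap K f) (eta x),
        forall x, comp (eta' x) (eta x) = idm (F x)
      & forall x, comp (eta x) (eta' x) = idm (K x)].

Definition equivalent_categories (C D : category) : Prop :=
  exists (F : functor C D) (K : functor D C),
    naturally_isomorphic (functor_comp K F) (functor_id C) /\
    naturally_isomorphic (functor_comp F K) (functor_id D).

Definition unitary (R : realType) (E F : hilbert R) (f : E -> F) : Prop :=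
  [/\ linear f, bijective f & forall u v, hdot F (f u) (f v) = hdot E u v].

Definition opnorm (R : realType) (E F : hilbert R) (f : E -> F) : \bar R :=
  ereal_sup [set (hnorm (f v))%:E | v in [set v : E | hnorm v <= 1]].

(* pi g, with its domain and codomain transported along equalities of base    *)
(* points.                                                                    *)
Definition pi_at (R : realType) (G : continuous_groupoid)
    (E : hilbert_field R (gbase G)) (pi : forall g : G, E (gsrc g) -> E (gtgt g))
    (g : G) (x y : gbase G) (sx : gsrc g = x) (ty : gtgt g = y) : E x -> E y :=
  match sx in _ = x', ty in _ = y' return E x' -> E y' with
  | erefl, erefl => pi g
  end.

(* The domain {(g, h) | s(g) = p(h)} of the action on the total space, coded  *)
(* as pairs of g and a vector over s(g), with the topology induced from the   *)
(* product of G and the total space.                                          *)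
Section action_domain.
Variables (R : realType) (G : continuous_groupoid) (E : hilbert_field R (gbase G)).

Definition action_domain_incl (x : {g : G & E (gsrc g)}) : G * total_space E :=
  (projT1 x, Total (projT2 x)).

Definition action_domain := initial_topology action_domain_incl.
HB.instance Definition _ := Topological.on action_domain.

End action_domain.

Record representation (R : realType) (G : continuous_groupoid) := Representation {
  rep_field :> hilbert_field R (gbase G);
  rep_pi : forall g : G, rep_field (gsrc g) -> rep_field (gtgt g);
  rep_unitary : forall g, unitary (@rep_pi g);
  rep_unit : forall m (v : rep_field m),
    pi_at rep_pi (gsrc_unit m) (gtgt_unit m) v = v;
  rep_mul : forall g h (gh : gsrc g = gtgt h) (v : rep_field (gsrc h)),
    pi_at rep_pi (gsrc_mul gh) (gtgt_mul gh) v =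
    pi_at rep_pi gh erefl (rep_pi v);
  rep_inv : forall g,
    cancel (@rep_pi g) (pi_at rep_pi (gsrc_inv g) (gtgt_inv g)) /\
    cancel (pi_at rep_pi (gsrc_inv g) (gtgt_inv g)) (@rep_pi g);
  rep_continuous : continuous (fun x : action_domain rep_field =>
    Total (rep_pi (projT2 x)) : total_space rep_field)
}.

Record rep_hom (R : realType) (G : continuous_groupoid)
    (E F : representation R G) := RepHom {
  rh_map :> forall m, E m -> F m;
  rh_linear : forall m, linear (@rh_map m);
  rh_sec : forall xi, field_sec xi -> field_sec (fun m => rh_map (xi m));
  rh_locally_bounded : forall m : gbase G, exists C : R,
    \forall n \near m, (opnorm (@rh_map n) <= C%:E)%E;
  rh_intertwine : forall (g : G) (v : E (gsrc g)),
    rh_map (rep_pi v) = rep_pi (rh_map v)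
}.

Section rep_category.
Variables (R : realType) (G : continuous_groupoid).
Implicit Types E F K L : representation R G.

Lemma rep_hom_eq E F (f f' : rep_hom E F) :
  (forall m (v : E m), f m v = f' m v) -> f = f'.
Proof.
move=> ff'; have e : rh_map f = rh_map f'.
  apply: functional_extensionality_dep => m.
  by apply: functional_extensionality_dep => v.
move: e {ff'}; case: f => f1 l1 s1 b1 i1; case: f' => f2 l2 s2 b2 i2 /= e; subst f2.
by congr RepHom; exact: Prop_irrelevance.
Qed.

Lemma opnorm_id (E : hilbert R) : (opnorm (fun v : E => v) <= 1%:E)%E.
Proof. by apply: ge_ereal_sup => _ [v /= v1 <-]; rewrite lee_fin. Qed.

Lemma opnorm_bound (E F : hilbert R) (f : E -> F) (C : R) (v : E) :
  linear f -> (opnorm f <= C%:E)%E -> hnorm (f v) <= C * hnorm v.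
Proof.
move=> lf fC.
have f0 : f 0 = 0 by have := lf (-1) 0 0; rewrite scaler0 addr0 scaleN1r addNr.
have fZ c u : f (c *: u) = c *: f u.
  by have := lf c u 0; rewrite !addr0 f0 addr0.
have [/hnorm_eq0 ->|v0] := eqVneq (hnorm v) 0; first by rewrite f0 !hnorm0 mulr0.
have vp : 0 < hnorm v by rewrite lt_neqAle eq_sym v0 hnorm_ge0.
have : hnorm (f ((hnorm v)^-1%:C *: v)) <= C.
  rewrite -lee_fin; apply: le_trans fC; apply: ereal_sup_ubound.
  by exists ((hnorm v)^-1%:C *: v) => //=; rewrite hnormZ ?invr_ge0 ?hnorm_ge0// mulVf.
by rewrite fZ hnormZ ?invr_ge0 ?hnorm_ge0// mulrC ler_pdivrMr.
Qed.

Lemma opnorm_comp (E F K : hilbert R) (f : F -> K) (g : E -> F) (C D : R) :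
  linear f -> 0 <= C -> (opnorm f <= C%:E)%E -> (opnorm g <= D%:E)%E ->
  (opnorm (f \o g) <= (C * D)%:E)%E.
Proof.
move=> lf C0 fC gD; apply: ge_ereal_sup => _ [v /= v1 <-]; rewrite lee_fin.
apply: le_trans (opnorm_bound _ lf fC) _; apply: ler_wpM2l => //.
by rewrite -lee_fin; apply: le_trans gD; apply: ereal_sup_ubound; exists v.
Qed.

Program Definition rep_id E : rep_hom E E := @RepHom R G E E (fun _ v => v) _ _ _ _.
Next Obligation. by []. Qed.
Next Obligation. by []. Qed.
Next Obligation. by exists 1; near=> n; exact: opnorm_id. Unshelve. all: by end_near. Qed.
Next Obligation. by []. Qed.

Program Definition rep_comp E F K (f : rep_hom F K) (g : rep_hom E F) :
  rep_hom E K := @RepHom R G E K (fun m v => f m (g m v)) _ _ _ _.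
Next Obligation. by move=> E F K f g m c u v; rewrite !rh_linear. Qed.
Next Obligation. by move=> E F K f g xi sxi; do 2!apply: rh_sec. Qed.
Next Obligation.
move=> E F K f g m.
have [C fC] := rh_locally_bounded f m; have [D gD] := rh_locally_bounded g m.
exists (Num.max 0 C * D); near=> n; apply: opnorm_comp.
- exact: rh_linear.
- by rewrite le_max lexx.
- apply: (@le_trans _ _ C%:E); first by near: n.
  by rewrite lee_fin le_max lexx orbT.
- by near: n.
Unshelve. all: by end_near. Qed.
Next Obligation. by move=> E F K f g h v; rewrite /= (rh_intertwine g) (rh_intertwine f). Qed.

Lemma rep_comp1m E F (f : rep_hom E F) : rep_comp (rep_id F) f = f.
Proof. exact: rep_hom_eq. Qed.

Lemma rep_compm1 E F (f : rep_hom E F) : rep_comp f (rep_id E) = f.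
Proof. exact: rep_hom_eq. Qed.

Lemma rep_compA E F K L (f : rep_hom K L) (g : rep_hom F K) (h : rep_hom E F) :
  rep_comp f (rep_comp g h) = rep_comp (rep_comp f g) h.
Proof. exact: rep_hom_eq. Qed.

Definition Rep : category := Category rep_comp1m rep_compm1 rep_compA.

End rep_category.

(* Main.v *)
(* Turn both actions on the Morita bibundle N into left actions; each moment map is then the
   orbit map of the other action.  A representation E of H is transferred to G by descending its
   pullback to N: the fibre over x is the fibre of E over J_H(n) for a chosen n above x, the
   choices being identified by the division map of the principal action, and a section is
   continuous when its lift to N is.  The hard point is that every vector is the value of a
   continuous section: averaging phi(h n) pi(h)^-1 xi(t h) over the source fibre of H, with phi a
   bump function near n, gives equivariant sections with dense values, and a series makes the
   value exact.  The Dirac sequences serve only to give the Haar measures full support, so that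
   the source maps and the orbit maps are open and N is locally compact.  Transferring to H and
   back to G moves each fibre by the element of G relating the two chosen points, which is a
   natural unitary isomorphism. *)

Require Import Defs.
From mathcomp Require Import all_boot all_order all_algebra.
From mathcomp Require Import sesquilinear generic_quotient complex.
From mathcomp Require Import all_classical all_reals all_analysis.
From mathcomp Require Import measurable_realfun ring lra.
Import Defs.

Set Implicit Arguments.
Unset Strict Implicit.
Unset Printing Implicit Defensive.

Import Order.TTheory GRing.Theory Num.Theory.
Import numFieldNormedType.Exports.

Local Open Scope classical_set_scope.
Local Open Scope ring_scope.
Local Open Scope complex_scope.

(** * Approximation by continuous sections *)

(** No vector-valued integral is constructed: the average is defined weakly, by real pairings with
    continuous sections, and exists because finite sums from a partition of unity approximate it and
    the fibres are complete. Continuity into a total space is replaced by local uniform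
    approximability by sections, which survives limits. It is tested on N, since the choice of
    points above the base is arbitrary and in general discontinuous; openness of the orbit maps
    brings the estimates back down. Sections must have norm in C_0. Hence equivariant sections are
    built with compact support modulo the action, and morphisms, only locally bounded by definition,
    must be shown globally bounded before they can be transferred. Fibres over provably equal base
    points are distinct types, so the action is used with free endpoints and explicit equations;
    each coherence statement then becomes an identity between divisions in the groupoid. Everything
    is stated for a left principal action, so one transfer and one round-trip lemma serve both
    directions. *)

Section hilbert_theory.
Variables (R : realType) (E : hilbert R).
Implicit Types u v w : E.

(** The real part already determines the norm and separates vectors, and it keeps every integral
    real-valued. *)
Definition rdot u v : R := complex.Re (hdot E u v).

Lemma rdotDl u v w : rdot (u + v) w = rdot u w + rdot v w.
Proof. by rewrite /rdot linearDl raddfD. Qed.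

Lemma rdot0l v : rdot 0 v = 0.
Proof. by rewrite /rdot linear0l. Qed.

Lemma rdotC u v : rdot u v = rdot v u.
Proof. by rewrite /rdot hermC/= mul1r; case: (hdot E v u). Qed.

Lemma rdotDr u v w : rdot w (u + v) = rdot w u + rdot w v.
Proof. by rewrite rdotC rdotDl !(rdotC w). Qed.

Lemma rdotZl (r : R) u v : rdot (r%:C *: u) v = r * rdot u v.
Proof. by rewrite /rdot linearZl_LR/=; case: (hdot E u v) => a b/=; ring. Qed.

Lemma rdotNl u v : rdot (- u) v = - rdot u v.
Proof. by rewrite /rdot linearNl raddfN. Qed.

Lemma rdotBl u v w : rdot (u - v) w = rdot u w - rdot v w.
Proof. by rewrite rdotDl rdotNl. Qed.

Lemma rdot_sq v : rdot v v = hnorm v ^+ 2.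
Proof.
by apply: (@complexI R); rewrite rmorphXn/= hnormE -hdot_norm RRe_real// hdot_norm
  rpredX// ger0_real// normr_ge0.
Qed.

Lemma hnormN v : hnorm (- v) = hnorm v.
Proof. by rewrite /hnorm normrN. Qed.

Lemma hnormBC u v : hnorm (u - v) = hnorm (v - u).
Proof. by rewrite -hnormN opprB. Qed.

Lemma hnormB u v : hnorm (u - v) <= hnorm u + hnorm v.
Proof. by have := hnormD u (- v); rewrite hnormN. Qed.

Lemma hnormB_tri w u v : hnorm (u - v) <= hnorm (u - w) + hnorm (w - v).
Proof. by have := hnormD (u - w) (w - v); rewrite subrKA. Qed.

Lemma hnorm_dist u v : `|hnorm u - hnorm v| <= hnorm (u - v).
Proof.
have h1 : hnorm u <= hnorm (u - v) + hnorm v by have := hnormD (u - v) v; rewrite subrK.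
have h2 : hnorm v <= hnorm (v - u) + hnorm u by have := hnormD (v - u) u; rewrite subrK.
by rewrite hnormBC in h2; rewrite ler_norml; apply/andP; split; lra.
Qed.

Lemma hnormZc (c : R[i]) v : hnorm (c *: v) = complex.Re `|c| * hnorm v.
Proof.
apply: (@complexI R); rewrite rmorphM/= !hnormE normrZ; congr (_ * _).
Qed.

Lemma hnormZr (r : R) v : hnorm (r%:C *: v) = `|r| * hnorm v.
Proof.
rewrite hnormZc; congr (_ * _); apply: (@complexI R).
by rewrite RRe_real ?ger0_real ?normr_ge0// normc_def/= expr0n/= addr0 sqrtr_sqr.
Qed.

Lemma rdot_le u v : rdot u v <= hnorm u * hnorm v.
Proof.
have : hnorm (u + v) ^+ 2 <= (hnorm u + hnorm v) ^+ 2.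
  by rewrite ler_pXn2r ?nnegrE ?addr_ge0 ?hnorm_ge0// hnormD.
rewrite -rdot_sq rdotDl !rdotDr !rdot_sq (rdotC v u) => h; nra.
Qed.

Lemma rdot_abs u v : `|rdot u v| <= hnorm u * hnorm v.
Proof.
rewrite ler_norml rdot_le andbT lerNl -rdotNl.
by rewrite -(hnormN u) rdot_le.
Qed.

Lemma rdot_ext u v : (forall w, rdot u w = rdot v w) -> u = v.
Proof.
move=> uv; apply/eqP; rewrite -subr_eq0; apply/eqP/hnorm_eq0/eqP.
by rewrite -sqrf_eq0 -rdot_sq rdotBl uv subrr.
Qed.

(** Test on [w] itself. Norm bounds for vectors known only through their pairings are obtained in
    this way. *)
Lemma hnorm_le_weak w (r : R) : 0 <= r -> (forall u, rdot w u <= r * hnorm u) ->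
  hnorm w <= r.
Proof.
move=> r0 /(_ w); rewrite rdot_sq expr2.
have [-> //|w0] := eqVneq (hnorm w) 0.
by rewrite ler_pM2r// lt_neqAle eq_sym w0 hnorm_ge0.
Qed.

Lemma hnorm_sum (I : Type) (s : seq I) (F : I -> E) :
  hnorm (\sum_(i <- s) F i) <= \sum_(i <- s) hnorm (F i).
Proof.
elim/big_ind2 : _ => //; first by rewrite hnorm0.
by move=> x a y b xa yb; apply: le_trans (hnormD _ _) _; exact: lerD.
Qed.

Lemma rdot_suml (I : Type) (s : seq I) (F : I -> E) v :
  rdot (\sum_(i <- s) F i) v = \sum_(i <- s) rdot (F i) v.
Proof.
elim/big_ind2 : _ => //; first by rewrite /rdot linear0l.
by move=> x a y b <- <-; rewrite rdotDl.
Qed.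

(** Completeness with a rate: letting the second index tend to infinity leaves the error [e k] for
    the limit. *)
Lemma hilbert_complete (w : nat -> E) (e : nat -> R) :
  e k @[k --> \oo] --> 0 -> (forall i j, hnorm (w i - w j) <= e i + e j) ->
  exists l, forall k, hnorm (w k - l) <= e k.
Proof.
move=> /cvgrPdist_lt e0 we.
have cw : cauchy (w @ \oo).
  apply: cauchy_exP => eps eps0.
  (* The norm takes values in [R[i]], so a positive radius is a complex number that happens to be
     real. *)
  have epsr : eps = (complex.Re eps)%:C by rewrite RRe_real// gtr0_real.
  rewrite epsr ltcR in eps0.
  have e2 : 0 < complex.Re eps / 2 by rewrite divr_gt0.
  have [N _ Ne] := e0 _ e2.
  exists (w N), N => // k /= Nk; rewrite -ball_normE/= epsr -hnormE ltcR.
  apply: le_lt_trans (we _ _) _.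
  have := Ne _ Nk; have := Ne N (leqnn N) => /=.
  by rewrite !sub0r !normrN !ltr_norml => /andP[_ h1] /andP[_ h2]; lra.
have [l wl] : exists l : E, w @ \oo --> l.
  by exists (lim (w @ \oo)); apply/cauchy_cvgP.
exists l => k; apply/ler_addgt0Pr => eps eps0.
have e2 : 0 < eps / 2 by rewrite divr_gt0.
have [N1 _ h1] := e0 _ e2.
have e2c : 0 < (eps / 2)%:C by rewrite ltcR.
move/cvgrPdist_lt : wl => /(_ _ e2c)[N2 _ h2].
have := h1 _ (leq_maxl N1 N2); have := h2 _ (leq_maxr N1 N2) => /=.
set N := maxn N1 N2.
rewrite -hnormE ltcR sub0r normrN ltr_norml => lN /andP[_ eN].
have := we k N; have := hnormB_tri (w N) (w k) l; rewrite (hnormBC (w N) l); lra.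
Qed.

End hilbert_theory.

Section approximation.
Variables (R : realType) (M : topologicalType) (E : hilbert_field R M).

(* With [F] the neighbourhood filter of a point at which [p] is continuous, this is
   continuity of [u] into the total space. *)
Definition sec_approx (X : Type) (F : set_system X) (p : X -> M) (u : forall x, E (p x)) :=
  forall eps : R, 0 < eps -> exists2 xi, field_sec xi &
    \forall x \near F, hnorm (u x - xi (p x)) < eps.
Arguments sec_approx {X} F p u.

Context (X : Type) (F : set_system X) {FF : Filter F} (p : X -> M).
Implicit Types u v : forall x, E (p x).

Lemma C0_bounded (T : topologicalType) (f : T -> R) : C0 f ->
  exists C, forall x, `|f x| <= C.
Proof.
move=> [cf /(_ 1 ltr01)[K cK Kf]].
have : compact (f @` K) by apply: continuous_compact => //; exact: continuous_subspaceT.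
move=> /compact_bounded[C [_ /(_ (C + 1))]].
rewrite ltrDl ltr01 => /(_ isT) CK.
exists (Num.max 1 (C + 1)) => x; rewrite le_max.
have [Kx|/Kf/ltW -> //] := pselect (K x).
by apply/orP; right; apply: CK; exists x.
Qed.

Lemma field_sec_bounded xi : @field_sec _ _ E xi -> exists C, forall m, hnorm (xi m) <= C.
Proof.
move=> /field_C0/C0_bounded[C xiC]; exists C => m.
by have := xiC m; rewrite ger0_norm ?hnorm_ge0.
Qed.

Lemma field_sec_cont xi : @field_sec _ _ E xi -> continuous (fun m => hnorm (xi m)).
Proof. by move=> /field_C0[]. Qed.

Lemma approx_sec xi : field_sec xi -> sec_approx F p (fun x => xi (p x)).
Proof.
move=> sxi eps eps0; exists xi => //.
by apply: nearW => x; rewrite subrr hnorm0.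
Qed.

Lemma approx_lim u :
  (forall eps : R, 0 < eps -> exists2 v, sec_approx F p v &
    \forall x \near F, hnorm (u x - v x) < eps) -> sec_approx F p u.
Proof.
move=> h eps eps0; have e2 : 0 < eps / 2 by rewrite divr_gt0.
have [v /(_ _ e2)[xi sxi vxi] uv] := h _ e2.
exists xi => //; near=> x; apply: le_lt_trans (hnormB_tri (v x) _ _) _.
by rewrite (splitr eps) ltrD//; near: x.
Unshelve. all: by end_near. Qed.

Lemma approxD u v : sec_approx F p u -> sec_approx F p v -> sec_approx F p (fun x => u x + v x).
Proof.
move=> au av eps eps0; have e2 : 0 < eps / 2 by rewrite divr_gt0.
have [xi sxi uxi] := au _ e2; have [eta seta veta] := av _ e2.
exists (fun m => xi m + eta m); first exact: field_secD.
near=> x; rewrite opprD addrACA; apply: le_lt_trans (hnormD _ _) _.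
by rewrite (splitr eps) ltrD//; near: x.
Unshelve. all: by end_near. Qed.

Lemma approxZ (c : R[i]) u : sec_approx F p u -> sec_approx F p (fun x => c *: u x).
Proof.
move=> au eps eps0.
have c0 : 0 <= complex.Re `|c| by rewrite -lecR RRe_real ?ger0_real ?normr_ge0.
have e2 : 0 < eps / (complex.Re `|c| + 1) by rewrite divr_gt0// ltr_wpDl.
have [xi sxi uxi] := au _ e2.
exists (fun m => c *: xi m); first exact: field_secZ.
apply: filterS uxi => x h; rewrite -scalerBr hnormZc.
apply: (@le_lt_trans _ _ ((complex.Re `|c| + 1) * hnorm (u x - xi (p x)))).
  by rewrite ler_wpM2r ?hnorm_ge0// lerDl.
by rewrite mulrC -ltr_pdivlMr// ltr_wpDl.
Qed.

Lemma approxB u v : sec_approx F p u -> sec_approx F p v -> sec_approx F p (fun x => u x - v x).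
Proof.
move=> au av.
have -> : (fun x => u x - v x) = (fun x => u x + (-1) *: v x).
  by apply: functional_extensionality_dep => x; rewrite scaleN1r.
by apply: approxD => //; exact: approxZ.
Qed.

Lemma approx_sum (I : Type) (s : seq I) (U : I -> forall x, E (p x)) :
  (forall i, sec_approx F p (U i)) -> sec_approx F p (fun x => \sum_(i <- s) U i x).
Proof.
move=> aU; elim: s => [|i s ih].
  have -> : (fun x => \sum_(j <- [::]) U j x) = (fun x => (fun=> 0 : E _) (p x)).
    by apply: functional_extensionality_dep => x; rewrite big_nil.
  exact: (approx_sec (field_sec0 E)).
have -> : (fun x => \sum_(j <- i :: s) U j x) = (fun x => U i x + \sum_(j <- s) U j x).
  by apply: functional_extensionality_dep => x; rewrite big_cons.
exact: approxD.
Qed.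

Lemma approx_bounded u : sec_approx F p u -> exists C : R, \forall x \near F, hnorm (u x) <= C.
Proof.
move=> /(_ 1 ltr01)[xi /field_sec_bounded[C xiC] uxi].
exists (1 + C); apply: filterS uxi => x /ltW h.
by rewrite -[u x](subrK (xi (p x))); apply: le_trans (hnormD _ _) _; rewrite lerD.
Qed.

(** Only the limit of [f] matters: [u] is bounded along [F], so [f x *: u x] is uniformly close to
    [l *: u x]. *)
Lemma approx_fun (f : X -> R) (l : R) u : f @ F --> l -> sec_approx F p u ->
  sec_approx F p (fun x => (f x)%:C *: u x).
Proof.
move=> /cvgrPdist_lt fl au; apply: approx_lim => eps eps0.
exists (fun x => l%:C *: u x); first exact: approxZ.
have [C uC] := approx_bounded au.
have e2 : 0 < eps / (`|C| + 1) by rewrite divr_gt0// ltr_wpDl.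
near=> x; rewrite -scalerBl -rmorphB/= hnormZr.
apply: (@le_lt_trans _ _ (`|f x - l| * (`|C| + 1))).
  rewrite ler_wpM2l// (@le_trans _ _ `|C|) ?lerDl// (le_trans _ (ler_norm _))//.
  by near: x.
by rewrite -ltr_pdivlMr ?ltr_wpDl// distrC; near: x; exact: fl.
Unshelve. all: by end_near. Qed.

Lemma approx_ext u v : (forall x, u x = v x) -> sec_approx F p u -> sec_approx F p v.
Proof. by move=> uv; have -> : v = u by apply: functional_extensionality_dep. Qed.

Variables (x0 : X).
Hypotheses (Fx0 : forall P : set X, F P -> P x0) (px0 : p @ F --> p x0).

(** The assumptions on [F] hold for [nbhs x0] and for its trace on a subset containing [x0], the two
    cases needed later. *)
Lemma approx_hnorm u : sec_approx F p u -> hnorm (u x) @[x --> F] --> hnorm (u x0).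
Proof.
move=> au; apply/cvgrPdist_lt => eps eps0.
have e3 : 0 < eps / 3 by rewrite divr_gt0.
have [xi sxi uxi] := au _ e3.
have /cvgrPdist_lt/(_ _ e3) cxi : hnorm (xi (p x)) @[x --> F] --> hnorm (xi (p x0)).
  apply: (@cvg_trans _ (hnorm (xi y) @[y --> p x0])); last exact: field_sec_cont.
  by move=> A; exact: px0.
have h0 : hnorm (u x0 - xi (p x0)) < eps / 3 by exact: Fx0 uxi.
near=> x.
have h1 : hnorm (u x - xi (p x)) < eps / 3 by near: x.
have h2 : `|hnorm (xi (p x0)) - hnorm (xi (p x))| < eps / 3 by near: x.
have := le_lt_trans (hnorm_dist _ _) h0; have := le_lt_trans (hnorm_dist _ _) h1.
by move: h2; rewrite !ltr_norml => /andP[? ?] /andP[? ?] /andP[? ?]; apply/andP; split; lra.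
Unshelve. all: by end_near. Qed.

(** The difference has a continuous norm that vanishes at [x0]. This permits replacing an
    approximating section by any other with the same value at the point. *)
Lemma approx_near u v (eps : R) : sec_approx F p u -> sec_approx F p v -> u x0 = v x0 ->
  0 < eps ->
  \forall x \near F, hnorm (u x - v x) < eps.
Proof.
move=> au av uv eps0; have /cvgrPdist_lt/(_ _ eps0) := approx_hnorm (approxB au av).
apply: filterS => x; rewrite uv subrr hnorm0 sub0r normrN.
by rewrite ger0_norm ?hnorm_ge0.
Qed.

End approximation.
Arguments sec_approx {R M E X} F p u.

(** * Total spaces and unitary representations *)

Lemma cvg_initial (S : choiceType) (T : topologicalType) (f : S -> T) (X : Type)
    (F : set_system X) {FF : Filter F} (g : X -> S) (s : initial_topology f) :
  (f \o g) @ F --> f s -> g @ F --> s.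
Proof.
move=> fg A; rewrite nbhsE => -[B [[C oC <-] Cfs] CA].
have nC : nbhs (f s) C by exact: open_nbhs_nbhs.
by apply: (@filterS _ F _ _ _ _ (fg _ nC)) => x Cx; exact: CA.
Qed.

(** Products and actions are continuous only on their fibred products; convergence statements about
    them pass through this form. *)
Lemma within_continuous_cvg (T U : topologicalType) (A : set T) (f : T -> U) (X : Type)
    (F : set_system X) {FF : Filter F} (g : X -> T) (t : T) :
  {within A, continuous f} -> A t -> g @ F --> t -> (\forall x \near F, A (g x)) ->
  f (g x) @[x --> F] --> f t.
Proof.
move=> /subspace_continuousP fA At gt Ag B /(fA _ At) nB.
have {}nB : nbhs t [set y | A y -> B (f y)] by [].
by apply: (@filterS2 _ F _ _ _ _ _ Ag (gt _ nB)) => x Agx; exact.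
Qed.

Section total_space_theory.
Variables (R : realType) (M : topologicalType) (E : hilbert_field R M).

Lemma tube_open (eps : R) (xi : forall m, E m) V : 0 < eps -> field_sec xi -> open V ->
  open (tube eps xi V).
Proof.
move=> eps0 sxi oV; change (total_open (tube eps xi V)) => -[m v] th.
have [eta seta etam] := field_full v.
have [d d0 [W [oW Wm] tW]] := tube_shrink sxi oV th seta etam.
exists d, eta, W; split => //.
by split => //=; rewrite etam subrr hnorm0.
Qed.

(** By [tube_shrink], the tubes around one section through [v] already form a neighbourhood basis at
    [v]. *)
Lemma total_cvg (X : Type) (F : set_system X) {FF : Filter F} (p : X -> M)
    (u : forall x, E (p x)) (m : M) (v : E m) xi :
  field_sec xi -> xi m = v -> p @ F --> m ->
  (forall eps : R, 0 < eps -> \forall x \near F, hnorm (u x - xi (p x)) < eps) ->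
  (fun x => Total (u x)) @ F --> Total v.
Proof.
move=> sxi xim pm h A; rewrite nbhsE => -[B [oB Bv] BA].
have [e [eta [V [e0 seta oV tV tB]]]] := oB _ Bv.
have [d d0 [W [oW Wm] tW]] := tube_shrink seta oV tV sxi xim.
have nW : nbhs m W by apply: open_nbhs_nbhs; split.
have pW : F (p @^-1` W) := pm _ nW.
apply: (@filterS _ F _ _ _ _ (filterI pW (h _ d0))) => x [Wx hx].
by apply: BA; apply: tB; apply: tW; split.
Qed.

End total_space_theory.

Section representation_theory.
Variables (R : realType) (G : continuous_groupoid).

Section one_representation.
Variable E : representation R G.

(** The endpoints are free and tied to [g] by equations, so arrows can be composed without casts; by
    proof irrelevance only [g] matters. *)
Definition rho (g : G) x y (sx : gsrc g = x) (ty : gtgt g = y) : E x -> E y :=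
  pi_at (@rep_pi _ _ E) sx ty.

Lemma rho_irr g g' x y (sx : gsrc g = x) (ty : gtgt g = y) (sx' : gsrc g' = x)
    (ty' : gtgt g' = y) v : g = g' -> rho sx ty v = rho sx' ty' v.
Proof. by move=> e; subst g'; rewrite (Prop_irrelevance sx sx') (Prop_irrelevance ty ty'). Qed.

Lemma rhoE g (sx : gsrc g = gsrc g) (ty : gtgt g = gtgt g) v : rho sx ty v = rep_pi v.
Proof. by rewrite (Prop_irrelevance sx erefl) (Prop_irrelevance ty erefl). Qed.

Lemma rho_mul g h gh x y z (sg : gsrc g = y) (tg : gtgt g = z) (sh : gsrc h = x)
    (th : gtgt h = y) (s : gsrc gh = x) (t : gtgt gh = z) v : gh = gmul g h ->
  rho sg tg (rho sh th v) = rho s t v.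
Proof.
move=> e; subst gh; have gh : gsrc g = gtgt h by rewrite sg th.
subst x z; have := @rep_mul _ _ E _ _ gh v.
rewrite /rho (Prop_irrelevance (gsrc_mul gh) s) (Prop_irrelevance (gtgt_mul gh) t) => ->.
by case: y / th sg => sg; rewrite (Prop_irrelevance gh sg).
Qed.

Lemma rho_unit m g x (sx : gsrc g = x) (ty : gtgt g = x) v : g = gunit m ->
  rho sx ty v = v.
Proof.
move=> e; subst g; have mx : m = x by rewrite -sx gsrc_unit.
case: x / mx sx ty v => sx ty v; rewrite -[RHS](@rep_unit _ _ E m v) /rho.
by rewrite (Prop_irrelevance sx (gsrc_unit m)) (Prop_irrelevance ty (gtgt_unit m)).
Qed.

Lemma rhoVK g x y (sx : gsrc g = x) (ty : gtgt g = y) (sy : gsrc (ginv g) = y)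
    (tx : gtgt (ginv g) = x) v : rho sx ty (rho sy tx v) = v.
Proof.
have e : gunit (gtgt g) = gmul g (ginv g) by rewrite gmulV.
by rewrite (rho_mul _ _ _ _ (etrans (gsrc_unit _) ty) (etrans (gtgt_unit _) ty) _ e) (rho_unit _
  _ _ erefl).
Qed.

Lemma rho_unitary g x y (sx : gsrc g = x) (ty : gtgt g = y) : unitary (rho sx ty).
Proof. by subst x y; exact: rep_unitary. Qed.

Lemma rho_linear g x y (sx : gsrc g = x) (ty : gtgt g = y) : linear (rho sx ty).
Proof. by have [] := rho_unitary sx ty. Qed.

Lemma rho_dot g x y (sx : gsrc g = x) (ty : gtgt g = y) u v :
  rdot (rho sx ty u) (rho sx ty v) = rdot u v.
Proof. by have [_ _ d] := rho_unitary sx ty; rewrite /rdot d. Qed.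

Lemma rho_dotV g x y (sx : gsrc g = x) (ty : gtgt g = y) (sy : gsrc (ginv g) = y)
    (tx : gtgt (ginv g) = x) u v : rdot (rho sx ty u) v = rdot u (rho sy tx v).
Proof. by rewrite -(rho_dot sx ty u) rhoVK. Qed.

Lemma rhoD g x y (sx : gsrc g = x) (ty : gtgt g = y) u v :
  rho sx ty (u + v) = rho sx ty u + rho sx ty v.
Proof. by have := rho_linear sx ty 1 u v; rewrite !scale1r. Qed.

Lemma rho0 g x y (sx : gsrc g = x) (ty : gtgt g = y) : rho sx ty 0 = 0.
Proof. by apply/(@addrI _ (rho sx ty 0)); rewrite -rhoD !addr0. Qed.

Lemma rhoZ g x y (sx : gsrc g = x) (ty : gtgt g = y) c v :
  rho sx ty (c *: v) = c *: rho sx ty v.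
Proof. by have := rho_linear sx ty c v 0; rewrite rho0 !addr0. Qed.

Lemma rhoB g x y (sx : gsrc g = x) (ty : gtgt g = y) u v :
  rho sx ty (u - v) = rho sx ty u - rho sx ty v.
Proof. by rewrite -scaleN1r rhoD rhoZ scaleN1r. Qed.

Lemma rho_norm g x y (sx : gsrc g = x) (ty : gtgt g = y) v :
  hnorm (rho sx ty v) = hnorm v.
Proof.
apply/eqP; rewrite -(@eqrXn2 _ 2)// ?hnorm_ge0//.
by rewrite -!rdot_sq rho_dot.
Qed.

(** Continuity of the action on the total space is restricted to the map sending h to (h, xi(s(h)))
    and read in a tube around a section through the value at [h0]. *)
Lemma rho_approx_sec (h0 : G) (xi : forall m, E m) : field_sec xi ->
  sec_approx (nbhs h0) (@gtgt G) (fun h => rho (erefl (gsrc h)) (erefl (gtgt h)) (xi (gsrc h))).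
Proof.
move=> sxi eps eps0.
have [zeta szeta zetah] := field_full (rep_pi (xi (gsrc h0))).
exists zeta => //.
pose f h : action_domain E := existT _ h (xi (gsrc h)).
have cf : f h @[h --> h0] --> f h0.
  apply: (@cvg_initial _ _ (@action_domain_incl R G E) _ (nbhs h0)).
  apply: (@cvg_pair _ _ _ (nbhs h0) (nbhs h0) (nbhs (Total (xi (gsrc h0)))) _ _ _ id (fun h =>
    Total (xi (gsrc h)))); first exact: cvg_id.
  apply: (total_cvg (p := @gsrc G) (u := fun h => xi (gsrc h)) sxi) => //;
    first exact: gsrc_continuous.
  by move=> e e0; apply: nearW => x; rewrite subrr hnorm0.
have := cvg_comp _ _ cf (@rep_continuous _ _ E (f h0)).
move=> /(_ (tube eps zeta setT)).
have tz : nbhs (Total (rep_pi (xi (gsrc h0))) : total_space E) (tube eps zeta setT).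
  apply: open_nbhs_nbhs; split; first exact: (tube_open eps0 szeta openT).
  by split => //=; rewrite zetah subrr hnorm0.
by move=> /(_ tz) ht; apply: (@filterS _ (nbhs h0) _ _ _ _ ht) => h [_].
Qed.

(** The operators are isometric, so replacing [u] by a nearby section costs nothing, and for
    sections the previous lemma applies. *)
Lemma rho_approx (X : Type) (F : set_system X) {FF : Filter F} (p q : X -> gbase G)
    (c : X -> G) (cp : forall x, gsrc (c x) = p x) (cq : forall x, gtgt (c x) = q x) (h0 : G)
    (u : forall x, E (p x)) :
  c @ F --> h0 -> sec_approx F p u -> sec_approx F q (fun x => rho (cp x) (cq x) (u x)).
Proof.
move=> ch au; apply: approx_lim => eps eps0.
have [xi sxi uxi] := au _ eps0.
exists (fun x => rho (cp x) (cq x) (xi (p x))).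
  move=> e e0; have [zeta sz hz] := rho_approx_sec h0 sxi e0.
  exists zeta => //.
  apply: (@filterS _ F _ _ _ _ (ch _ hz)) => x /=.
  by move: (cp x) (cq x); case: _ /; case: _ /.
by apply: filterS uxi => x; rewrite -rhoB rho_norm.
Qed.

End one_representation.

(** Converse of [rho_approx_sec]: a vector near xi(s(g)) stays equally near after applying an
    isometry. This is how a transferred action is shown continuous. *)
Lemma rep_continuous_of_approx (E : hilbert_field R (gbase G))
    (pi : forall g : G, E (gsrc g) -> E (gtgt g)) :
  (forall g, unitary (@pi g)) ->
  (forall (g0 : G) (xi : forall m, E m), field_sec xi ->
    sec_approx (nbhs g0) (@gtgt G) (fun g => @pi g (xi (gsrc g)))) ->
  continuous (fun x : action_domain E => Total (@pi _ (projT2 x)) : total_space E).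
Proof.
move=> pu pa [g0 v0].
have [xi sxi xiv] := field_full v0.
have [zeta sz zv] := field_full (@pi _ v0).
pose z : action_domain E := existT _ g0 v0.
have ic : (@action_domain_incl R G E) @ nbhs z --> ((g0, Total v0) : G * total_space E).
  exact: (@initial_continuous _ _ (@action_domain_incl R G E) z).
have pc : (fun x : action_domain E => projT1 x) @ nbhs z --> g0.
  exact: (cvg_comp (@action_domain_incl R G E) fst ic cvg_fst).
apply: (@total_cvg _ _ _ _ (nbhs z) _ (fun x => gtgt (projT1 x)) _ _ _ zeta) => //.
  exact: (cvg_comp _ (@gtgt G) pc (gtgt_continuous (c := G) (x := g0))).
move=> eps eps0; have e2 : 0 < eps / 2 by rewrite divr_gt0.
have pxz : \forall g \near g0, hnorm (@pi g (xi (gsrc g)) - zeta (gtgt g)) < eps / 2.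
  apply: (@approx_near _ _ E _ (nbhs g0) _ (@gtgt G) g0) => //.
  - by move=> P /nbhs_singleton.
  - exact: gtgt_continuous.
  - exact: pa.
  - exact: approx_sec.
  - by rewrite xiv zv.
have h1 : \forall x \near z,
    hnorm (@pi _ (xi (gsrc (projT1 x))) - zeta (gtgt (projT1 x))) < eps / 2 := pc _ pxz.
have tz : nbhs (Total v0 : total_space E) (tube (eps / 2) xi setT).
  apply: open_nbhs_nbhs; split; first exact: (tube_open e2 sxi openT).
  by split => //=; rewrite xiv subrr hnorm0.
have tc : (fun x : action_domain E => Total (projT2 x) : total_space E) @ nbhs z --> Total v0.
  exact: (cvg_comp (@action_domain_incl R G E) snd ic cvg_snd).
have h2 : nbhs z [set x : action_domain E |
    hnorm (projT2 x - xi (gsrc (projT1 x))) < eps / 2].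
  by apply: (@filterS _ (nbhs z) _ _ _ _ (tc _ tz)) => x [].
have pB (g : G) (u v : E (gsrc g)) : @pi g (u - v) = @pi g u - @pi g v.
  by have [pl _ _] := pu g; rewrite -scaleN1r addrC pl scaleN1r addrC.
have pN (g : G) (u : E (gsrc g)) : hnorm (@pi g u) = hnorm u.
  have [_ _ pd] := pu g; apply/eqP; rewrite -(@eqrXn2 _ 2)// ?hnorm_ge0//.
  by rewrite -!rdot_sq /rdot pd.
apply: (@filterS2 _ (nbhs z) _ _ _ _ _ h1 h2) => -[g v] /= hx1 hx2.
apply: le_lt_trans (hnormB_tri (@pi g (xi (gsrc g))) _ _) _.
by rewrite (splitr eps) ltrD// -pB pN.
Qed.

End representation_theory.

(** * Integration along source fibres *)

Section borel_theory.

Lemma borel_open_measurable (X : ptopologicalType) (U : set X) :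
  open U -> measurable (U : set (borel X)).
Proof. by move=> oU; exact: sub_sigma_algebra. Qed.

Lemma borel_closed_measurable (X : ptopologicalType) (U : set X) :
  closed U -> measurable (U : set (borel X)).
Proof.
move=> cU; rewrite -[U]setCK.
by apply: (@measurableC _ (borel X)); apply: borel_open_measurable; exact: closed_openC.
Qed.

Lemma borel_continuous_measurable (R : realType) (X : ptopologicalType) (f : X -> R) :
  continuous f -> measurable_fun [set: borel X] (f : borel X -> R).
Proof.
move=> /continuousP cf; apply: (@measurability _ _ (borel X) R setT f _ (RGenOpens.measurableE
  R)).
move=> _ [_ [a [b ->] <-]]; rewrite setTI; apply: borel_open_measurable.
exact/cf/interval_open.
Qed.

Lemma borel_map_measurable (X Y : ptopologicalType) (f : X -> Y) :
  continuous f -> measurable_fun [set: borel X] (f : borel X -> borel Y).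
Proof.
move=> /continuousP cf; apply: (@measurability _ _ (borel X) (borel Y) setT f (@open Y)) => //.
by move=> _ [B oB <-]; rewrite setTI; apply: borel_open_measurable; exact: cf.
Qed.

Lemma compact_support_integrable (R : realType) (X : ptopologicalType)
    (mu : {measure set (borel X) -> \bar R}) (f : X -> R) (K : set X) :
  continuous f -> compact K -> closed K -> (mu K < +oo)%E ->
  (forall x, f x != 0 -> K x) -> mu.-integrable [set: borel X] (EFin \o f).
Proof.
move=> cf cK clK muK fK.
have mK := borel_closed_measurable clK.
have : compact (f @` K) by apply: continuous_compact => //; exact: continuous_subspaceT.
move=> /compact_bounded[C [_ /(_ (`|C| + 1))]].
(* [compact_bounded] asks for a bound exceeding [C]; this one is also nonnegative, as domination by
   an indicator requires. *)
have C1 : C < `|C| + 1 by rewrite (le_lt_trans (ler_norm _))// ltrDl.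
move=> /(_ C1) CK.
have mf := borel_continuous_measurable cf.
apply: (@le_integrable _ _ _ mu _ measurableT _
  (fun x => (`|C| + 1)%:E * (\1_K x)%:E)%E).
- exact/measurable_EFinP.
- move=> x _; rewrite -EFinM !abse_EFin lee_fin indicE.
  have [/eqP fx0|/fK Kx] := boolP (f x == 0); first by rewrite fx0 normr0.
  by rewrite mem_set// mulr1 [leRHS]ger0_norm ?addr_ge0//; apply: CK; exists x.
- apply: integrableZl => //; apply/integrableP; split.
    by apply/measurable_EFinP; exact: measurable_indic.
  rewrite (eq_integral (fun x : borel X => (\1_(K : set (borel X)) x)%:E));
    first by rewrite integral_indic// setIT.
  by move=> x _; rewrite gee0_abs// lee_fin indicE.
Qed.

(** Chebyshev's inequality on the open set where [f] exceeds half its value at [x0]. *)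
Lemma integral_gt0_open (R : realType) (X : ptopologicalType)
    (mu : {measure set (borel X) -> \bar R}) (f : X -> R) (x0 : X) :
  continuous f -> mu.-integrable [set: borel X] (EFin \o f) ->
  (forall x, 0 <= f x) -> 0 < f x0 ->
  (forall U : set X, open U -> U x0 -> mu U != 0%E) ->
  0 < \int[mu]_(x in [set: borel X]) f x.
Proof.
move=> cf intf f0 fx0 supp.
have mf := borel_continuous_measurable cf.
pose U : set X := f @^-1` [set y | f x0 / 2 < y].
have oU : open U by move/continuousP : cf; apply; exact: open_gt.
have Ux0 : U x0 by rewrite /U/= ltr_pdivrMr// ltr_pMr// ltr1n.
have f2 : 0 < f x0 / 2 by rewrite divr_gt0.
have mu0 : (0 < mu U)%E by rewrite lt0e supp//= measure_ge0.
have mfE : measurable_fun [set: borel X] (EFin \o f) by exact/measurable_EFinP.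
have := @le_integral_abse _ _ _ mu _ measurableT (EFin \o f) (f x0 / 2) mfE f2.
have -> : (\int[mu]_(x in [set: borel X]) `|(EFin \o f) x|)%E =
    (\int[mu]_(x in [set: borel X]) (f x)%:E)%E.
  by apply: eq_integral => x _ /=; rewrite ger0_norm.
move=> h; rewrite /Rintegral fine_gt0//; apply/andP; split.
  apply: lt_le_trans h; rewrite mule_gt0// (lt_le_trans mu0)//.
  apply: le_measure; rewrite ?inE.
  - exact: borel_open_measurable.
  - apply: measurableI => //; rewrite -[X in measurable X]setTI.
    have -> : [set x | ((f x0 / 2)%:E <= `|(EFin \o f) x|)%E] = f @^-1` [set y | f x0 / 2 <= y].
      by apply/seteqP; split => x /=; rewrite lee_fin ger0_norm.
    rewrite setTI; apply: borel_closed_measurable.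
    by apply: closed_comp => [x _|]; [exact: cf|exact: closed_ge].
  - by move=> x Ux; split => //=; rewrite lee_fin ger0_norm// ltW.
by rewrite -ge0_fin_numE ?integral_ge0// => [|x _]; [exact: integrable_fin_num|rewrite lee_fin].
Qed.

(** If [U] were null, the whole unit mass would lie outside [U], against the concentration condition
    with epsilon 1. *)
Lemma dirac_full_support (R : realType) (X : ptopologicalType)
    (mu : {measure set (borel X) -> \bar R}) (d : nat -> X -> R) (U : set X) :
  (forall k, measurable_fun [set: borel X] (d k : borel X -> R)) ->
  (forall k, \int[mu]_(x in [set: borel X]) (d k x)%:E = 1)%E ->
  (exists K : nat, forall k, (K < k)%N ->
    (\int[mu]_(x in ~` (U : set (borel X))) (d k x)%:E < 1)%E) ->
  open U -> mu U != 0%E.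
Proof.
move=> md d1 [K /(_ K.+1 (ltnSn K))] dU oU; apply/eqP => U0.
have mU := borel_open_measurable oU.
have mE : measurable_fun [set: borel X] (EFin \o (d K.+1 : borel X -> R)).
  by apply/measurable_EFinP; exact: md.
have di : mu.-integrable [set: borel X] (EFin \o (d K.+1 : borel X -> R)).
  by apply/integrableP; split => //; rewrite integral_fin_num_abs// d1.
have := negligible_integral mU measurableT di U0.
by rewrite d1 setTD => h; rewrite -h ltxx in dU.
Qed.

End borel_theory.

Section haar_functional.
Variables (R : realType) (H : continuous_groupoid) (lam : right_haar_system R H).
Implicit Types (m : gbase H) (f : H -> R).

Definition haar_int m f : R :=
  \int[lam m]_(g in [set: borel (src_fiber m)]) f (set_val g).

(** Continuity and support are required on the fibre only: an integrand such as [phi (lact b h n)]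
    is meaningful only where the source of [h] is [lJ b n]. *)
Definition fib_cc m f : Prop :=
  {within [set g : H | gsrc g = m], continuous f} /\
  exists2 K : set H, compact K & forall g, gsrc g = m -> f g != 0 -> K g.

Lemma src_fiber_closed m : closed [set g : H | gsrc g = m].
Proof.
have -> : [set g : H | gsrc g = m] = @gsrc H @^-1` [set m] by [].
apply: closed_comp => [g _|]; first exact: gsrc_continuous.
by apply: accessible_closed_set1; apply: hausdorff_accessible; exact: gbase_hausdorff.
Qed.

Lemma set_val_src_continuous m : continuous (fun g : src_fiber m => set_val g).
Proof. exact: initial_continuous. Qed.

Lemma src_fiber_comp_continuous m f : {within [set g : H | gsrc g = m], continuous f} ->
  continuous (fun g : src_fiber m => f (set_val g)).
Proof.
move=> cf g; apply: (within_continuous_cvg (F := nbhs g) cf (g := fun g : src_fiber m =>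
  set_val g)
  (t := set_val g)).
- exact: (src_fiberP g).
- exact: set_val_src_continuous.
- by apply: nearW => x; exact: (src_fiberP x).
Qed.

(** A cluster point found in the arrow space lies in the fibre because source fibres are closed, the
    base being Hausdorff. *)
Lemma src_fiber_compact m (K : set H) : compact K ->
  compact ([set g | K (set_val g)] : set (src_fiber m)).
Proof.
move=> cK F PF FK.
have cKm := compact_closedI cK (src_fiber_closed (m := m)).
have FK' : (set_val @ F) (K `&` [set g : H | gsrc g = m]).
  by apply: (@filterS _ F _ _ _ _ FK) => g Kg; split => //; exact: (src_fiberP g).
have [g [[Kg gm] Fg]] := cKm _ _ FK'.
exists (src_fiber_of gm); split => // A B FA.
rewrite nbhsE => -[C [[D oD <-] Dg] CB].
have FA' : (set_val @ F) (set_val @` A) by apply: (@filterS _ F _ _ _ _ FA) => x Ax; exists x.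
have nD : nbhs g D by exact: open_nbhs_nbhs.
have [_ [[x Ax <-] Dx]] := Fg _ _ FA' nD.
by exists x; split => //; exact: CB.
Qed.

Lemma fib_integrable m f : fib_cc m f ->
  (lam m).-integrable [set: borel (src_fiber m)] (EFin \o (fun g => f (set_val g))).
Proof.
move=> [cf [K cK fK]].
have cK' := src_fiber_compact (m := m) cK.
apply: (compact_support_integrable (X := src_fiber m) (f := fun g => f (set_val g))
  (K := [set g | K (set_val g)])) => //.
- exact: src_fiber_comp_continuous.
- apply: closed_comp => [g _|]; first exact: set_val_src_continuous.
  by apply: compact_closed => //; exact: haar_hausdorff lam.
- by have [h _ _] := haar_radon lam m; exact: h.
- by move=> g; apply: fK; exact: (src_fiberP g).
Qed.

Lemma haar_intD m f (g : H -> R) : fib_cc m f -> fib_cc m g ->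
  haar_int m (fun h => f h + g h) = haar_int m f + haar_int m g.
Proof. by move=> /fib_integrable cf /fib_integrable cg; rewrite -RintegralD. Qed.

Lemma haar_intZ m (c : R) f : fib_cc m f -> haar_int m (fun h => c * f h) = c * haar_int m f.
Proof. by move=> /fib_integrable cf; rewrite -RintegralZl. Qed.

Lemma haar_int_le m f (g : H -> R) : fib_cc m f -> fib_cc m g ->
  (forall h, gsrc h = m -> f h <= g h) -> haar_int m f <= haar_int m g.
Proof.
move=> /fib_integrable cf /fib_integrable cg fg.
by apply: le_Rintegral => // h _; apply: fg; exact: (src_fiberP h).
Qed.

Lemma haar_int_eq m f (g : H -> R) : (forall h, gsrc h = m -> f h = g h) ->
  haar_int m f = haar_int m g.
Proof. by move=> fg; apply: eq_Rintegral => h _; apply: fg; exact: (src_fiberP h). Qed.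

Lemma right_translation_continuous (g : H) : continuous (@right_translation H g).
Proof.
move=> h; apply: (cvg_initial (F := nbhs h)).
have : gmul (set_val x) g @[x --> h] --> gmul (set_val h) g; last exact.
apply: (within_continuous_cvg (F := nbhs h) (@gmul_continuous H) (g := fun h :
  src_fiber (gtgt g) => (set_val h, g))
  (t := (set_val h, g))) => /=.
- exact: (src_fiberP h).
- by apply: (cvg_pair (F := nbhs h)); [exact: set_val_src_continuous|exact: cvg_cst].
- by apply: nearW => x /=; exact: (src_fiberP x).
Qed.

Lemma fib_cc_trans (g : H) f : fib_cc (gsrc g) f -> fib_cc (gtgt g) (fun h => f (gmul h g)).
Proof.
move=> [cf [K cK fK]]; split.
  apply/subspace_continuousP => h hg.
  apply: (within_continuous_cvg cf (g := fun h => gmul h g) (t := gmul h g)) => /=.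
    exact: gsrc_mul.
    apply: (within_continuous_cvg (@gmul_continuous H) (g := fun h => (h, g)) (t := (h, g))) =>
      //.
      by apply: cvg_pair => /=; [exact: cvg_within|exact: cvg_cst].
    by apply: withinT.
  by apply: (@filterS _ _ _ _ _ _ (withinT _ _)) => // x /= ?; exact: gsrc_mul.
(* If h g lies in K, then h lies in the translate by the inverse of g of the part of K on the
   fibre. *)
exists ((fun k => gmul k (ginv g)) @` (K `&` [set k : H | gsrc k = gsrc g])).
  apply: continuous_compact; last exact: (compact_closedI cK (src_fiber_closed (m := _))).
  apply/subspace_continuousP => k [Kk kg].
  apply: (within_continuous_cvg (@gmul_continuous H) (g := fun h => (h, ginv g))
    (t := (k, ginv g))) => //=.
  - by rewrite gtgt_inv.
  - by apply: cvg_pair => /=; [exact: cvg_within|exact: cvg_cst].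
  - by apply: (@filterS _ _ _ _ _ _ (withinT _ _)) => x /= [_ ->]; rewrite gtgt_inv.
move=> h hg /(fK _ (gsrc_mul hg)) Kh; exists (gmul h g).
  by split => //=; exact: gsrc_mul.
by rewrite -gmulA ?gtgt_inv// gmulV -hg gmul1.
Qed.

(** Invariance says that the measure over [gsrc g] is the image of the one over [gtgt g]; the rest
    is change of variables. *)
Lemma haar_int_trans (g : H) f : fib_cc (gsrc g) f ->
  haar_int (gtgt g) (fun h => f (gmul h g)) = haar_int (gsrc g) f.
Proof.
move=> cf; have intg := fib_integrable (fib_cc_trans cf).
pose phi : borel (src_fiber (gtgt g)) -> borel (src_fiber (gsrc g)) := @right_translation H g.
have mphi : measurable_fun setT phi.
  by apply: borel_map_measurable; exact: right_translation_continuous.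
rewrite /haar_int /Rintegral; congr fine; apply/esym.
pose mu := measure_function_pushforward__canonical__measure_function_Measure (lam (gtgt g)) mphi.
rewrite (@eq_measure_integral _ _ _ _ mu); last first.
  by move=> A mA _; rewrite -haar_invariant.
rewrite /= integral_pushforward//.
by apply/measurable_EFinP; apply: borel_continuous_measurable; apply: src_fiber_comp_continuous;
  case: cf.
Qed.

(* By right invariance, charging the neighbourhoods of the units is charging all open sets. *)
Definition full_support : Prop :=
  forall m (U : set (src_fiber m)), open U -> U (src_fiber1 m) -> lam m U != 0%E.

Lemma haar_int_gt0 m f : full_support -> fib_cc m f ->
  (forall h, gsrc h = m -> 0 <= f h) -> 0 < f (gunit m) -> 0 < haar_int m f.
Proof.
move=> fs cf f0 f1; apply: (integral_gt0_open (x0 := src_fiber1 m)) => //.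
- by apply: src_fiber_comp_continuous; case: cf.
- exact: fib_integrable.
- by move=> x; apply: f0; exact: (src_fiberP x).
- exact: fs.
Qed.

Lemma haar_int_continuous f (K : set H) : continuous f -> compact K ->
  (forall g, f g != 0 -> K g) -> continuous (fun m => haar_int m f).
Proof.
move=> cf cK fK; apply: haar_continuous => //.
apply: (subclosed_compact _ cK); first exact: closed_closure.
have -> : K = closure K.
  by apply/closure_id; apply: compact_closed => //; exact: haar_hausdorff lam.
by apply: closureS.
Qed.

End haar_functional.

(** * Principal actions *)

(** Complete regularity separates [x] from the complement of an open set that lies both in [U] and
    in a compact neighbourhood. *)
Lemma compact_bump (R : realType) (X : topologicalType) (U : set X) (x : X) :
  locally_compact [set: X] -> hausdorff_space X -> open U -> U x ->
  exists f : X -> R, [/\ continuous f, forall y, 0 <= f y <= 1, f x = 1,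
    forall y, f y != 0 -> U y & exists2 K, compact K & forall y, f y != 0 -> K y].
Proof.
move=> lcX hX oU Ux; have [C] := lcX x I; rewrite withinET => Cx [cC clC].
pose V := C° `&` U.
have oV : open V by apply: openI => //; exact: open_interior.
have Vx : V x by split.
have := @locally_compact_completely_regular X R lcX hX x (~` V) (open_closedC oV) (fun h => h Vx).
move=> /(@uniform_separatorP _ R)[f [cf f01 f0 f1]].
have fV y : 1 - f y != 0 -> V y.
  move=> fy; apply: contrapT => Vy; move/negP : fy; apply; rewrite subr_eq0 eq_sym.
  by apply/eqP; apply: f1; exists y.
exists (fun y => 1 - f y); split.
- by move=> y; apply: cvgB; [exact: cvg_cst|exact: cf].
- move=> y; have : `[0, 1]%classic (f y) by apply: f01; exists y.
  by rewrite /= in_itv/= => /andP[? ?]; apply/andP; split; lra.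
- by rewrite (f0 (f x)) ?subr0//; exists x.
- by move=> y /fV[].
- by exists C => // y /fV[+ _]; exact: interior_subset.
Qed.

Lemma compact_nbhs_in (R : realType) (X : topologicalType) (U : set X) (x : X) :
  locally_compact [set: X] -> hausdorff_space X -> open U -> U x ->
  exists K : set X, [/\ compact K, closed K, nbhs x K & K `<=` U].
Proof.
move=> lcX hX oU Ux; have [f [cf f01 fx fU [K cK fK]]] := @compact_bump R _ _ _ lcX hX oU Ux.
have cl : closed [set y | 2^-1 <= f y].
  by apply: (@closed_comp _ _ f [set y | 2^-1 <= y]) => [y _|]; [exact: cf|exact: closed_ge].
have f_gt0 y : 2^-1 <= f y -> f y != 0.
  by move=> h; rewrite gt_eqF// (lt_le_trans _ h)// invr_gt0.
exists [set y | 2^-1 <= f y]; split => //.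
- by apply: (subclosed_compact cl cK) => y /f_gt0/fK.
- have := cf x [set y | 2^-1 < y]; rewrite fx => h.
  have h1 : nbhs (1 : R) [set y | 2^-1 < y].
    apply: open_nbhs_nbhs; split; first exact: open_gt.
    by rewrite /= invf_lt1// ltr1n.
  by apply: (@filterS _ (nbhs x) _ _ _ _ (h h1)) => y /= /ltW.
- by move=> y /f_gt0/fU.
Qed.

Definition open_map (X Y : topologicalType) (f : X -> Y) :=
  forall U : set X, open U -> open (f @` U).

Lemma open_map_nbhs (X Y : topologicalType) (f : X -> Y) (x : X) (A : set X) :
  open_map f -> nbhs x A -> nbhs (f x) (f @` A).
Proof.
move=> fo; rewrite nbhsE => -[U [oU Ux] UA].
have oU' := fo _ oU.
have h : nbhs (f x) (f @` U) by apply: open_nbhs_nbhs; split => //; exists x.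
by apply: (@filterS _ (nbhs (f x)) _ _ _ _ h); exact: image_subset.
Qed.

Section open_source.
Variables (R : realType) (H : continuous_groupoid) (lam : right_haar_system R H).

Lemma fib_cc_cts (m : gbase H) (f : H -> R) (K : set H) :
  continuous f -> compact K -> (forall g, f g != 0 -> K g) -> fib_cc m f.
Proof.
move=> cf cK fK; split; first exact: continuous_subspaceT.
by exists K => // g _; exact: fK.
Qed.

(** A bump supported in [U] has positive integral over the fibre through [h0]. Positivity persists
    on nearby fibres by continuity of the Haar system, and a fibre missing [U] would have integral
    zero. *)
Lemma gsrc_open : full_support lam -> open_map (@gsrc H).
Proof.
move=> fs U oU; rewrite openE => _ [h0 Uh0 <-].
have [f [cf f01 fh0 fU [K cK fK]]] :=
  @compact_bump R _ _ _ (haar_locally_compact lam) (haar_hausdorff lam) oU Uh0.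
have cc m := fib_cc_cts m cf cK fK.
have pos : 0 < haar_int lam (gsrc h0) f.
  (* Translation moves [h0] to the unit, where full support is available. *)
  rewrite -haar_int_trans//; apply: haar_int_gt0 => //.
  - exact: fib_cc_trans.
  - by move=> h _; have /andP[] := f01 (gmul h h0).
  - by rewrite g1mul fh0.
have /(_ (gsrc h0) [set y | 0 < y]) ci := haar_int_continuous (lam := lam) cf cK fK.
have np : nbhs (haar_int lam (gsrc h0) f) [set y | 0 < y].
  by apply: open_nbhs_nbhs; split => //; exact: open_gt.
apply: (@filterS _ (nbhs (gsrc h0)) _ _ _ _ (ci np)) => m /= mpos.
apply: contrapT => Um; move: mpos.
have -> : haar_int lam m f = haar_int lam m (fun h => 0 * f h).
  apply: haar_int_eq => h hm; rewrite mul0r; apply/eqP/negPn/negP => fh.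
  by apply: Um; exists h => //; exact: fU.
by rewrite haar_intZ// mul0r ltxx.
Qed.

Lemma ginvK : involutive (@ginv H).
Proof.
move=> g; have e1 := gVmul (ginv g); have e2 := gVmul g.
have s1 : gsrc (ginv (ginv g)) = gtgt (ginv g) by rewrite gsrc_inv.
have s2 : gsrc (ginv g) = gtgt g by rewrite gsrc_inv.
have a1 : gmul (ginv (ginv g)) (gunit (gsrc g)) = ginv (ginv g).
  by rewrite -[gsrc g]gtgt_inv -gsrc_inv gmul1.
have a2 : gmul (gunit (gsrc (ginv g))) g = g by rewrite gsrc_inv g1mul.
by have := gmulA s1 s2; rewrite e1 e2 a1 a2.
Qed.

Lemma ginv_unit (m : gbase H) : ginv (gunit m) = gunit m.
Proof. by rewrite -[LHS]g1mul gtgt_inv gsrc_unit gmulV gtgt_unit. Qed.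

Lemma ginv_eq (k x : H) : gsrc k = gtgt x -> gmul k x = gunit (gsrc x) -> k = ginv x.
Proof.
move=> kx kxu; rewrite -[LHS]gmul1 kx -gmulV gmulA ?gtgt_inv// kxu -gtgt_inv.
exact: g1mul.
Qed.

Lemma ginv_mul (g h : H) : gsrc g = gtgt h -> ginv (gmul g h) = gmul (ginv h) (ginv g).
Proof.
move=> gh; have s1 : gsrc (ginv h) = gtgt (ginv g) by rewrite gsrc_inv gtgt_inv.
have s2 : gsrc (ginv g) = gtgt (gmul g h) by rewrite gsrc_inv gtgt_mul.
apply/esym/ginv_eq; first by rewrite gsrc_mul.
rewrite -gmulA// [X in gmul _ X]gmulA ?gsrc_inv// gVmul gh g1mul gVmul.
by rewrite gsrc_mul.
Qed.

End open_source.

(** Principality over an explicit base [X] in place of the orbit space. [pr_div n' n] is the unique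
    arrow taking [n] to [n']: the first component of the inverse of the principal homeomorphism. *)
Record principal (H : continuous_groupoid) (N : topologicalType) (b : left_action H N)
    (X : topologicalType) (J : N -> X) := Principal {
  pr_cont : continuous J;
  pr_surj : forall x, exists n, J n = x;
  pr_inv : forall h n, gsrc h = lJ b n -> J (lact b h n) = J n;
  pr_div : N -> N -> H;
  pr_div_src : forall n' n, J n' = J n -> gsrc (pr_div n' n) = lJ b n;
  pr_div_act : forall n' n, J n' = J n -> lact b (pr_div n' n) n = n';
  pr_div_uniq : forall h n, gsrc h = lJ b n -> pr_div (lact b h n) n = h;
  pr_div_cont : {within [set y : N * N | J y.1 = J y.2],
    continuous (fun y : N * N => pr_div y.1 y.2)};
  pr_open : open_map J
}.

Arguments pr_div_cont {H N b X J} p.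

Section principal_theory.
Variables (H : continuous_groupoid) (N : topologicalType) (b : left_action H N).
Variables (X : topologicalType) (J : N -> X) (P : principal b J).
Local Notation div := (pr_div P).

Lemma div_tgt n' n : J n' = J n -> gtgt (div n' n) = lJ b n'.
Proof. by move=> e; rewrite -[in RHS](pr_div_act P e) lJ_act// pr_div_src. Qed.

Lemma div_refl n : div n n = gunit (lJ b n).
Proof. by rewrite -[X in div X n](lact1 b) pr_div_uniq// gsrc_unit. Qed.

Lemma div_mul n'' n' n : J n'' = J n' -> J n' = J n ->
  gmul (div n'' n') (div n' n) = div n'' n.
Proof.
move=> e e'; have s : gsrc (div n'' n') = gtgt (div n' n) by rewrite pr_div_src// div_tgt.
have := pr_div_uniq P (n := n) (h := gmul (div n'' n') (div n' n)).
by rewrite lactM ?pr_div_act ?gsrc_mul ?pr_div_src ?div_tgt// => /(_ erefl).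
Qed.

Lemma div_nbhs n' n (A : set H) : J n' = J n -> nbhs (div n' n) A ->
  exists U V, [/\ open_nbhs n' U, open_nbhs n V &
    forall u v, U u -> V v -> J u = J v -> A (div u v)].
Proof.
move=> e nA; move/subspace_continuousP : (pr_div_cont P) => /(_ (n', n) e A nA).
rewrite /within/= => -[[U V] /= [nU nV] UV].
move: nU nV; rewrite !nbhsE => -[U' oU' UU'] [V' oV' VV'].
exists U', V'; split => // u v Uu Vv uv.
by apply: (UV (u, v)) => //; split; [exact: UU'|exact: VV'].
Qed.

(** Inseparable points have the same image in [X]. A point z near both shows, through its division
    by itself, that p/q and q/q are inseparable in [H], hence equal. *)
Lemma principal_hausdorff : hausdorff_space X -> hausdorff_space H -> hausdorff_space N.
Proof.
move=> hX hH p q pq.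
have e : J p = J q.
  apply: hX => A B nA nB; have [z [Az Bz]] := pq _ _ (pr_cont P nA) (pr_cont P nB).
  by exists (J z).
have : div p q = div q q.
  apply: hH => A B nA nB.
  have [U [V [oU oV UV]]] := div_nbhs e nA.
  have [U' [V' [oU' oV' UV']]] := div_nbhs erefl nB.
  have nVV : nbhs q (V `&` (U' `&` V')).
    by apply: filterI; [|apply: filterI]; exact: open_nbhs_nbhs.
  have [z [Uz [Vz [U'z V'z]]]] := pq _ _ (open_nbhs_nbhs oU) nVV.
  have dz : div z z = div z z by [].
  by exists (div z z); split; [exact: UV|exact: UV'].
by move=> d; rewrite -(pr_div_act P e) d div_refl lact1.
Qed.

Lemma lact_nbhs h n (A : set N) : gsrc h = lJ b n -> nbhs (lact b h n) A ->
  exists U V, [/\ nbhs h U, nbhs n V &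
    forall u v, U u -> V v -> gsrc u = lJ b v -> A (lact b u v)].
Proof.
move=> e nA; move/subspace_continuousP : (@lact_continuous _ _ b) => /(_ (h, n) e A nA).
rewrite /within/= => -[[U V] /= [nU nV] UV].
by exists U, V; split => // u v Uu Vv uv; exact: (UV (u, v)).
Qed.

(* A filter of points [n] whose images converge to [J m] is compared with nearby points [m'] of
   the same fibres: the division [n / m'] stays in a compact set, so it clusters at some [g],
   and then the filter clusters at [g . m]. *)
Lemma principal_compact_nbhs (R : realType) (n0 : N) :
  locally_compact [set: X] -> hausdorff_space X ->
  locally_compact [set: H] -> hausdorff_space H ->
  exists2 K, nbhs n0 K & compact K.
Proof.
move=> lcX hX lcH hH.
have [C] := lcH (div n0 n0) I; rewrite withinET => nC [cC clC].
have [V1 [V2 [[oV1 V1n] [oV2 V2n] VC]]] := div_nbhs erefl nC.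
pose V := V1 `&` V2; have oV : open V by exact: openI.
have oJV : open (J @` V) := pr_open P oV.
have JVn : (J @` V) (J n0) by exists n0.
have [K [cK clK nK KV]] := @compact_nbhs_in R X _ _ lcX hX oJV JVn.
pose V' := V `&` J @^-1` K.
have nV' : nbhs n0 V'.
  by apply: filterI; [exact: open_nbhs_nbhs|exact: (pr_cont P nK)].
have QK n : closure V' n -> K (J n).
  move=> Qn; apply: clK => B /(pr_cont P) /Qn[z [[_ Kz] Bz]].
  by exists (J z).
have QC n m : closure V' n -> V m -> J n = J m -> C (div n m).
  move=> Qn Vm e; apply: clC => B nB.
  have [U1 [U2 [oU1 oU2 UB]]] := div_nbhs e nB.
  (* Openness of [J] replaces [m] by a nearby point of [V] over the same base point as [z], so that
     the two can be divided. *)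
  have nJ : nbhs n (U1 `&` J @^-1` (J @` (U2 `&` V))).
    apply: filterI; first exact: open_nbhs_nbhs.
    apply: (pr_cont P); rewrite e; apply: open_map_nbhs; first exact: (pr_open P).
    by apply: filterI; apply: open_nbhs_nbhs; [exact: oU2|split].
  have [z [[Vz Kz] [U1z [m' [U2m Vm'] e']]]] := Qn _ nJ.
  exists (div z m'); split; last exact: UB.
  by apply: VC => //; [case: Vz|case: Vm'].
exists (closure V'); first by apply: (@filterS _ (nbhs n0) _ _ _ _ nV'); exact: subset_closure.
move=> F PF FQ.
have FK : (J @ F) K by apply: (@filterS _ F _ _ _ _ FQ) => n; exact: QK.
have [x [Kx Fx]] := cK _ _ FK.
have [m Vm mx] := KV _ Kx; subst x.
(* Divisions of points along [F] by points near [m] in the same fibre; this filter is proper because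
   [J m] is a cluster point of the image of [F] and [J] is open. *)
pose D := filter_from [set AB : set N * set N | F AB.1 /\ nbhs m AB.2]
  (fun AB => [set h | exists n m', [/\ AB.1 n, AB.2 m', J n = J m' & h = div n m']]).
have PD : ProperFilter D.
  apply: filter_from_proper; last first.
    move=> [A B] /= [FA nB].
    have FJA : (J @ F) (J @` A) by apply: (@filterS _ F _ _ _ _ FA) => z Az; exists z.
    have [_ [[n An <-] [m' Bm e]]] := Fx _ _ FJA (open_map_nbhs (pr_open P) nB).
    by exists (div n m'), n, m'; split.
  apply: filter_from_filter; first by exists (setT, setT); split; exact: filterT.
  move=> [A1 B1] [A2 B2] /= [FA1 nB1] [FA2 nB2].
  exists (A1 `&` A2, B1 `&` B2) => /=; first by split; exact: filterI.
  by move=> h [n [m' [[? ?] [? ?] e ->]]]; split; exists n, m'; split.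
have DC : D C.
  exists (closure V', V) => /=; first by split => //; apply: open_nbhs_nbhs.
  by move=> _ [n [m' [Qn Vm' e ->]]]; exact: QC.
have [g [Cg Dg]] := cC _ PD DC.
have sg : gsrc g = lJ b m.
  apply: (@gbase_hausdorff H) => A B nA nB.
  have DB : D [set h | B (gsrc h)].
    exists (setT, lJ b @^-1` B) => /=.
      by split; [exact: filterT|exact: (@lJ_continuous _ _ b)].
    by move=> _ [n [m' [_ Bm e ->]]] /=; rewrite pr_div_src.
  have [h [Bh Ah]] := Dg _ _ DB (@gsrc_continuous H g _ nA).
  by exists (gsrc h).
have Fz : cluster F (lact b g m).
  move=> A O FA nO; have [U1 [U2 [nU1 nU2 UO]]] := lact_nbhs sg nO.
  have DA : D [set h | exists n m', [/\ A n, U2 m', J n = J m' & h = div n m']].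
    by exists (A, U2).
  have [_ [[n [m' [An Um e ->]]] U1h]] := Dg _ _ DA nU1.
  exists n; split => //; rewrite -(pr_div_act P e); apply: UO => //.
  by rewrite pr_div_src.
exists (lact b g m); split => //.
by apply: (@closed_closure _ V') => B /(Fz _ _ FQ).
Qed.

End principal_theory.

(** * Averaging over a Haar system *)

Lemma compact_finite_cover (X : topologicalType) (C : set X) (U : X -> set X) :
  compact C -> (forall c, C c -> nbhs c (U c)) ->
  exists2 s : seq X, forall c, c \in s -> C c & forall y, C y -> exists2 c, c \in s & U c y.
Proof.
move=> /compact_near_coveringP cC CU.
(* Finite sequences ordered by inclusion; concatenation makes this a filter, and near-covering
   compactness yields one sequence serving all points. *)
pose F := filter_from [set: seq X] (fun s0 => [set s : seq X | {subset s0 <= s}]).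
have FF : Filter F.
  apply: filter_from_filter; first by exists [::].
  move=> s1 s2 _ _; exists (s1 ++ s2) => // s ss; split => x xs; apply: ss;
    by rewrite mem_cat xs ?orbT.
have [|s _ sP] := cC _ F (fun s y => exists c, [/\ c \in s, C c & U c y]) FF.
  move=> c Cc; exists (U c, [set s : seq X | c \in s]) => /=.
    split; first exact: CU.
    by exists [:: c] => // s; apply; rewrite inE.
  by move=> [y s] /= [Uy cs]; exists c.
exists [seq c <- s | `[< C c >]]; first by move=> c; rewrite mem_filter => /andP[/asboolP].
move=> y Cy; have [|c [cs Cc Uy]] := sP s _ y Cy; first by [].
by exists c => //; rewrite mem_filter cs andbT; apply/asboolP.
Qed.

Lemma cvg_sum_seq (R : realType) (I X : Type) (F : set_system X) {FF : Filter F} (s : seq I)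
    (f : I -> X -> R) (l : I -> R) :
  (forall i, f i x @[x --> F] --> l i) ->
  (\sum_(i <- s) f i x) @[x --> F] --> \sum_(i <- s) l i.
Proof.
by move=> fl; apply: cvg_big => // x; exact: add_continuous.
Qed.

Lemma partition_of_unity (R : realType) (X : topologicalType) (C : set X) (V : X -> set X) :
  locally_compact [set: X] -> hausdorff_space X -> compact C ->
  (forall c, C c -> open (V c) /\ V c c) ->
  exists (s : seq X) (th : X -> X -> R) (K O : set X),
    [/\ forall c, c \in s -> C c,
        forall c, continuous (th c) /\ (forall y, 0 <= th c y),
        forall c y, c \in s -> th c y != 0 -> V c y /\ K y,
        compact K /\ (open O /\ C `<=` O)
      & (forall y, \sum_(c <- s) th c y <= 1) /\
        (forall y, O y -> \sum_(c <- s) th c y = 1)].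
Proof.
move=> lcX hX cC CV.
have bmp c : {g : X -> R | C c -> [/\ continuous g, forall y, 0 <= g y <= 1, g c = 1,
    forall y, g y != 0 -> V c y & exists2 K, compact K & forall y, g y != 0 -> K y]}.
  apply: cid; have [Cc|nCc] := pselect (C c); last by exists (fun=> 0).
  have [oV Vc] := CV _ Cc.
  by have [g gP] := @compact_bump R _ _ _ lcX hX oV Vc; exists g.
pose g c := if `[< C c >] then sval (bmp c) else (fun=> 0).
have gC c : C c -> g c = sval (bmp c) by move=> Cc; rewrite /g asboolT.
have gc c : continuous (g c).
  rewrite /g; case: asboolP => Cc; last by move=> ?; exact: cvg_cst.
  by have [] := svalP (bmp c) Cc.
have g0 c y : 0 <= g c y.
  rewrite /g; case: asboolP => Cc //.
  by have [_ /(_ y)/andP[]] := svalP (bmp c) Cc.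
have [c Cc|s sC sP] := @compact_finite_cover _ C (fun c => [set y | 2^-1 < g c y]) cC.
  have [_ _ g1 _ _] := svalP (bmp c) Cc.
  apply: (gc c c [set y : R | 2^-1 < y]); rewrite gC// g1.
  by apply: open_nbhs_nbhs; split; [exact: open_gt|rewrite /= invf_lt1// ltr1n].
pose S y := \sum_(c <- s) g c y.
have Sc : continuous S.
  by move=> y; apply: cvg_sum_seq => c; exact: gc.
(* The maximum keeps the denominator positive everywhere and equals [S] on the open set where the
   weights must sum to 1. *)
pose D y := Num.max (S y) 2^-1.
have D0 y : 0 < D y by rewrite lt_max invr_gt0 ltr0n orbT.
have Dc : continuous D.
  move=> y; apply: (@continuous_max R X S (fun=> 2^-1) y); first exact: Sc.
  exact: cvg_cst.
have K_ c : {K : set X | C c -> compact K /\ forall y, g c y != 0 -> K y}.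
  apply: cid; have [Cc|nCc] := pselect (C c); last by exists setT.
  have [_ _ _ _ [K cK gK]] := svalP (bmp c) Cc.
  by exists K => _; split => // y; rewrite gC//; exact: gK.
have sumE y : \sum_(c <- s) g c y / D y = S y / D y by rewrite /S mulr_suml.
exists s, (fun c y => g c y / D y), (\big[setU/set0]_(c <- s) sval (K_ c)), [set y | 2^-1 < S y].
split => //.
- move=> c; split; last by move=> y; rewrite divr_ge0// ltW.
  move=> y; apply: cvgM; first exact: gc.
  by apply: cvgV; [rewrite gt_eqF|exact: Dc].
- move=> c y cs; rewrite mulf_eq0 negb_or => /andP[gy _]; have Cc := sC _ cs; split.
    have [_ _ _ + _] := svalP (bmp c) Cc; apply.
    by rewrite -gC.
  rewrite -bigcup_seq; exists c => //.
  by have [_] := svalP (K_ c) Cc; apply.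
- split.
    rewrite big_seq; apply: bigsetU_compact => c /sC Cc.
    by have [] := svalP (K_ c) Cc.
  split; first by apply: (@open_comp _ _ S [set y | 2^-1 < y]) => [y _|];
    [exact: Sc|exact: open_gt].
  move=> y /sP[c cs gy] /=; apply: (lt_le_trans gy).
  rewrite /S (big_rem c)//= lerDl; apply: sumr_ge0 => *; exact: g0.
- split => y.
    by rewrite sumE ler_pdivrMr// mul1r le_max lexx.
  move=> /= Sy; rewrite sumE /D max_l ?divff//; last exact: ltW.
  by rewrite gt_eqF// (lt_trans _ Sy)// invr_gt0.
Qed.

Lemma compact_cutoff (R : realType) (X : topologicalType) (C : set X) :
  locally_compact [set: X] -> hausdorff_space X -> compact C ->
  exists chi : X -> R, [/\ continuous chi, forall y, 0 <= chi y, forall y, C y -> chi y = 1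
    & exists2 K, compact K & forall y, chi y != 0 -> K y].
Proof.
move=> lcX hX cC.
have [c _|s [th [K [U [sC thc thK [cK [_ CU]] [_ thU]]]]]] :=
  @partition_of_unity R X C (fun=> setT) lcX hX cC; first by split => //; exact: openT.
exists (fun y => \sum_(c <- s) th c y); split.
- by move=> y; apply: cvg_sum_seq => c; have [h _] := thc c; exact: h.
- by move=> y; apply: sumr_ge0 => c _; have [_] := thc c; exact.
- by move=> y /CU/thU.
- exists K => // y; apply: contraNP => Ky; apply/eqP; rewrite big_seq big1// => c cs.
  by apply/eqP/negPn/negP => /(thK c y cs)[_].
Qed.

Lemma near_seq (I : eqType) (X : Type) (F : set_system X) {FF : Filter F} (s : seq I)
    (Q : I -> X -> Prop) :
  (forall c, c \in s -> \forall x \near F, Q c x) ->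
  \forall x \near F, forall c, c \in s -> Q c x.
Proof.
elim: s => [|c s ih] h; first by apply: nearW.
have h1 : \forall x \near F, Q c x by apply: h; rewrite mem_head.
have h2 : \forall x \near F, forall c, c \in s -> Q c x.
  by apply: ih => d ds; apply: h; rewrite in_cons ds orbT.
apply: (@filterS2 _ F _ _ _ _ _ h1 h2) => x Qc Qs d.
by rewrite in_cons => /predU1P[->|/Qs].
Qed.

Section approximation_more.
Variables (R : realType) (M : topologicalType) (E : hilbert_field R M).

Lemma approx_comp (X Y : Type) (F : set_system X) (G : set_system Y) (g : Y -> X)
    (p : X -> M) (u : forall x, E (p x)) :
  (forall A, F A -> G (g @^-1` A)) -> sec_approx F p u ->
  sec_approx G (fun y => p (g y)) (fun y => u (g y)).
Proof. by move=> gF au eps eps0; have [xi sxi uxi] := au _ eps0; exists xi => //;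
  exact: (gF _ uxi). Qed.

(** Polarization reduces the pairing to norms of sums and differences. *)
Lemma approx_rdot (X : Type) (F : set_system X) {FF : Filter F} (p : X -> M) (x0 : X)
    (u v : forall x, E (p x)) :
  (forall P : set X, F P -> P x0) -> p @ F --> p x0 ->
  sec_approx F p u -> sec_approx F p v -> rdot (u x) (v x) @[x --> F] --> rdot (u x0) (v x0).
Proof.
move=> Fx0 px0 au av.
have polar x : rdot (u x) (v x) = (hnorm (u x + v x) ^+ 2 - hnorm (u x - v x) ^+ 2) / 4.
  by rewrite -!rdot_sq !rdotDl !rdotDr !rdotNl !(rdotC _ (- v x)) !rdotNl (rdotC (v x) (u x));
    field.
rewrite polar; under eq_fun do rewrite polar.
apply: cvgM; last exact: cvg_cst.
apply: cvgB; under eq_fun do rewrite expr2; rewrite expr2; apply: cvgM;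
  by apply: approx_hnorm => //; (exact: approxD || exact: approxB).
Qed.

End approximation_more.

Section haar_more.
Variables (R : realType) (H : continuous_groupoid) (lam : right_haar_system R H).

Lemma fib_ccD (m : gbase H) (f g : H -> R) : fib_cc m f -> fib_cc m g ->
  fib_cc m (fun h => f h + g h).
Proof.
move=> [cf [K cK fK]] [cg [L cL gL]]; split.
  apply/subspace_continuousP => h hm; apply: cvgD.
    by move/subspace_continuousP : cf; exact.
  by move/subspace_continuousP : cg; exact.
exists (K `|` L); first exact: compactU.
move=> h hm; have [/eqP ->|fh] := boolP (f h == 0).
  by rewrite add0r => gh; right; exact: gL.
by move=> _; left; exact: fK.
Qed.

Lemma fib_ccZ (m : gbase H) (c : R) (f : H -> R) : fib_cc m f -> fib_cc m (fun h => c * f h).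
Proof.
move=> [cf [K cK fK]]; split.
  apply/subspace_continuousP => h hm; apply: cvgM; first exact: cvg_cst.
  by move/subspace_continuousP : cf; exact.
by exists K => // h hm; rewrite mulf_eq0 negb_or => /andP[_]; exact: fK.
Qed.

Lemma fib_cc0 (m : gbase H) : fib_cc m (fun=> 0 : R).
Proof.
split; first by apply: continuous_subspaceT => ?; exact: cvg_cst.
by exists set0; [exact: compact0|move=> h _; rewrite eqxx].
Qed.

Lemma haar_int0 (m : gbase H) : haar_int lam m (fun=> 0) = 0.
Proof.
rewrite -[RHS](mul0r (haar_int lam m (fun=> 0))) -(haar_intZ lam 0 (fib_cc0 m)).
by apply: haar_int_eq => h _; rewrite mulr0.
Qed.

Lemma haar_int_ge0 (m : gbase H) (f : H -> R) : fib_cc m f ->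
  (forall h, gsrc h = m -> 0 <= f h) -> 0 <= haar_int lam m f.
Proof. by move=> cf f0; rewrite -(haar_int0 m); apply: haar_int_le => //; exact: fib_cc0. Qed.

Lemma fib_cc_sum (m : gbase H) (I : Type) (s : seq I) (f : I -> H -> R) :
  (forall i, fib_cc m (f i)) -> fib_cc m (fun h => \sum_(i <- s) f i h).
Proof.
move=> cf; elim: s => [|i s ih].
  have -> : (fun h => \sum_(i <- [::]) f i h) = (fun=> 0) by apply/funext => h; rewrite big_nil.
  exact: fib_cc0.
have -> : (fun h => \sum_(i <- i :: s) f i h) = (fun h => f i h + \sum_(i <- s) f i h).
  by apply/funext => h; rewrite big_cons.
exact: fib_ccD.
Qed.

Lemma haar_int_sum (m : gbase H) (I : Type) (s : seq I) (f : I -> H -> R) :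
  (forall i, fib_cc m (f i)) ->
  haar_int lam m (fun h => \sum_(i <- s) f i h) = \sum_(i <- s) haar_int lam m (f i).
Proof.
move=> cf; elim: s => [|i s ih].
  rewrite big_nil -[RHS](haar_int0 m); apply: haar_int_eq => h _.
  by rewrite big_nil.
rewrite big_cons -ih -haar_intD//; last exact: fib_cc_sum.
by apply: haar_int_eq => h _; rewrite big_cons.
Qed.

Lemma haar_int_dist (m : gbase H) (f g k : H -> R) : fib_cc m f -> fib_cc m g -> fib_cc m k ->
  (forall h, gsrc h = m -> `|f h - g h| <= k h) ->
  `|haar_int lam m f - haar_int lam m g| <= haar_int lam m k.
Proof.
move=> cf cg ck fgk.
have h1 : haar_int lam m f <= haar_int lam m (fun h => g h + k h).
  apply: haar_int_le => //; first exact: fib_ccD.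
  by move=> h /fgk; rewrite ler_norml => /andP[_ ?]; lra.
have h2 : haar_int lam m g <= haar_int lam m (fun h => f h + k h).
  apply: haar_int_le => //; first exact: fib_ccD.
  by move=> h /fgk; rewrite ler_norml => /andP[? _]; lra.
by rewrite !haar_intD// in h1 h2; rewrite ler_norml; apply/andP; split; lra.
Qed.

End haar_more.

Section average.
Variables (R : realType) (H : continuous_groupoid) (lam : right_haar_system R H).
Variables (N : topologicalType) (b : left_action H N) (X : topologicalType) (J : N -> X).
Variables (P : principal b J) (hX : hausdorff_space X) (lcX : locally_compact [set: X]).
Variable E : representation R H.

Let hH : hausdorff_space H := haar_hausdorff lam.
Let lcH : locally_compact [set: H] := haar_locally_compact lam.
Let hN : hausdorff_space N := principal_hausdorff P hX hH.

Lemma principal_locally_compact : locally_compact [set: N].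
Proof.
move=> n _; have [K nK cK] := @principal_compact_nbhs _ _ _ _ _ P R n lcX hX lcH hH.
rewrite withinET; exists K => //; split => //; exact: compact_closed.
Qed.

Variables (phi : N -> R) (Kphi : set N).
Hypotheses (cphi : continuous phi) (phi0 : forall n, 0 <= phi n).
Hypotheses (cKphi : compact Kphi) (phiK : forall n, phi n != 0 -> Kphi n).

(** Such an [h] is the division of a point of [Kphi] by a point of a compact neighbourhood of [n1],
    so one compact set, the image of a compact set of pairs, serves all nearby [n]. *)
Lemma cutoff_support (n1 : N) : exists2 C : set H, compact C &
  \forall n \near n1, forall h, gsrc h = lJ b n -> phi (lact b h n) != 0 -> C h.
Proof.
have [W] := principal_locally_compact (I : [set: N] n1); rewrite withinET => nW [cW clW].
pose A := (Kphi `*` W) `&` [set y : N * N | J y.1 = J y.2].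
have cA : compact A.
  apply: compact_closedI; first exact: compact_setX.
  rewrite (_ : [set y | _] = (fun y => (J y.1, J y.2)) @^-1` [set z : X * X | z.1 = z.2])//.
  move=> y cy; apply: hX => B1 B2 nB1 nB2.
  have n1' : nbhs y (fun y : N * N => B1 (J y.1)).
    by apply: (cvg_comp fst J cvg_fst (pr_cont P (x := y.1))).
  have n2' : nbhs y (fun y : N * N => B2 (J y.2)).
    by apply: (cvg_comp snd J cvg_snd (pr_cont P (x := y.2))).
  have [z [e [B1z B2z]]] := cy _ (filterI n1' n2').
  by exists (J z.1); split => //; rewrite [J z.1]e.
exists ((fun y : N * N => pr_div P y.1 y.2) @` A).
  apply: continuous_compact => //; apply: continuous_subspaceW (pr_div_cont P).
  by move=> y [].
apply: (@filterS _ (nbhs n1) _ _ _ _ nW) => n Wn h hn /phiK Kh.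
exists (lact b h n, n); last by rewrite /= pr_div_uniq.
by split => //=; rewrite pr_inv.
Qed.

Variables (xi : forall x, E x) (sxi : field_sec xi).

Definition pulled_sec (h : H) : E (gsrc h) := rho (gsrc_inv h) (gtgt_inv h) (xi (gtgt h)).

Definition integrand (n : N) (h : H) : E (gsrc h) := (phi (lact b h n))%:C *: pulled_sec h.

Lemma pulled_sec_approx (h0 : H) : sec_approx (nbhs h0) (@gsrc H) pulled_sec.
Proof.
apply: (@rho_approx _ _ E _ (nbhs h0) _ (@gtgt H) (@gsrc H) (@ginv H) (@gsrc_inv H) (@gtgt_inv H)
  (ginv h0) (fun h => xi (gtgt h))).
  exact: ginv_continuous.
exact: approx_sec.
Qed.

Let fibp := [set y : N * H | gsrc y.2 = lJ b y.1].

Lemma integrand_approx (n1 : N) (h1 : H) : gsrc h1 = lJ b n1 ->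
  sec_approx (within fibp (nbhs (n1, h1))) (fun y => gsrc y.2) (fun y => integrand y.1 y.2).
Proof.
move=> e; apply: (approx_fun (f := fun y : N * H => phi (lact b y.2 y.1))
  (l := phi (lact b h1 n1)) (u := fun y : N * H => pulled_sec y.2)).
  have sw : (y.2, y.1) @[y --> within fibp (nbhs (n1, h1))] --> (h1, n1).
    apply: cvg_within_filter; apply: cvg_pair; [exact: cvg_snd|exact: cvg_fst].
  have A : \forall y \near within fibp (nbhs (n1, h1)), gsrc y.2 = lJ b y.1 by exact: withinT.
  have c : lact b y.2 y.1 @[y --> within fibp (nbhs (n1, h1))] --> lact b h1 n1.
    exact: (within_continuous_cvg (t := (h1, n1)) (@lact_continuous _ _ b) e sw A).
  exact: (cvg_comp (fun y : N * H => lact b y.2 y.1) phi c (cphi (x := lact b h1 n1))).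
apply: (approx_comp (g := snd) (F := nbhs h1) (u := pulled_sec)); last exact: pulled_sec_approx.
move=> A nA.
have n2 : nbhs (n1, h1) (snd @^-1` A) by exact: (@cvg_snd _ _ (nbhs n1) (nbhs h1) _ _ nA).
by apply: (@filterS _ (nbhs (n1, h1)) _ _ _ _ n2) => y Ay _.
Qed.

Lemma integrand_cc (n : N) (eta : forall x, E x) : field_sec eta ->
  fib_cc (lJ b n) (fun h => rdot (integrand n h) (eta (gsrc h))).
Proof.
move=> seta; split.
  apply/subspace_continuousP => h hn.
  have nW : forall A, (within [set g | gsrc g = lJ b n] (nbhs h)) A -> A h.
    by move=> A nA; have := nbhs_singleton nA; exact.
  have sc : gsrc x @[x --> within [set g | gsrc g = lJ b n] (nbhs h)] --> gsrc h.
    by apply: cvg_within_filter; exact: gsrc_continuous.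
  apply: (approx_rdot (p := @gsrc H) (u := integrand n) (v := fun h => eta (gsrc h)) nW sc);
    last exact: approx_sec.
  apply: (approx_comp (g := fun h => (n, h)) _ (integrand_approx (n1 := n) hn)) => A.
  rewrite /within/= => -[[U V] /= [nU nV] UV].
  apply: (@filterS _ (nbhs h) _ _ _ _ nV) => k Vk kn; apply: (UV (n, k)) => //.
  by split => //=; exact: nbhs_singleton.
have [C cC nC] := cutoff_support n; exists C => // h hn r0.
apply: (nbhs_singleton nC) => //; apply: contraNneq r0 => r0.
by rewrite /integrand r0 rdotZl mul0r.
Qed.

(** The integrand is jointly continuous, so on the part of [C] over [lJ b n1] finitely many sections
    approximate it locally. A partition of unity glues them, with one error bound for all [n] near
    [n1]. *)
Lemma finite_approx (n1 : N) (C : set H) (eps : R) : compact C -> 0 < eps ->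
  exists (s : seq H) (th : H -> H -> R) (zeta : H -> forall x, E x),
  [/\ forall c, continuous (th c) /\ (forall h, 0 <= th c h),
      forall c, field_sec (zeta c)
    & \forall n \near n1, forall h, gsrc h = lJ b n -> (~ C h -> integrand n h = 0) ->
      hnorm (integrand n h - \sum_(c <- s) (th c h)%:C *: zeta c (gsrc h)) <= eps].
Proof.
move=> cC eps0.
pose C1 := C `&` [set h | gsrc h = lJ b n1].
have cC1 : compact C1 by apply: compact_closedI => //; exact: src_fiber_closed.
have loc c : {d : (forall x, E x) * (set N * set H) | field_sec d.1 /\ (C1 c ->
    [/\ open_nbhs n1 d.2.1, open_nbhs c d.2.2 & forall n h, d.2.1 n -> d.2.2 h ->
     gsrc h = lJ b n -> hnorm (integrand n h - d.1 (gsrc h)) < eps])}.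
  apply: cid; have [[Cc cn]|nC1] := pselect (C1 c); last first.
    by exists ((fun=> 0), (setT, setT)); split => //=; exact: field_sec0.
  have [zeta sz zP] := integrand_approx cn eps0; move: zP.
  rewrite /within/= => -[[U V] /= [nU nV] UV].
  move: nU nV; rewrite !nbhsE => -[U' oU' UU'] [V' oV' VV'].
  exists (zeta, (U', V')); split => //= _; split => // n h Un Vh hn.
  by apply: (UV (n, h)) => //; split; [exact: UU'|exact: VV'].
pose zeta c := (sval (loc c)).1.
pose V c := (sval (loc c)).2.2.
have VC c : C1 c -> open (V c) /\ V c c by move=> /(svalP (loc c)).2[_ [oV Vc] _].
have [s [th [K [W [sC thc thV [cK [oW CW]] [th1 thO]]]]]] :=
  @partition_of_unity R H C1 V lcH hH cC1 VC.
exists s, th, zeta; split => //; first by move=> c; exact: (svalP (loc c)).1.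
(* The weights sum to 1 only on [W]. The rest of [C] has a compact image under the source map that
   misses [lJ b n1], hence also [lJ b n] for nearby [n]. *)
have cCO : compact (C `&` ~` W) by apply: compact_closedI => //; exact: open_closedC.
have cI : compact (@gsrc H @` (C `&` ~` W)).
  by apply: continuous_compact => //; apply: continuous_subspaceT; exact: gsrc_continuous.
have clI : closed (@gsrc H @` (C `&` ~` W)).
  by apply: compact_closed => //; exact: gbase_hausdorff.
have nI : nbhs (lJ b n1) (~` (@gsrc H @` (C `&` ~` W))).
  apply: open_nbhs_nbhs; split; first exact: closed_openC.
  by move=> [h [Ch Wh] hn]; apply: Wh; apply: CW.
have n2 : \forall n \near n1, forall c, c \in s -> (sval (loc c)).2.1 n.
  apply: near_seq => c /sC C1c; apply: open_nbhs_nbhs.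
  by have [] := (svalP (loc c)).2 C1c.
apply: (@filterS2 _ (nbhs n1) _ _ _ _ _ n2 (@lJ_continuous _ _ b n1 _ nI)) => n sn In h hn Ch.
have Sth : \sum_(c <- s) th c h = 1 \/ integrand n h = 0.
  have [Ch'|/Ch] := pselect (C h); last by right.
  left; apply: thO; apply: contrapT => Wh; apply: In.
  by exists h.
pose D c := (th c h)%:C *: (integrand n h - zeta c (gsrc h)).
have -> : integrand n h - \sum_(c <- s) (th c h)%:C *: zeta c (gsrc h) = \sum_(c <- s) D c.
  rewrite /D; under [RHS]eq_bigr do rewrite scalerBr.
  rewrite sumrB -scaler_suml -rmorph_sum/=; congr (_ - _).
  by case: Sth => ->; rewrite ?scale1r ?scaler0.
apply: le_trans (hnorm_sum _ _) _; rewrite -[leRHS]mul1r.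
apply: (@le_trans _ _ ((\sum_(c <- s) th c h) * eps)); last by rewrite ler_wpM2r// ltW.
rewrite mulr_suml big_seq [leRHS]big_seq; apply: ler_sum => c cs.
rewrite /D hnormZ; last by have [_] := thc c; exact.
have [->|th0] := eqVneq (th c h) 0; first by rewrite !mul0r.
apply: ler_wpM2l; first by have [_] := thc c; exact.
apply: ltW; have [_ _] := (svalP (loc c)).2 (sC _ cs); apply => //; first exact: sn.
by have [] := thV c h cs th0.
Qed.

Local Notation pairing n eta := (fun h : H => rdot (integrand n h) (eta (gsrc h))).

(* The integral of [integrand n] is taken in the weak sense, against sections; the finite sums [v]
   approximate it uniformly for [n] near [n1],
     which gives both its existence and its continuity. *)
Lemma average_approx (n1 : N) : exists2 chi : H -> R,
  [/\ continuous chi, forall h, 0 <= chi h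
    & exists2 K, compact K & forall h, chi h != 0 -> K h]
  & forall eps : R, 0 < eps -> exists2 v : forall n, E (lJ b n),
    sec_approx (nbhs n1) (lJ b) v
    & \forall n \near n1, forall eta : forall x, E x, field_sec eta ->
      `|haar_int lam (lJ b n) (pairing n eta) - rdot (v n) (eta (lJ b n))| <=
      eps * haar_int lam (lJ b n) chi * hnorm (eta (lJ b n)).
Proof.
have [C cC nC] := cutoff_support n1.
(* [chi] is 1 on the support of the integrand, so its integral converts the pointwise error into an
   error of the integral. *)
have [chi [cchi chi0 chiC [K cK chiK]]] := @compact_cutoff R H C lcH hH cC.
exists chi; first by split => //; exists K.
move=> eps eps0; have [s [th [zeta [thc sz nz]]]] := finite_approx n1 cC eps0.
pose w c h := chi h * th c h.
have cw c : continuous (w c).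
  by move=> h; apply: cvgM; [exact: cchi|have [tc _] := thc c; exact: tc].
have wK c h : w c h != 0 -> K h by rewrite mulf_eq0 negb_or => /andP[/chiK].
exists (fun n => \sum_(c <- s) (haar_int lam (lJ b n) (w c))%:C *: zeta c (lJ b n)).
  apply: (@approx_sum _ _ E _ (nbhs n1) _ (lJ b) H s (fun c n =>
    (haar_int lam (lJ b n) (w c))%:C *: zeta c (lJ b n))) => c.
  apply: (approx_fun (F := nbhs n1) (f := fun n =>
    haar_int lam (lJ b n) (w c)) (l := haar_int lam (lJ b n1) (w c)));
    last exact: approx_sec.
  apply: (cvg_comp (lJ b) (fun m => haar_int lam m (w c)) (@lJ_continuous _ _ b n1)).
  exact: (haar_int_continuous (lam := lam) (cw c) cK (wK c) (x := lJ b n1)).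
apply: (@filterS2 _ (nbhs n1) _ _ _ _ _ nC nz) => n nCn nzn eta seta.
set m := lJ b n.
have -> : rdot (\sum_(c <- s) (haar_int lam m (w c))%:C *: zeta c m) (eta m) =
    haar_int lam m (fun h => \sum_(c <- s) rdot (zeta c m) (eta m) * w c h).
  rewrite haar_int_sum; last by move=> c; apply: fib_ccZ; exact: fib_cc_cts (cw c) cK (wK c).
  rewrite rdot_suml; apply: eq_bigr => c _; rewrite rdotZl haar_intZ 1?mulrC//.
  exact: fib_cc_cts (cw c) cK (wK c).
rewrite mulrAC -haar_intZ; last exact: fib_cc_cts cchi cK chiK.
apply: haar_int_dist.
- exact: integrand_cc.
- by apply: fib_cc_sum => c; apply: fib_ccZ; exact: fib_cc_cts (cw c) cK (wK c).
- by apply: fib_ccZ; exact: fib_cc_cts cchi cK chiK.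
move=> h hm; rewrite -hm.
have F0 : ~ C h -> integrand n h = 0.
  move=> Ch; rewrite /integrand.
  have [->|p0] := eqVneq (phi (lact b h n)) 0; first by rewrite scale0r.
  by exfalso; apply: Ch; exact: nCn.
have Fchi : integrand n h = (chi h)%:C *: integrand n h.
  have [/chiC ->|/F0 ->] := pselect (C h); first by rewrite scale1r.
  by rewrite scaler0.
have -> : rdot (integrand n h) (eta (gsrc h)) -
    \sum_(c <- s) rdot (zeta c (gsrc h)) (eta (gsrc h)) * w c h =
    chi h * rdot (integrand n h - \sum_(c <- s) (th c h)%:C *: zeta c (gsrc h)) (eta (gsrc h)).
  rewrite rdotBl mulrBr -rdotZl -Fchi; congr (_ - _).
  rewrite rdot_suml mulr_sumr; apply: eq_bigr => c _.
  by rewrite rdotZl /w; ring.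
rewrite normrM ger0_norm// mulrC ler_wpM2r//.
apply: le_trans (rdot_abs _ _) _; rewrite ler_wpM2r ?hnorm_ge0//.
exact: nzn.
Qed.

(** The approximants with error 1/(k+1) are Cauchy: tested against sections, whose values fill the
    fibre, they differ by at most the sum of their errors. Their limit represents the integral. *)
Lemma average_exists (n : N) : exists w : E (lJ b n), forall eta : forall x, E x, field_sec eta ->
  haar_int lam (lJ b n) (pairing n eta) = rdot w (eta (lJ b n)).
Proof.
have [chi [cchi chi0 [K cK chiK]] app] := average_approx n.
set m := lJ b n; set L := haar_int lam m chi.
have L0 : 0 <= L by apply: haar_int_ge0 => //; exact: fib_cc_cts cchi cK chiK.
have e0 (k : nat) : 0 < k.+1%:R^-1 :> R by rewrite invr_gt0.
have wP (k : nat) : {w : E m | forall eta : forall x, E x, field_sec eta ->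
    `|haar_int lam m (pairing n eta) - rdot w (eta m)| <= k.+1%:R^-1 * L * hnorm (eta m)}.
  apply: cid; have [v _ nv] := app _ (e0 k).
  by exists (v n) => eta seta; have := nbhs_singleton nv; exact.
pose e (k : nat) := k.+1%:R^-1 * L.
have ecv : e k @[k --> \oo] --> 0.
  rewrite -[X in _ --> X](mul0r L); apply: cvgM; last exact: cvg_cst.
  exact: cvg_harmonic.
have [|w wl] := @hilbert_complete _ _ (fun k => sval (wP k)) e ecv.
  move=> i j; apply: hnorm_le_weak; first by rewrite addr_ge0// mulr_ge0// invr_ge0.
  move=> u; have [eta seta <-] := field_full u.
  have := svalP (wP i) _ seta; have := svalP (wP j) _ seta.
  rewrite rdotBl mulrDl -/(e i) -/(e j) !ler_norml => /andP[? ?] /andP[? ?]; lra.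
exists w => eta seta; apply/eqP; rewrite -subr_eq0 -normr_le0.
have c0 : (e k + e k) * hnorm (eta m) @[k --> \oo] --> 0.
  rewrite -[X in _ --> X](mul0r (hnorm (eta m))); apply: cvgM; last exact: cvg_cst.
  by rewrite -[X in _ --> X](addr0 0); exact: cvgD.
rewrite -(cvg_lim _ c0)//; apply: limr_ge; first by apply/cvg_ex; exists 0.
apply: nearW => k; have h1 := svalP (wP k) _ seta; have h2 := wl k.
have h3 := rdot_abs (sval (wP k) - w) (eta m).
have h4 : hnorm (sval (wP k) - w) * hnorm (eta m) <= e k * hnorm (eta m).
  by rewrite ler_wpM2r ?hnorm_ge0.
have h5 := le_trans h3 h4; rewrite -/(e k) in h1.
move: h1 h5; rewrite rdotBl !ler_norml => /andP[? ?] /andP[? ?].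
by rewrite mulrDl; apply/andP; split; lra.
Qed.

Definition average (n : N) : E (lJ b n) := sval (cid (average_exists n)).

Lemma averageE (n : N) (eta : forall x, E x) : field_sec eta ->
  haar_int lam (lJ b n) (pairing n eta) = rdot (average n) (eta (lJ b n)).
Proof. exact: (svalP (cid (average_exists n))). Qed.

Lemma average_sec_approx (n1 : N) : sec_approx (nbhs n1) (lJ b) average.
Proof.
have [chi [cchi chi0 [K cK chiK]] app] := average_approx n1.
apply: approx_lim => eps eps0.
pose L n := haar_int lam (lJ b n) chi.
have cL : L n @[n --> n1] --> L n1.
  apply: (cvg_comp (lJ b) (fun m => haar_int lam m chi) (@lJ_continuous _ _ b n1)).
  exact: (haar_int_continuous (lam := lam) cchi cK chiK (x := lJ b n1)).
have L0 n : 0 <= L n by apply: haar_int_ge0 => //; exact: fib_cc_cts cchi cK chiK.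
(* The error gets multiplied by [L n], which is below [L n1 + 1] near [n1]. *)
have d0 : 0 < eps / (L n1 + 1) by rewrite divr_gt0// ltr_wpDl.
have [v av nv] := app _ d0; exists v => //.
have nL : \forall n \near n1, L n < L n1 + 1.
  by apply: (cL [set y | y < L n1 + 1]); apply: open_nbhs_nbhs; split;
    [exact: open_lt|rewrite /= ltrDl].
apply: (@filterS2 _ (nbhs n1) _ _ _ _ _ nL nv) => n Ln nvn.
apply: (@le_lt_trans _ _ (eps / (L n1 + 1) * L n)); last first.
  by rewrite mulrAC ltr_pdivrMr ?ltr_wpDl// ltr_pM2l.
apply: hnorm_le_weak; first by rewrite mulr_ge0// ltW.
move=> u; have [eta seta <-] := field_full u.
have := nvn _ seta; rewrite averageE// rdotBl ler_norml => /andP[_]; exact.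
Qed.

Lemma rdot_integrand (n : N) (h : H) (eta : forall x, E x) (x y : gbase H)
    (sx : gsrc h = x) (ty : gtgt h = y) :
  rdot (integrand n h) (eta (gsrc h)) = phi (lact b h n) * rdot (xi y) (rho sx ty (eta x)).
Proof.
subst x y; rewrite rdotZl; congr (_ * _).
by rewrite [RHS]rdotC (rho_dotV _ _ (gsrc_inv h) (gtgt_inv h)) rdotC.
Qed.

(** Both sides are tested against a vector: unitarity moves the operator to the test vector, and
    right invariance substitutes [gmul k h] for the integration variable. *)
Lemma average_equivariant (h : H) (n : N) (sh : gsrc h = lJ b n)
    (th : gtgt h = lJ b (lact b h n)) : average (lact b h n) = rho sh th (average n).
Proof.
apply: rdot_ext => w; have [eta seta etaw] := field_full w.
have si : gsrc (ginv h) = lJ b (lact b h n) by rewrite gsrc_inv.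
have ti : gtgt (ginv h) = lJ b n by rewrite gtgt_inv.
(* Averages pair only with sections, so the moved test vector also needs a section through it. *)
have [eta' seta' etaw'] := field_full (rho si ti w).
rewrite (rho_dotV _ _ si ti) -etaw' -averageE// -[in LHS]etaw -averageE//.
have := integrand_cc n seta'; rewrite -{1}sh -[in RHS]sh => cc.
rewrite -haar_int_trans// -[in LHS]th; apply: haar_int_eq => k kh.
have sk : gsrc k = lJ b (lact b h n) by rewrite kh.
have skh : gsrc (gmul k h) = lJ b n by rewrite gsrc_mul.
have tkh : gtgt (gmul k h) = gtgt k by rewrite gtgt_mul.
rewrite (rdot_integrand _ _ sk erefl) (rdot_integrand _ _ skh tkh) lactM// etaw etaw'.
congr (_ * rdot _ _); apply/esym; apply: rho_mul.
by rewrite -gmulA ?gtgt_inv// gmulV -kh gmul1.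
Qed.

Lemma orbit_cutoff_cc (n : N) : fib_cc (lJ b n) (fun h => phi (lact b h n)).
Proof.
split.
  apply/subspace_continuousP => h hn.
  have A : \forall k \near within [set g | gsrc g = lJ b n] (nbhs h), gsrc k = lJ b n.
    exact: withinT.
  have sw : (k, n) @[k --> within [set g | gsrc g = lJ b n] (nbhs h)] --> (h, n).
    by apply: cvg_within_filter; apply: cvg_pair; [exact: cvg_id|exact: cvg_cst].
  have c : lact b k n @[k --> within [set g | gsrc g = lJ b n] (nbhs h)] --> lact b h n.
    exact: (within_continuous_cvg (t := (h, n)) (@lact_continuous _ _ b) hn sw A).
  exact: (cvg_comp (fun k : H => lact b k n) phi c (cphi (x := lact b h n))).
have [C cC nC] := cutoff_support n; exists C => // h hn r0.
exact: (nbhs_singleton nC).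
Qed.

(** The difference is the integral of [phi] times a vector of norm at most [eps]; the bound is
    therefore relative to the total mass. *)
Lemma average_near (n : N) (eps : R) : 0 <= eps ->
  (forall h, gsrc h = lJ b n -> phi (lact b h n) != 0 ->
    hnorm (pulled_sec h - xi (gsrc h)) <= eps) ->
  hnorm (average n - (haar_int lam (lJ b n) (fun h => phi (lact b h n)))%:C *: xi (lJ b n)) <=
  eps * haar_int lam (lJ b n) (fun h => phi (lact b h n)).
Proof.
move=> eps0 near; set m := lJ b n; set c := haar_int lam m _.
have c0 : 0 <= c by apply: haar_int_ge0 => //; exact: orbit_cutoff_cc.
apply: hnorm_le_weak; first exact: mulr_ge0.
move=> u; have [eta seta <-] := field_full u.
rewrite rdotBl -averageE// rdotZl.
have cc := orbit_cutoff_cc n.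
have -> : c * rdot (xi m) (eta m) = haar_int lam m (fun h =>
  rdot (xi m) (eta m) * phi (lact b h n)).
  by rewrite haar_intZ// mulrC.
rewrite mulrAC -haar_intZ//; apply: le_trans (ler_norm _) _; apply: haar_int_dist.
- exact: integrand_cc.
- exact: fib_ccZ.
- exact: fib_ccZ.
move=> h hm; rewrite /m -hm rdotZl.
have -> : phi (lact b h n) * rdot (pulled_sec h) (eta (gsrc h)) -
    rdot (xi (gsrc h)) (eta (gsrc h)) * phi (lact b h n) =
    phi (lact b h n) * rdot (pulled_sec h - xi (gsrc h)) (eta (gsrc h)).
  by rewrite rdotBl; ring.
have [->|p0] := eqVneq (phi (lact b h n)) 0; first by rewrite mul0r normr0 mulr0.
rewrite normrM ger0_norm// mulrC ler_wpM2r//.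
by apply: le_trans (rdot_abs _ _) _; rewrite ler_wpM2r ?hnorm_ge0// near.
Qed.

Lemma average_eq0 (n : N) : (forall h, gsrc h = lJ b n -> phi (lact b h n) = 0) ->
  average n = 0.
Proof.
move=> p0; apply: rdot_ext => w; have [eta seta <-] := field_full w.
rewrite rdot0l -averageE// -[RHS](haar_int0 lam (lJ b n)).
by apply: haar_int_eq => h hn; rewrite /integrand p0// scale0r rdot0l.
Qed.

End average.

Section average_density.
Variables (R : realType) (H : continuous_groupoid) (lam : right_haar_system R H).
Hypothesis fs : full_support lam.
Variables (N : topologicalType) (b : left_action H N) (X : topologicalType) (J : N -> X).
Variables (P : principal b J) (hX : hausdorff_space X) (lcX : locally_compact [set: X]).
Variable E : representation R H.

Lemma rho_unit_sec (xi : forall x, E x) (g : H) (m x y : gbase H) (sx : gsrc g = x)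
  (ty : gtgt g = y) : x = m -> y = m -> g = gunit m -> rho sx ty (xi x) = xi y.
Proof. by move=> xm ym gm; move: sx ty; rewrite xm ym => sx ty; exact: (rho_unit _ _ _ gm). Qed.

(** For a bump near [n0], any [h] with [lact b h n0] in its support is the division of that point by
    [n0], hence close to the unit, where the pulled-back section is close to [xi]. Full support
    makes the mass [c] positive, so one may normalize by it. *)
Lemma equivariant_density (n0 : N) (v : E (lJ b n0)) (eps : R) : 0 < eps ->
  exists u : forall n, E (lJ b n),
    [/\ forall (h : H) n (sh : gsrc h = lJ b n) (th : gtgt h = lJ b (lact b h n)),
          u (lact b h n) = rho sh th (u n),
        forall n1 : N, sec_approx (nbhs n1) (lJ b) u,
        hnorm (u n0 - v) < eps
      & exists2 K : set X, compact K & forall n, u n != 0 -> K (J n)].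
Proof.
move=> eps0; have e2 : 0 < eps / 2 by rewrite divr_gt0.
have [xi sxi xiv] := field_full v.
have hH : hausdorff_space H := haar_hausdorff lam.
have lcN := principal_locally_compact lam P hX lcX.
have hN := principal_hausdorff P hX hH.
have pn : \forall h \near gunit (lJ b n0), hnorm (pulled_sec xi h - xi (gsrc h)) < eps / 2.
  apply: (@approx_near _ _ E _ (nbhs (gunit (lJ b n0))) _ (@gsrc H) (gunit (lJ b n0))) => //.
  - by move=> A /nbhs_singleton.
  - exact: gsrc_continuous.
  - exact: pulled_sec_approx.
  - exact: approx_sec.
  - apply: (@rho_unit_sec _ _ (lJ b n0)); rewrite ?gtgt_unit ?gsrc_unit//.
    exact: ginv_unit.
(* Writing the unit as a division lets continuity of division turn nearness of arrows into nearness
   of points. *)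
rewrite -(div_refl P) in pn.
have [U [V [[oU Un0] [oV Vn0] UV]]] := div_nbhs (P := P) erefl pn.
have [phi [cphi phi01 phin0 phiU [K cK phiK]]] := @compact_bump R _ _ _ lcN hN oU Un0.
have phi0 n : 0 <= phi n by have /andP[] := phi01 n.
pose av := average lam P hX lcX cphi cK phiK sxi.
pose c := haar_int lam (lJ b n0) (fun h => phi (lact b h n0)).
have c0 : 0 < c.
  apply: haar_int_gt0 => //; first exact: (orbit_cutoff_cc lam P hX lcX cphi cK phiK).
  by rewrite lact1 phin0.
have ci0 : 0 <= c^-1 by rewrite invr_ge0 ltW.
exists (fun n => c^-1%:C *: av n); split.
- by move=> h n sh th; rewrite rhoZ /av (average_equivariant lam P hX lcX cphi cK phiK sxi sh th).
- by move=> n1; apply: approxZ; exact: average_sec_approx.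
- have -> : c^-1%:C *: av n0 - v = c^-1%:C *: (av n0 - c%:C *: xi (lJ b n0)).
    by rewrite scalerBr scalerA -rmorphM/= mulVf ?gt_eqF// scale1r xiv.
  rewrite hnormZ//; apply: (@le_lt_trans _ _ (eps / 2));
    last by rewrite ltr_pdivrMr// ltr_pMr// ltr1n.
  rewrite mulrC ler_pdivrMr//; apply: average_near => //; first exact: ltW.
  move=> h hn /phiU Uh; have := UV _ _ Uh Vn0; rewrite pr_div_uniq// pr_inv// => /(_ erefl)/ltW.
  exact.
- exists (J @` K).
    by apply: continuous_compact => //; apply: continuous_subspaceT; exact: (pr_cont P).
  move=> n; apply: contraNP => nK; apply/eqP; rewrite /av average_eq0 ?scaler0// => h hn.
  apply/eqP/negPn/negP => /phiK Kh; apply: nK; exists (lact b h n) => //.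
  exact: pr_inv.
Qed.

End average_density.

(** * Transfer of continuous fields *)

Section C0_theory.
Variables (R : realType) (M : topologicalType).
Implicit Types f : M -> R.

Lemma C0_uniform_lim f :
  (forall eps, 0 < eps -> exists2 g : M -> R, C0 g & forall m, `|f m - g m| <= eps) -> C0 f.
Proof.
move=> fg; split.
  move=> m; apply/cvgrPdist_lt => eps eps0.
  have e3 : 0 < eps / 3 by rewrite divr_gt0.
  have [g [cg _] gf] := fg _ e3.
  have /cvgrPdist_lt/(_ _ e3) := cg m.
  apply: (@filterS _ (nbhs m)) => x h; have := gf m; have := gf x; move: h.
  by rewrite !ler_norml !ltr_norml => /andP[? ?] /andP[? ?] /andP[? ?]; apply/andP; split; lra.
move=> eps eps0; have e2 : 0 < eps / 2 by rewrite divr_gt0.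
have [g [_ /(_ _ e2)[K cK Kg]] gf] := fg _ e2.
exists K => // m /Kg h; have := gf m; move: h.
by rewrite !ler_norml !ltr_norml => /andP[? ?] /andP[? ?]; apply/andP; split; lra.
Qed.

Lemma C0_le f (g : M -> R) (c : R) : continuous f -> C0 g ->
  (forall m, `|f m| <= c * `|g m|) -> C0 f.
Proof.
move=> cf [_ gK] fg; split => // eps eps0.
have e2 : 0 < eps / (`|c| + 1) by rewrite divr_gt0// ltr_wpDl.
have [K cK Kg] := gK _ e2; exists K => // m /Kg h; apply: le_lt_trans (fg m) _.
apply: (@le_lt_trans _ _ ((`|c| + 1) * `|g m|)).
  by rewrite ler_wpM2r// (le_trans (ler_norm c))// lerDl.
by rewrite mulrC -ltr_pdivlMr// ltr_wpDl.
Qed.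

Lemma C0D f (g : M -> R) : C0 f -> C0 g -> C0 (fun m => `|f m| + `|g m|).
Proof.
move=> [cf fK] [cg gK]; split.
  by move=> m; apply: cvgD; apply: cvg_norm; [exact: cf|exact: cg].
move=> eps eps0; have e2 : 0 < eps / 2 by rewrite divr_gt0.
have [K cK Kf] := fK _ e2; have [L cL Lg] := gK _ e2.
exists (K `|` L); first exact: compactU.
move=> m KL; rewrite ger0_norm ?addr_ge0// (splitr eps) ltrD//.
  by apply: Kf => Km; apply: KL; left.
by apply: Lg => Lm; apply: KL; right.
Qed.

End C0_theory.

Section section_space.
Variables (R : realType) (M : topologicalType) (F : M -> hilbert R).
Variable S : set (forall m, F m).
Hypothesis S0 : S (fun=> 0).
Hypothesis SD : forall xi eta, S xi -> S eta -> S (fun m => xi m + eta m).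
Hypothesis SC0 : forall xi, S xi -> C0 (fun m => hnorm (xi m)).
Hypothesis S_closed : forall xi : forall m, F m, C0 (fun m => hnorm (xi m)) ->
  (forall eps : R, 0 < eps -> forall m : M, exists2 eta, S eta &
     \forall n \near m, hnorm (xi n - eta n) < eps) -> S xi.

Lemma section_sum (xi : nat -> forall m, F m) n : (forall k, S (xi k)) ->
  S (fun m => \sum_(k < n) xi k m).
Proof.
move=> Sxi; elim: n => [|n ih].
  have -> : (fun m => \sum_(k < 0) xi k m) = (fun=> 0) :> (forall m, F m).
    by apply: functional_extensionality_dep => m; rewrite big_ord0.
  exact: S0.
have -> : (fun m => \sum_(k < n.+1) xi k m) = (fun m => \sum_(k < n) xi k m + xi n m).
  by apply: functional_extensionality_dep => m; rewrite big_ord_recr.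
exact: SD.
Qed.

(** Stated for a bare set of sections, since it serves both to build the transferred field and
    inside a given one. The sum of the powers of 1/3 is 3/2, so the tail from [n] on is at most C
    (3/2) 3^-n. *)
Lemma section_series (xi : nat -> forall m, F m) (C : R) : 0 <= C -> (forall k, S (xi k)) ->
  (forall k m, hnorm (xi k m) <= C * 3^-1 ^+ k) ->
  exists2 s, S s & forall n m, hnorm (\sum_(k < n) xi k m - s m) <= C * (3 / 2) * 3^-1 ^+ n.
Proof.
move=> C0' Sxi xiC; pose e n : R := C * (3 / 2) * 3^-1 ^+ n.
have e0 : e n @[n --> \oo] --> 0.
  rewrite -[X in _ --> X](mulr0 (C * (3 / 2))); apply: cvgM; first exact: cvg_cst.
  by apply: cvg_expr; rewrite ger0_norm ?invr_ge0// invf_lt1// ltr1n.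
have ege n : 0 <= e n by rewrite !mulr_ge0// exprn_ge0// invr_ge0.
pose s n m := \sum_(k < n) xi k m.
have ss i d m : hnorm (s (i + d)%N m - s i m) <= e i - e (i + d)%N.
  elim: d => [|d ih]; first by rewrite addn0 !subrr hnorm0.
  rewrite addnS {1}/s big_ord_recr/= -/(s _ _) addrAC.
  apply: le_trans (hnormD _ _) _.
  have := xiC (i + d)%N m; rewrite /e exprS; move: ih; rewrite /e.
  set x := 3^-1 ^+ (i + d); set y := 3^-1 ^+ i => h1 h2.
  have -> : C * (3 / 2) * y - C * (3 / 2) * (3^-1 * x) = (C * (3 / 2) * y - C * (3 / 2) * x) + C
    * x.
    by field.
  exact: lerD.
have sc m i j : hnorm (s i m - s j m) <= e i + e j.
  have [ij|/ltnW ji] := leqP i j.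
    rewrite hnormBC; have := ss i (j - i)%N m; rewrite subnKC// => h.
    by apply: le_trans h _; rewrite lerD2l ge0_cp//.
  have := ss j (i - j)%N m; rewrite subnKC// => h.
  by apply: le_trans h _; rewrite addrC lerD2r ge0_cp//.
pose l m := sval (cid (hilbert_complete e0 (sc m))).
have lP n m : hnorm (s n m - l m) <= e n := svalP (cid (hilbert_complete e0 (sc m))) n.
have small eps : 0 < eps -> exists n, e n < eps.
  move=> eps0; have /cvgrPdist_lt/(_ _ eps0)[n _ /(_ n (leqnn n))] /= := e0.
  by rewrite sub0r normrN ger0_norm// => ?; exists n.
exists l; last by move=> n m; exact: lP.
apply: S_closed.
  apply: C0_uniform_lim => eps /small[n en].
  exists (fun m => hnorm (s n m)); first by apply: SC0; exact: section_sum.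
  move=> m; apply: le_trans (hnorm_dist _ _) _; rewrite hnormBC.
  by apply: le_trans (lP n m) _; exact: ltW.
move=> eps /small[n en] m; exists (s n); first exact: section_sum.
by apply: nearW => x; rewrite hnormBC; apply: le_lt_trans (lP n x) _.
Qed.

Hypothesis S_trunc : forall xi m (r : R), S xi -> 0 < r -> hnorm (xi m) <= r ->
  exists eta, [/\ S eta, eta m = xi m & forall x, hnorm (eta x) <= r].

(** Successive approximation of residuals: each section reduces the residual by a factor 3. It has
    norm at most [2 * q n] at [m], and truncation extends this bound to all points, which makes the
    series converge uniformly. *)
Lemma section_full_of_dense (m : M) :
  (forall (v : F m) (eps : R), 0 < eps -> exists2 xi, S xi & hnorm (xi m - v) < eps) ->
  forall v : F m, exists2 xi, S xi & xi m = v.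
Proof.
move=> dense v; pose C := hnorm v + 1.
have C0' : 0 < C by rewrite ltr_wpDl// hnorm_ge0.
pose q n : R := C * 3^-1 ^+ n.
have q0 n : 0 < q n by rewrite mulr_gt0// exprn_gt0// invr_gt0.
(* Total in the residual, with the zero section as default, so that [res] is a plain recursion whose
   bound is proved afterwards. *)
have step n (r : F m) : {xi : forall x, F x | S xi /\ (hnorm r <= q n ->
    hnorm (r - xi m) <= q n.+1 /\ forall x, hnorm (xi x) <= 2 * C * 3^-1 ^+ n)}.
  apply: cid; have [rn|rn] := pselect (hnorm r <= q n); last by exists (fun=> 0).
  have [xi Sxi xir] := dense r _ (q0 n.+1).
  have qn : q n.+1 <= q n.
    by have := q0 n; rewrite /q exprS mulrCA; lra.
  have r2 : hnorm (xi m) <= 2 * q n.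
    rewrite -[xi m](subrK r); apply: le_trans (hnormD _ _) _.
    by rewrite mulrDl !mul1r lerD// (le_trans (ltW xir)).
  have q2 : 0 < 2 * q n by rewrite mulr_gt0.
  have [eta [Seta etam etar]] := S_trunc Sxi q2 r2.
  exists eta; split => // _; split; first by rewrite etam hnormBC ltW.
  by move=> x; rewrite -mulrA; exact: etar.
pose res := fix res n : F m := if n is k.+1 then res k - sval (step k (res k)) m else v.
pose xi n := sval (step n (res n)).
have resq n : hnorm (res n) <= q n.
  elim: n => [|n ih]; first by rewrite /q expr0 mulr1 lerDl.
  by have [/= h _] := (svalP (step n (res n))).2 ih.
have Sxi n : S (xi n) := (svalP (step n (res n))).1.
have xiC n x : hnorm (xi n x) <= 2 * C * 3^-1 ^+ n.
  by have [_] := (svalP (step n (res n))).2 (resq n); exact.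
have C2 : 0 <= 2 * C by rewrite mulr_ge0// ltW.
have [s Ss sP] := section_series C2 Sxi xiC.
exists s => //.
have sumE n : \sum_(k < n) xi k m = v - res n.
  elim: n => [|n ih]; first by rewrite big_ord0 subrr.
  by rewrite big_ord_recr/= ih -/(xi n) opprB addrA addrAC.
apply/eqP; rewrite -subr_eq0; apply/eqP/hnorm_eq0/eqP; rewrite -normr_le0.
(* The residual contributes [C] and the tail of the series 2 C (3/2). *)
have c0 : C * 4 * 3^-1 ^+ n @[n --> \oo] --> 0.
  rewrite -[X in _ --> X](mulr0 (C * 4)); apply: cvgM; first exact: cvg_cst.
  by apply: cvg_expr; rewrite ger0_norm ?invr_ge0// invf_lt1// ltr1n.
rewrite -(cvg_lim _ c0)//; apply: limr_ge; first by apply/cvg_ex; exists 0.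
apply: nearW => n; rewrite ger0_norm ?hnorm_ge0// hnormBC.
have := sP n m; rewrite sumE => h1; have h2 := resq n.
apply: le_trans (hnormB_tri (v - res n) _ _) _.
rewrite opprB addrCA subrr addr0.
apply: le_trans (lerD h2 h1) _; rewrite /q; set y := 3^-1 ^+ n.
by rewrite le_eqVlt; apply/orP; left; apply/eqP; field.
Qed.

End section_space.

Lemma continuous_descend (X Y Z : topologicalType) (J : X -> Y) (f : Y -> Z) :
  open_map J -> (forall y, exists x, J x = y) -> continuous (f \o J) -> continuous f.
Proof.
move=> Jo Js /continuousP cf; apply/continuousP => A oA.
have -> : f @^-1` A = J @` ((f \o J) @^-1` A).
  apply/seteqP; split => [y Ay|_ [x Ax <-]] //.
  by have [x xy] := Js y; exists x; rewrite //= xy.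
by apply: Jo; exact: cf.
Qed.

Section transport.
Variables (R : realType) (H : continuous_groupoid) (N : topologicalType) (b : left_action H N).
Variables (X : topologicalType) (J : N -> X) (P : principal b J) (E : representation R H).

Definition transport (n' n : N) (e : J n' = J n) : E (lJ b n) -> E (lJ b n') :=
  rho (pr_div_src P e) (div_tgt P e).

Lemma transport_refl n (e : J n = J n) v : transport e v = v.
Proof. by apply: rho_unit; rewrite div_refl. Qed.

Lemma transport_norm n' n (e : J n' = J n) v : hnorm (transport e v) = hnorm v.
Proof. exact: rho_norm. Qed.

Lemma transport_equivariant (u : forall n, E (lJ b n)) :
  (forall (h : H) n (sh : gsrc h = lJ b n) (th : gtgt h = lJ b (lact b h n)),
    u (lact b h n) = rho sh th (u n)) ->
  forall n' n (e : J n' = J n), transport e (u n) = u n'.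
Proof.
move=> uh n' n e; rewrite /transport.
move: (pr_div_src P e) (div_tgt P e) (pr_div_act P e); move: (pr_div P n' n) => h sh th hn.
by case: _ / hn th => th; rewrite uh.
Qed.

End transport.

Section transfer_field.
Variables (R : realType) (H : continuous_groupoid) (lam : right_haar_system R H).
Hypothesis fs : full_support lam.
Variables (N : topologicalType) (b : left_action H N) (X : topologicalType) (J : N -> X).
Variables (P : principal b J) (hX : hausdorff_space X) (lcX : locally_compact [set: X]).
Variable E : representation R H.

Definition base_lift (x : X) : N := sval (cid (pr_surj P x)).

Lemma base_liftK x : J (base_lift x) = x.
Proof. exact: (svalP (cid (pr_surj P x))). Qed.

Lemma base_lift_fiber n : J n = J (base_lift (J n)).
Proof. by rewrite base_liftK. Qed.

Definition tfiber (x : X) : hilbert R := E (lJ b (base_lift x)).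

Definition lift_sec (xi : forall x, tfiber x) (n : N) : E (lJ b n) :=
  transport P (base_lift_fiber n) (xi (J n)).

Lemma lift_sec_norm xi n : hnorm (lift_sec xi n) = hnorm (xi (J n)).
Proof. exact: transport_norm. Qed.

Lemma lift_secD xi eta n : lift_sec (fun x => xi x + eta x) n = lift_sec xi n + lift_sec eta n.
Proof. exact: rhoD. Qed.

Lemma lift_secB xi eta n : lift_sec (fun x => xi x - eta x) n = lift_sec xi n - lift_sec eta n.
Proof. exact: rhoB. Qed.

Lemma lift_secZ (c : X -> R[i]) xi n : lift_sec (fun x =>
  c x *: xi x) n = c (J n) *: lift_sec xi n.
Proof. exact: rhoZ. Qed.

Definition tsec : set (forall x, tfiber x) := [set xi |
  C0 (fun x => hnorm (xi x)) /\ forall n0 : N, sec_approx (nbhs n0) (lJ b) (lift_sec xi)].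

Lemma tsec_continuous (xi : forall x, tfiber x) :
  (forall n0 : N, sec_approx (nbhs n0) (lJ b) (lift_sec xi)) ->
    continuous (fun x => hnorm (xi x)).
Proof.
move=> axi; apply: (continuous_descend (pr_open P) (pr_surj P)) => n0.
have -> : (fun x => hnorm (xi x)) \o J = (fun n => hnorm (lift_sec xi n)).
  by apply/funext => n; rewrite lift_sec_norm.
apply: (approx_hnorm (F := nbhs n0)) => //.
- by move=> A /nbhs_singleton.
- exact: lJ_continuous.
Qed.

Lemma tsec0 : tsec (fun=> 0).
Proof.
have l0 : lift_sec (fun=> 0) = (fun n => (fun=> 0 : E _) (lJ b n)).
  by apply: functional_extensionality_dep => n; exact: rho0.
split => [|n0]; last by rewrite l0;
  exact: (@approx_sec _ _ E _ (nbhs n0) _ (lJ b) _ (field_sec0 E)).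
split; first by move=> x; under eq_fun do rewrite hnorm0; exact: cvg_cst.
by move=> eps eps0; exists set0; [exact: compact0|move=> x _; rewrite hnorm0 normr0].
Qed.

Lemma tsecD xi eta : tsec xi -> tsec eta -> tsec (fun x => xi x + eta x).
Proof.
move=> [c1 a1] [c2 a2].
have a3 (n0 : N) : sec_approx (nbhs n0) (lJ b) (lift_sec (fun x => xi x + eta x)).
  by apply: approx_ext (approxD (a1 n0) (a2 n0)) => n; rewrite lift_secD.
split => //; apply: (C0_le (c := 1) _ (C0D c1 c2)); first exact: tsec_continuous.
move=> x; rewrite mul1r !ger0_norm ?addr_ge0 ?hnorm_ge0//.
exact: hnormD.
Qed.

(** The factor may vary over the base, which covers both scalar multiples and truncations. *)
Lemma tsec_scale (c : X -> R[i]) (C : R) xi :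
  (forall n0 : N, sec_approx (nbhs n0) (lJ b) (fun n => c (J n) *: lift_sec xi n)) ->
  (forall x, complex.Re `|c x| <= C) -> tsec xi -> tsec (fun x => c x *: xi x).
Proof.
move=> a1 cC [c0 _].
have a3 (n0 : N) : sec_approx (nbhs n0) (lJ b) (lift_sec (fun x => c x *: xi x)).
  by apply: approx_ext (a1 n0) => n; rewrite lift_secZ.
split => //; apply: (C0_le (c := C) _ c0); first exact: tsec_continuous.
move=> x; rewrite !ger0_norm ?hnorm_ge0// hnormZc ler_wpM2r ?hnorm_ge0//.
Qed.

Lemma tsecZ (c : R[i]) xi : tsec xi -> tsec (fun x => c *: xi x).
Proof.
move=> sxi; have [_ a1] := sxi.
by apply: (tsec_scale (C := complex.Re `|c|)) => // n0; exact: approxZ.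
Qed.

Lemma tsec_closed (xi : forall x, tfiber x) : C0 (fun x => hnorm (xi x)) ->
  (forall eps : R, 0 < eps -> forall x : X, exists2 eta, tsec eta &
     \forall y \near x, hnorm (xi y - eta y) < eps) -> tsec xi.
Proof.
move=> cxi h; split => // n0; apply: approx_lim => eps eps0.
have [eta [_ aeta] near] := h _ eps0 (J n0).
exists (lift_sec eta) => //.
apply: (@filterS _ (nbhs n0) _ _ _ _ (pr_cont P near)) => n.
by rewrite -lift_secB lift_sec_norm.
Qed.

(** Radial retraction onto the ball of radius [r]; the maximum keeps the denominator away from 0. *)
Lemma tsec_trunc xi x (r : R) : tsec xi -> 0 < r -> hnorm (xi x) <= r ->
  exists eta, [/\ tsec eta, eta x = xi x & forall y, hnorm (eta y) <= r].
Proof.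
move=> sxi r0 xr; have [[cxi _] axi] := sxi.
pose m y := Num.max r (hnorm (xi y)).
have m0 y : 0 < m y by rewrite lt_max r0.
have cm : continuous m.
  by move=> y; apply: (@continuous_max R X (fun=> r) (fun y => hnorm (xi y)) y);
    [exact: cvg_cst|exact: cxi].
pose g y := r / m y.
have g0 y : 0 <= g y by rewrite divr_ge0// ltW.
have cg : continuous g.
  move=> y; apply: cvgM; first exact: cvg_cst.
  by apply: cvgV; [rewrite gt_eqF|exact: cm].
have g1 y : g y <= 1 by rewrite ler_pdivrMr// mul1r le_max lexx.
exists (fun y => (g y)%:C *: xi y); split.
- apply: (tsec_scale (c := fun y => (g y)%:C) (C := 1)) => //.
    move=> n0; apply: (approx_fun (F := nbhs n0) (f := g \o J) (l := g (J n0))) => //.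
    by apply: (cvg_comp J g (pr_cont P (x := n0))); exact: cg.
  by move=> y; rewrite ger0_norm ?lecR//=.
- by rewrite /g /m max_l// divff ?gt_eqF// scale1r.
- move=> y; rewrite hnormZ// /g -mulrA ler_piMr ?(ltW r0)// mulrC ler_pdivrMr// mul1r.
  by rewrite le_max lexx orbT.
Qed.

Lemma tsec_full x (v : tfiber x) : exists2 xi, tsec xi & xi x = v.
Proof.
apply: (section_full_of_dense tsec0 tsecD _ tsec_closed tsec_trunc) => [xi []//|].
move=> {}v eps eps0.
have [u [uh ua uv [K cK uK]]] := equivariant_density fs P hX lcX v eps0.
(* By equivariance the lift of this section is [u] itself, whatever points were chosen. *)
pose xi y : tfiber y := u (base_lift y).
have lxi : lift_sec xi = u.
  by apply: functional_extensionality_dep => n; exact: transport_equivariant.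
have axi (n0 : N) : sec_approx (nbhs n0) (lJ b) (lift_sec xi) by rewrite lxi.
exists xi => //; split => //; split; first exact: tsec_continuous.
move=> e e0; exists K => // y Ky; rewrite /xi.
have [-> |/uK] := eqVneq (u (base_lift y)) 0; first by rewrite hnorm0 normr0.
by rewrite base_liftK.
Qed.

Definition tfield : hilbert_field R X := @HilbertField R X tfiber tsec
  tsec0 tsecD tsecZ tsec_full (fun xi sxi => sxi.1) tsec_closed.

End transfer_field.

Arguments lift_sec {R H N b X J} P E xi n.

(** * Transfer of representations *)

Section field_scaling.
Variables (R : realType) (M : topologicalType) (E : hilbert_field R M).

Lemma field_sec_scale (g : M -> R) (C : R) (xi : forall m, E m) : continuous g ->
  (forall m, `|g m| <= C) -> field_sec xi -> field_sec (fun m => (g m)%:C *: xi m).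
Proof.
move=> cg gC sxi.
have ag (m0 : M) : sec_approx (nbhs m0) id (fun m => (g m)%:C *: xi m).
  apply: (@approx_fun _ _ E _ (nbhs m0) _ id g (g m0) xi); first exact: cg.
  exact: (@approx_sec _ _ E _ (nbhs m0) _ id xi).
apply: field_closed; last by move=> eps eps0 m; exact: ag.
apply: (C0_le (c := C) _ (field_C0 sxi)).
  move=> m0; apply: (approx_hnorm (F := nbhs m0) (p := id)) => //.
  by move=> A /nbhs_singleton.
by move=> m; rewrite hnormZr normrM normr_id !(ger0_norm (hnorm_ge0 _)) ler_wpM2r ?hnorm_ge0.
Qed.

Lemma field_trunc (xi : forall m, E m) (m : M) (r : R) : field_sec xi -> 0 < r ->
  hnorm (xi m) <= r ->
  exists eta, [/\ field_sec eta, eta m = xi m & forall x, hnorm (eta x) <= r].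
Proof.
move=> sxi r0 mr; pose d y := Num.max r (hnorm (xi y)).
have d0 y : 0 < d y by rewrite lt_max r0.
have cd : continuous d.
  move=> y; apply: (@continuous_max R M (fun=> r) (fun y => hnorm (xi y)) y).
    exact: cvg_cst.
  exact: field_sec_cont.
pose g y := r / d y.
have g0 y : 0 <= g y by rewrite divr_ge0// ltW.
have cg : continuous g.
  move=> y; apply: cvgM; first exact: cvg_cst.
  by apply: cvgV; [rewrite gt_eqF|exact: cd].
have g1 y : g y <= 1 by rewrite ler_pdivrMr// mul1r le_max lexx.
exists (fun y => (g y)%:C *: xi y); split.
- by apply: (field_sec_scale (C := 1)) => // y; rewrite ger0_norm.
- by rewrite /g /d max_l// divff ?gt_eqF// scale1r.
- move=> y; rewrite hnormZ// /g -mulrA ler_piMr ?(ltW r0)// mulrC ler_pdivrMr// mul1r.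
  by rewrite le_max lexx orbT.
Qed.

End field_scaling.

(** * Morphisms are globally bounded *)

Section rep_hom_bounded.
Variables (R : realType) (G : continuous_groupoid) (E F : representation R G).
Variable f : rep_hom E F.

Lemma rh0 m : f m 0 = 0.
Proof. by have := @rh_linear _ _ _ _ f m (-1) 0 0; rewrite scaler0 addr0 scaleN1r addNr. Qed.

Lemma rhD m u v : f m (u + v) = f m u + f m v.
Proof. by have := @rh_linear _ _ _ _ f m 1 u v; rewrite !scale1r. Qed.

Lemma rhZ m c v : f m (c *: v) = c *: f m v.
Proof. by have := @rh_linear _ _ _ _ f m c v 0; rewrite !addr0 rh0 addr0. Qed.

Lemma rhB m u v : f m (u - v) = f m u - f m v.
Proof. by rewrite -scaleN1r rhD rhZ scaleN1r. Qed.

(** [a] is the operator norm at [m], finite by local boundedness; some vector of the unit ball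
    attains at least three quarters of it. *)
Lemma rh_norm_attained m (A : R) (v0 : E m) : 0 <= A -> A * hnorm v0 < hnorm (f m v0) ->
  exists (a : R) (v : E m), [/\ A < a, forall u, hnorm (f m u) <= a * hnorm u,
    hnorm v <= 1 & 3 / 4 * a <= hnorm (f m v)].
Proof.
move=> A0 Av; have [C nC] := rh_locally_bounded f m.
have fC : (opnorm (f m) <= C%:E)%E := nbhs_singleton nC.
have f0 : (0%:E <= opnorm (f m))%E.
  by apply: ereal_sup_ubound; exists 0; rewrite /= ?rh0 ?hnorm0.
have [a ae] : exists a, opnorm (f m) = a%:E.
  exists (fine (opnorm (f m))); rewrite fineK// fin_numE.
  by move: fC f0; case: (opnorm (f m)).
have fa u : hnorm (f m u) <= a * hnorm u.
  by apply: opnorm_bound; [exact: rh_linear|rewrite ae].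
have Aa : A < a.
  rewrite ltNge; apply/negP => aA; have := lt_le_trans Av (fa v0).
  by rewrite ltNge ler_wpM2r// hnorm_ge0.
have a0 : 0 < a by exact: le_lt_trans Aa.
exists a; apply: contrapT => nv.
have : (opnorm (f m) <= (3 / 4 * a)%:E)%E.
  apply: ge_ereal_sup => _ [v /= v1 <-]; rewrite lee_fin leNgt; apply/negP => va.
  by apply: nv; exists v; split => //; exact: ltW.
by rewrite ae lee_fin => h; lra.
Qed.

(* Gliding hump: otherwise a rapidly converging series of sections has an image of unbounded
   norm, although that image is again a section. *)
Lemma rep_hom_bounded : exists2 C : R, 0 <= C & forall m (v : E m), hnorm (f m v) <= C * hnorm v.
Proof.
apply: contrapT => unbounded.
have big A : 0 <= A -> exists m (v : E m), A * hnorm v < hnorm (f m v).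
  move=> A0; apply: contrapT => h; apply: unbounded; exists A => // m v.
  by rewrite leNgt; apply/negP => mv; apply: h; exists m, v.
have q0 k : 0 < 3^-1 ^+ k :> R by rewrite exprn_gt0// invr_gt0.
(* [s] is the partial sum so far and [w] stands for whatever the later terms may add. *)
have step k (s : forall m, E m) : {xi : forall m, E m | field_sec xi /\ (field_sec s ->
    (forall m, hnorm (xi m) <= 3^-1 ^+ k) /\ exists m, forall w : E m,
      hnorm w <= 2^-1 * 3^-1 ^+ k -> k%:R <= hnorm (f m (s m + xi m + w)))}.
  apply: cid; have [ss|ns] := pselect (field_sec s); last first.
    by exists (fun=> 0); split => //; exact: field_sec0.
  have [B sB] := field_sec_bounded (rh_sec f ss).
  (* With q = 3^-k, the new hump has size at least 3/4 a q and later terms disturb it by at most a q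
     / 2; the remaining a q / 4 must absorb [B] and leave [k]. *)
  have A0 : 0 <= 4 * (`|B| + k%:R) / 3^-1 ^+ k by rewrite divr_ge0 ?mulr_ge0 ?addr_ge0// ltW.
  have [m [v0 mv0]] := big _ A0.
  have [a [v [Aa fa v1 va]]] := rh_norm_attained A0 mv0.
  have [eta seta etam] := field_full ((3^-1 ^+ k)%:C *: v).
  have etaq : hnorm (eta m) <= 3^-1 ^+ k by rewrite etam hnormZ ?(ltW (q0 k))// ler_piMr ?(ltW
    (q0 k)).
  have [xi [sxi xim xiq]] := field_trunc seta (q0 k) etaq.
  exists xi; split => // _; split => //; exists m => w wq.
  rewrite xim etam !rhD rhZ.
  set q := 3^-1 ^+ k in A0 Aa etaq xiq wq *.
  have qp : 0 < q := q0 k.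
  have h1 : hnorm (f m w) <= a * (2^-1 * q).
    apply: le_trans (fa w) _; apply: ler_wpM2l => //.
    by apply: le_trans (ltW Aa).
  have h2 := sB m.
  have h3 : 3 / 4 * a * q <= hnorm (q%:C *: f m v).
    by rewrite hnormZ ?(ltW qp)// mulrC ler_wpM2l ?(ltW qp).
  have h4 : 4 * (`|B| + k%:R) <= a * q by rewrite -ler_pdivrMr// ltW.
  have h5 : hnorm (q%:C *: f m v) <= hnorm (f m (s m) + q%:C *: f m v + f m w) +
      (hnorm (f m (s m)) + hnorm (f m w)).
    set p := f m (s m); set y := _ *: _; set z := f m w.
    have e : y = (p + y + z) - (p + z) by rewrite (addrAC p y z) (addrC (p + z) y) addrK.
    by rewrite {1}e; apply: le_trans (hnormB _ _) _; rewrite lerD2l hnormD.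
  have h6 := ler_norm B.
  by lra.
pose sums := fix sums n : forall m, E m :=
  if n is k.+1 then (fun m => sums k m + sval (step k (sums k)) m) else fun=> 0.
pose xi k := sval (step k (sums k)).
have sxi k : field_sec (xi k) := (svalP (step k (sums k))).1.
have ssums k : field_sec (sums k).
  by elim: k => [|k ih]; [exact: (field_sec0 E)|exact: (field_secD ih (sxi k))].
have xiq k m : hnorm (xi k m) <= 1 * 3^-1 ^+ k.
  by rewrite mul1r; have [h _] := (svalP (step k (sums k))).2 (ssums k); exact: h.
have [s ss sP] := section_series (field_sec0 E) (@field_secD _ _ E) (@field_C0 _ _ E)
  (@field_closed _ _ E) ler01 sxi xiq.
have sumsE n m : \sum_(k < n) xi k m = sums n m.
  by elim: n => [|n ih]; rewrite ?big_ord0// big_ord_recr/= ih.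
have [B fsB] := field_sec_bounded (rh_sec f ss).
have [k Bk] : exists k : nat, B < k%:R.
  exists (Num.bound `|B|); apply: le_lt_trans (ler_norm B) _.
  exact: archi_boundP.
have [_ [m mk]] := (svalP (step k (sums k))).2 (ssums k).
(* The tail (3/2) 3^-(k+1) is exactly the disturbance allowed for. *)
have w0 : hnorm (s m - sums k.+1 m) <= 2^-1 * 3^-1 ^+ k.
  rewrite hnormBC -sumsE; apply: le_trans (sP k.+1 m) _; rewrite mul1r exprS.
  by rewrite le_eqVlt; apply/orP; left; apply/eqP; field.
have := mk _ w0; rewrite /= -/(xi k) addrC subrK => h.
by have := fsB m; rewrite leNgt (lt_le_trans Bk h).
Qed.

End rep_hom_bounded.

Section transfer_representation.
Variables (R : realType) (G H : continuous_groupoid) (lam : right_haar_system R H).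
Hypothesis fs : full_support lam.
Variables (N : topologicalType) (a : left_action G N) (b : left_action H N).
Variable P : principal b (lJ a).
Hypothesis inv : forall g n, gsrc g = lJ a n -> lJ b (lact a g n) = lJ b n.
Hypothesis comm : forall g n h, gsrc g = lJ a n -> gsrc h = lJ b n ->
  lact b h (lact a g n) = lact a g (lact b h n).

Lemma div_lact g n' n : gsrc g = lJ a n -> lJ a n' = lJ a n ->
  pr_div P (lact a g n') (lact a g n) = pr_div P n' n.
Proof.
move=> gn e; rewrite -{1}(pr_div_act P e) -comm ?pr_div_src//.
by rewrite pr_div_uniq// inv// pr_div_src.
Qed.

Section one_representation.
Variable E : representation R H.

(* The action of [g] on the transferred fibres, computed at representatives [n] of the source
   and [n'] of the target. *)
Definition gtransport (g : G) (n' n : N) (gn : gsrc g = lJ a n) (e :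
  lJ a n' = lJ a (lact a g n)) :
    E (lJ b n) -> E (lJ b n') :=
  rho (etrans (pr_div_src P e) (inv gn)) (div_tgt P e).

(** The second division does not change when both its points are moved by [g]; after that the two
    divisions share a point and compose. *)
Lemma gtransport_comp (g h k : G) (n'' n' n : N) (gn : gsrc g = lJ a n')
    (e : lJ a n'' = lJ a (lact a g n')) (hn : gsrc h = lJ a n) (e' : lJ a n' = lJ a (lact a h n))
    (kn : gsrc k = lJ a n) (e'' : lJ a n'' = lJ a (lact a k n)) v : k = gmul g h ->
  gtransport gn e (gtransport hn e' v) = gtransport kn e'' v.
Proof.
move=> kE; subst k; apply: rho_mul.
have gh : gsrc g = gtgt h by rewrite gn e' lJ_act.
rewrite lactM// -[X in gmul _ X](div_lact (g := g))//; last by rewrite -e'.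
rewrite div_mul// [RHS]lJ_act; last by rewrite -e'.
by rewrite lJ_act.
Qed.

Lemma gtransport_unit (g : G) (n' n : N) (gn : gsrc g = lJ a n) (e : lJ a n' = lJ a (lact a g n))
    (e' : lJ a n' = lJ a n) v : g = gunit (lJ a n) -> gtransport gn e v = transport P e' v.
Proof. by move=> gE; subst g; apply: rho_irr; rewrite lact1. Qed.

Lemma gtransportl (g : G) (n'' n' n : N) (gn : gsrc g = lJ a n) (e : lJ a n' = lJ a (lact a g n))
    (e1 : lJ a n'' = lJ a n') (e2 : lJ a n'' = lJ a (lact a g n)) v :
  transport P e1 (gtransport gn e v) = gtransport gn e2 v.
Proof. by apply: rho_mul; rewrite div_mul. Qed.

Lemma gtransportr (g : G) (n'' n' n : N) (gn : gsrc g = lJ a n) (gn' : gsrc g = lJ a n')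
    (e : lJ a n'' = lJ a (lact a g n')) (e1 : lJ a n' = lJ a n)
    (e2 : lJ a n'' = lJ a (lact a g n)) v :
  gtransport gn' e (transport P e1 v) = gtransport gn e2 v.
Proof.
apply: rho_mul; rewrite -[X in gmul _ X](div_lact (g := g))// div_mul//.
by rewrite !lJ_act.
Qed.

Definition tfld := tfield fs P (@gbase_hausdorff G) (@gbase_locally_compact G) E.

Lemma base_lift_src (g : G) : gsrc g = lJ a (base_lift P (gsrc g)).
Proof. by rewrite base_liftK. Qed.

Lemma base_lift_tgt (g : G) x : gsrc g = lJ a (base_lift P x) ->
  lJ a (base_lift P (gtgt g)) = lJ a (lact a g (base_lift P x)).
Proof. by move=> gx; rewrite base_liftK lJ_act. Qed.

Definition tpi (g : G) : tfld (gsrc g) -> tfld (gtgt g) :=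
  gtransport (base_lift_src g) (base_lift_tgt (base_lift_src g)).

Lemma pi_at_tpi (g : G) (x y : gbase G) (sx : gsrc g = x) (ty : gtgt g = y)
    (gx : gsrc g = lJ a (base_lift P x)) (e :
      lJ a (base_lift P y) = lJ a (lact a g (base_lift P x))) v :
  pi_at tpi sx ty v = gtransport gx e v.
Proof. by subst x y; exact: rho_irr. Qed.

Lemma tpi_unitary g : unitary (@tpi g).
Proof. exact: rho_unitary. Qed.

Lemma tpi_unit m (v : tfld m) : pi_at tpi (gsrc_unit m) (gtgt_unit m) v = v.
Proof.
have gx : gsrc (gunit m) = lJ a (base_lift P m) by rewrite gsrc_unit base_liftK.
have e : lJ a (base_lift P m) = lJ a (lact a (gunit m) (base_lift P m)).
  by rewrite lJ_act// gtgt_unit base_liftK.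
rewrite (pi_at_tpi _ _ gx e) (gtransport_unit gx e (erefl (lJ a (base_lift P m)))).
  exact: transport_refl.
by rewrite base_liftK.
Qed.

Lemma tpi_mul g h (gh : gsrc g = gtgt h) (v : tfld (gsrc h)) :
  pi_at tpi (gsrc_mul gh) (gtgt_mul gh) v = pi_at tpi gh erefl (tpi v).
Proof.
have gx : gsrc (gmul g h) = lJ a (base_lift P (gsrc h)) by rewrite gsrc_mul// base_liftK.
have e : lJ a (base_lift P (gtgt g)) = lJ a (lact a (gmul g h) (base_lift P (gsrc h))).
  by rewrite base_liftK lJ_act// gtgt_mul.
have gx' : gsrc g = lJ a (base_lift P (gtgt h)) by rewrite base_liftK.
have e' : lJ a (base_lift P (gtgt g)) = lJ a (lact a g (base_lift P (gtgt h))).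
  by rewrite base_liftK lJ_act.
rewrite (pi_at_tpi _ _ gx e) (pi_at_tpi _ _ gx' e') /tpi.
by rewrite (gtransport_comp _ _ _ _ gx e).
Qed.

Lemma tpi_inv g : cancel (@tpi g) (pi_at tpi (gsrc_inv g) (gtgt_inv g)) /\
  cancel (pi_at tpi (gsrc_inv g) (gtgt_inv g)) (@tpi g).
Proof.
have gx : gsrc (ginv g) = lJ a (base_lift P (gtgt g)) by rewrite gsrc_inv base_liftK.
have e : lJ a (base_lift P (gsrc g)) = lJ a (lact a (ginv g) (base_lift P (gtgt g))).
  by rewrite base_liftK lJ_act// gtgt_inv.
split=> v; rewrite (pi_at_tpi _ _ gx e) /tpi.
  have u1 : gsrc (gunit (gsrc g)) = lJ a (base_lift P (gsrc g)) by rewrite gsrc_unit base_liftK.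
  have u2 : lJ a (base_lift P (gsrc g)) = lJ a (lact a (gunit (gsrc g)) (base_lift P (gsrc g))).
    by rewrite lJ_act// gtgt_unit base_liftK.
  rewrite (gtransport_comp _ _ _ _ u1 u2) ?gVmul//.
  by rewrite (gtransport_unit u1 u2 erefl) ?base_liftK// transport_refl.
have u1 : gsrc (gunit (gtgt g)) = lJ a (base_lift P (gtgt g)) by rewrite gsrc_unit base_liftK.
have u2 : lJ a (base_lift P (gtgt g)) = lJ a (lact a (gunit (gtgt g)) (base_lift P (gtgt g))).
  by rewrite lJ_act// gtgt_unit base_liftK.
rewrite (gtransport_comp _ _ _ _ u1 u2) ?gmulV//.
by rewrite (gtransport_unit u1 u2 erefl) ?base_liftK// transport_refl.
Qed.

Lemma lift_secE (xi : forall x, tfld x) n x (e : lJ a n = x) (e' :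
  lJ a n = lJ a (base_lift P x)) :
  lift_sec P E xi n = transport P e' (xi x).
Proof. by subst x; exact: rho_irr. Qed.

(* The two sides of the continuity estimate, computed at an arbitrary point [n] over the source
   of [g] instead of the chosen one. *)
Lemma tpi_at g n (gn : gsrc g = lJ a n) (gn' : lJ a (lact a g n) = lJ a (lact a g n))
    (xi zeta : forall x, tfld x) :
  hnorm (tpi (xi (gsrc g)) - zeta (gtgt g)) =
  hnorm (gtransport gn gn' (lift_sec P E xi n) - lift_sec P E zeta (lact a g n)).
Proof.
have e1 : lJ a (lact a g n) = gtgt g by rewrite lJ_act.
have e2 : lJ a (lact a g n) = lJ a (base_lift P (gtgt g)) by rewrite base_liftK.
have e3 : lJ a n = lJ a (base_lift P (gsrc g)) by rewrite base_liftK.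
have e4 : lJ a (lact a g n) = lJ a (lact a g (base_lift P (gsrc g))).
  by rewrite !lJ_act// base_liftK.
rewrite (lift_secE zeta e1 e2) (lift_secE xi (esym gn) e3).
rewrite (gtransportr (base_lift_src g) _ _ _ e4) -(gtransportl _ (base_lift_tgt (base_lift_src
  g)) e2).
by rewrite -[in RHS]/(tpi (xi (gsrc g))) -rhoB rho_norm.
Qed.

(** The points n and g·n lie over the same point of the base of [H], so one section [al] of [E] can
    be compared with the lift of [xi] near [n0] and with the lift of [zeta] near g0·n0. *)
Lemma tpi_approx (g0 : G) (xi : forall x, tfld x) : field_sec xi ->
  sec_approx (nbhs g0) (@gtgt G) (fun g => tpi (xi (gsrc g))).
Proof.
move=> sxi eps eps0; have e2 : 0 < eps / 2 by rewrite divr_gt0.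
have [zeta sz zg] := field_full (tpi (xi (gsrc g0))).
exists zeta => //; pose n0 := base_lift P (gsrc g0);
  have gn0 : gsrc g0 = lJ a n0 := base_lift_src g0.
have [al sal aln] := field_full (lift_sec P E xi n0).
pose A := [set y : G * N | gsrc y.1 = lJ a y.2].
pose W := within A (nbhs (g0, n0)).
have Wx Q : W Q -> Q (g0, n0) by move=> /nbhs_singleton; exact.
have n1 : \forall y \near nbhs n0, hnorm (lift_sec P E xi y - al (lJ b y)) < eps / 2.
  apply: (@approx_near _ _ E _ (nbhs n0) _ (lJ b) n0) => //.
  - by move=> Q /nbhs_singleton.
  - exact: lJ_continuous.
  - by have [_] := sxi; exact.
  - exact: approx_sec.
pose n0' := lact a g0 n0.
(* The arrow involved is the division of [lact a g n] by itself, a unit; only the type of the base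
   point changes. *)
have castal g n (gn : gsrc g = lJ a n) (e : lJ a (lact a g n) = lJ a (lact a g n)) :
    gtransport gn e (al (lJ b n)) = al (lJ b (lact a g n)).
  by apply: (@rho_unit_sec _ _ _ _ _ (lJ b (lact a g n))); [rewrite inv|by []|exact: div_refl].
have n2 : \forall y \near nbhs n0', hnorm (al (lJ b y) - lift_sec P E zeta y) < eps / 2.
  apply: (@approx_near _ _ E _ (nbhs n0') _ (lJ b) n0') => //.
  - by move=> Q /nbhs_singleton.
  - exact: lJ_continuous.
  - exact: approx_sec.
  - by have [_] := sz; exact.
  - rewrite -(castal _ _ gn0 erefl) aln; apply/eqP; rewrite -subr_eq0; apply/eqP/hnorm_eq0.
    by rewrite -tpi_at zg subrr hnorm0.
have good g n : gsrc g = lJ a n -> hnorm (lift_sec P E xi n - al (lJ b n)) < eps / 2 ->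
    hnorm (al (lJ b (lact a g n)) - lift_sec P E zeta (lact a g n)) < eps / 2 ->
    hnorm (tpi (xi (gsrc g)) - zeta (gtgt g)) < eps.
  move=> gn h1 h2; rewrite (tpi_at gn erefl).
  apply: le_lt_trans (hnormB_tri (al (lJ b (lact a g n))) _ _) _.
  by rewrite (splitr eps) ltrD// -(castal _ _ gn erefl) -rhoB rho_norm.
have [U [V [nU nV UV]]] := lact_nbhs gn0 n2.
(* Openness of the moment map supplies, for each [g] near [g0], a point over its source that is near
   [n0]. *)
have nJ : nbhs (gsrc g0) (lJ a @` (V `&` [set y | hnorm (lift_sec P E xi y - al (lJ b y)) < eps
  / 2])).
  by rewrite gn0; apply: (open_map_nbhs (pr_open P)); exact: filterI.
apply: (@filterS2 _ (nbhs g0) _ _ _ _ _ nU (@gsrc_continuous G g0 _ nJ)).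
move=> g Ug [n [Vn hn] /esym gn].
by apply: (good g n) => //; exact: UV.
Qed.

Definition trep : representation R G := @Representation R G tfld tpi tpi_unitary tpi_unit
  tpi_mul tpi_inv (rep_continuous_of_approx tpi_unitary tpi_approx).

End one_representation.

Lemma rh_rho (E F : representation R H) (f : rep_hom E F) (h : H) (x y : gbase H)
    (sx : gsrc h = x) (ty : gtgt h = y) (v : E x) : f y (rho sx ty v) = rho sx ty (f x v).
Proof. by subst x y; exact: rh_intertwine. Qed.

Section morphism.
Variables (E F : representation R H) (f : rep_hom E F).

Definition thom_map (m : gbase G) : trep E m -> trep F m := f (lJ b (base_lift P m)).

(** Vanishing of the image norm at infinity is where the global bound is essential. *)
Lemma thom_sec (xi : forall m, trep E m) : field_sec xi ->
  field_sec (fun m => thom_map (xi m) : trep F m).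
Proof.
move=> [cxi axi]; have [C C0' fC] := rep_hom_bounded f.
have lf n : lift_sec P F (fun m => thom_map (xi m)) n = f (lJ b n) (lift_sec P E xi n).
  by rewrite /lift_sec /transport rh_rho.
have al (n0 : N) : sec_approx (nbhs n0) (lJ b) (lift_sec P F (fun m => thom_map (xi m))).
  apply: (approx_ext (u := fun n => f (lJ b n) (lift_sec P E xi n))) => [n|]; first by rewrite lf.
  move=> eps eps0; have e2 : 0 < eps / (C + 1) by rewrite divr_gt0// ltr_wpDl.
  have [eta seta near] := axi n0 _ e2.
  exists (fun m => f m (eta m)); first exact: rh_sec.
  apply: (@filterS _ (nbhs n0) _ _ _ _ near) => n h; rewrite -rhB.
  apply: le_lt_trans (fC _ _) _; apply: (@le_lt_trans _ _ ((C + 1) * hnorm (lift_sec P E xi n -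
    eta (lJ b n)))).
    by rewrite ler_wpM2r ?hnorm_ge0// lerDl.
  by rewrite mulrC -ltr_pdivlMr// ltr_wpDl.
split => //; apply: (C0_le (c := C) _ cxi).
  exact: (tsec_continuous (P := P)).
by move=> m; rewrite !ger0_norm ?hnorm_ge0//; exact: fC.
Qed.

(** Chosen points above nearby base points need not be close, so the bound is taken from the global
    one. *)
Lemma thom_bounded (m : gbase G) : exists C :
  R, \forall n \near m, (opnorm (@thom_map n) <= C%:E)%E.
Proof.
have [C C0' fC] := rep_hom_bounded f; exists C; apply: nearW => n.
apply: ge_ereal_sup => _ [v /= v1 <-]; rewrite lee_fin.
by apply: le_trans (fC _ _) _; rewrite ler_piMr.
Qed.

Lemma thom_intertwine (g : G) (v : trep E (gsrc g)) :
  thom_map (rep_pi v) = rep_pi (thom_map v).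
Proof. exact: rh_rho. Qed.

Definition thom : rep_hom (trep E) (trep F) := @RepHom R G (trep E) (trep F) thom_map
  (fun m => @rh_linear _ _ _ _ f _) thom_sec thom_bounded thom_intertwine.

End morphism.

Lemma thom_id (E : representation R H) : thom (rep_id E) = rep_id (trep E).
Proof. exact: rep_hom_eq. Qed.

Lemma thom_comp (E F K : representation R H) (f : rep_hom F K) (g : rep_hom E F) :
  thom (rep_comp f g) = rep_comp (thom f) (thom g).
Proof. exact: rep_hom_eq. Qed.

Definition transfer : functor (Rep R H) (Rep R G) :=
  @Functor (Rep R H) (Rep R G) trep thom thom_id thom_comp.

End transfer_representation.

(** * The round trip is the identity *)

Section natural_isomorphism.
Variables (R : realType) (G H : continuous_groupoid).
Variables (lamG : right_haar_system R G) (lamH : right_haar_system R H).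
Hypotheses (fsG : full_support lamG) (fsH : full_support lamH).
Variables (N : topologicalType) (a : left_action G N) (b : left_action H N).
Variables (Pa : principal a (lJ b)) (Pb : principal b (lJ a)).
Hypothesis comm : forall g n h, gsrc g = lJ a n -> gsrc h = lJ b n ->
  lact b h (lact a g n) = lact a g (lact b h n).

(** The mirror image of [comm]; with both at hand, exchanging the groupoids yields the second round
    trip verbatim. *)
Hypothesis commV : forall h n g, gsrc h = lJ b n -> gsrc g = lJ a n ->
  lact a g (lact b h n) = lact b h (lact a g n).

Let invG g n (gn : gsrc g = lJ a n) : lJ b (lact a g n) = lJ b n := pr_inv Pa gn.
Let invH h n (hn : gsrc h = lJ b n) : lJ a (lact b h n) = lJ a n := pr_inv Pb hn.

Local Notation TG := (@trep R H G lamG fsG N b a Pa invH commV).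
Local Notation TH := (@trep R G H lamH fsH N a b Pb invG comm).

Section component.
Variable E : representation R G.
Local Notation E1 := (TG E).
Local Notation E2 := (TH E1).

Let s (x : gbase G) : N := base_lift Pb x.
Let t (y : gbase H) : N := base_lift Pa y.

Lemma base_lift_twice x : lJ b (s x) = lJ b (t (lJ b (s x))).
Proof. by rewrite base_liftK. Qed.

(** [E2 x] is the fibre of [E] over [lJ a (t (lJ b (s x)))]. The points [t (lJ b (s x))] and [s x]
    lie over the same point of the base of [H], and their division is an arrow of [G] ending at
    [x]. *)
Definition unit_map x : E2 x -> E x :=
  rho (pr_div_src Pa (base_lift_twice x)) (etrans (div_tgt Pa (base_lift_twice x)) (base_liftK
    Pb x)).

Lemma counit_src x : gsrc (pr_div Pa (t (lJ b (s x))) (s x)) = x.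
Proof. by rewrite pr_div_src ?base_liftK. Qed.

Definition counit_map x : E x -> E2 x :=
  rho (counit_src x) (div_tgt Pa (esym (base_lift_twice x))).

Lemma counit_mapK x : cancel (@counit_map x) (@unit_map x).
Proof.
move=> v; rewrite /unit_map /counit_map.
have u1 : gsrc (gunit x) = x by rewrite gsrc_unit.
have u2 : gtgt (gunit x) = x by rewrite gtgt_unit.
rewrite (rho_mul _ _ _ _ u1 u2); first exact: (rho_unit u1 u2).
by rewrite div_mul ?base_liftK// div_refl base_liftK.
Qed.

Lemma unit_mapK x : cancel (@unit_map x) (@counit_map x).
Proof.
move=> v; rewrite /unit_map /counit_map.
set y := lJ a (t (lJ b (s x))).
rewrite (rho_mul _ _ _ _ (gsrc_unit y) (gtgt_unit y)).
  exact: (@rho_unit R G E y _ y (gsrc_unit y) (gtgt_unit y) v erefl).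
by rewrite div_mul ?base_liftK// div_refl.
Qed.

(* Lifting through both transfers and comparing with the original fibre does not depend on the
   point [n] above [x]. *)
Lemma unit_map_transport n x (ex : lJ a n = x) (e1 : lJ b n = lJ b (t (lJ b n)))
    (e2 : lJ a n = lJ a (s x)) (w : E2 x) :
  rho (pr_div_src Pa e1) (etrans (div_tgt Pa e1) ex) (transport (E := E1) Pb e2 w) = unit_map w.
Proof.
set h := pr_div Pb n (s x).
have hs : gsrc h = lJ b (t (lJ b (s x))) by rewrite pr_div_src// base_liftK.
have e3 : lJ b (t (lJ b n)) = lJ b (lact b h (t (lJ b (s x)))).
  by rewrite base_liftK lJ_act// div_tgt.
rewrite /transport /rho (pi_at_tpi invH _ _ hs e3).
apply: rho_mul; rewrite div_mul//.
rewrite -[X in _ = pr_div Pa X _](pr_div_act Pb e2).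
by apply/esym; apply: div_lact => //; exact: base_lift_twice.
Qed.

Lemma unit_map_lift (xi : forall x, E2 x) n (e1 : lJ b n = lJ b (t (lJ b n))) :
  transport (E := E) Pa e1 (lift_sec Pb E1 xi n) = unit_map (xi (lJ a n)).
Proof.
by rewrite -(unit_map_transport (erefl (lJ a n)) e1 (base_lift_fiber Pb n)); exact: rho_irr.
Qed.

Lemma unit_map_norm x (v : E2 x) : hnorm (unit_map v) = hnorm v.
Proof. exact: rho_norm. Qed.

Lemma counit_map_norm x (v : E x) : hnorm (counit_map v) = hnorm v.
Proof. exact: rho_norm. Qed.

Lemma unit_map_linear x : linear (@unit_map x).
Proof.
by have [] := @rho_unitary R G E _ _ _ (pr_div_src Pa (base_lift_twice x))
  (etrans (div_tgt Pa (base_lift_twice x)) (base_liftK Pb x)).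
Qed.

Lemma counit_map_linear x : linear (@counit_map x).
Proof.
by have [] := @rho_unitary R G E _ _ _ (counit_src x) (div_tgt Pa (esym (base_lift_twice x))).
Qed.

Lemma isometry_bounded (E' F' : representation R G) (f : forall m, E' m -> F' m) (m : gbase G) :
  (forall m v, hnorm (f m v) = hnorm v) ->
  exists C : R, \forall n \near m, (opnorm (@f n) <= C%:E)%E.
Proof.
move=> fN; exists 1; apply: nearW => n; apply: ge_ereal_sup => _ [v /= v1 <-].
by rewrite lee_fin fN.
Qed.

Lemma unit_map_intertwine (g : G) (v : E2 (gsrc g)) :
  unit_map (@rep_pi _ _ E2 g v) = rep_pi (unit_map v).
Proof.
set n := s (gsrc g); set n' := s (gtgt g).
have gn : gsrc g = lJ a n by rewrite base_liftK.
have e : lJ a n' = lJ a (lact a g n) by rewrite base_liftK lJ_act.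
set h := pr_div Pb n' (lact a g n).
have hs : gsrc h = lJ b (t (lJ b n)) by rewrite pr_div_src// base_liftK (pr_inv Pa).
have e3 : lJ b (t (lJ b n')) = lJ b (lact b h (t (lJ b n))).
  by rewrite base_liftK lJ_act// div_tgt.
have -> : @rep_pi _ _ E2 g v = gtransport Pa invH (E := E) hs e3 v.
  by rewrite -[LHS]/(rho (E := E1) _ _ v) /rho (pi_at_tpi invH _ _ hs e3).
have hb : gsrc h = lJ b (lact a g n) by rewrite pr_div_src.
have tt : lJ b n = lJ b (t (lJ b n)) by rewrite base_liftK.
(* Write [n'] as h·(g·n). Division for [G] is unchanged when [h] moves both points, and dividing g·n
   by a point is [g] times dividing n by it. Both sides of the goal act by this arrow. *)
have dE : pr_div Pa n' (lact b h (t (lJ b n))) = gmul g (pr_div Pa n (t (lJ b n))).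
  have -> : n' = lact b h (lact a g n) by rewrite pr_div_act.
  rewrite div_lact//; last by rewrite (pr_inv Pa).
  rewrite -[X in pr_div Pa X _ = _](_ :
    lact a (gmul g (pr_div Pa n (t (lJ b n)))) (t (lJ b n)) = _).
    by rewrite pr_div_uniq// gsrc_mul ?pr_div_src// div_tgt.
  by rewrite lactM ?pr_div_act ?pr_div_src// div_tgt.
rewrite -(rhoE (erefl (gsrc g)) (erefl (gtgt g))).
rewrite /unit_map /gtransport.
have s1 : gsrc (gmul g (pr_div Pa n (t (lJ b n)))) = lJ a (t (lJ b n)).
  by rewrite gsrc_mul ?pr_div_src// div_tgt.
have t1 : gtgt (gmul g (pr_div Pa n (t (lJ b n)))) = gtgt g.
  by rewrite gtgt_mul// div_tgt.
rewrite [RHS](rho_mul _ _ _ _ s1 t1)//; apply: rho_mul.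
by rewrite div_mul//; exact: base_lift_twice.
Qed.

(** Two approximations are chained above [s x0], one for each transfer; openness of [lJ a] carries
    the estimate down to the base. *)
Lemma unit_map_sec (xi : forall m, E2 m) : field_sec xi -> field_sec (fun m => unit_map (xi m)).
Proof.
move=> [cxi axi]; apply: field_closed.
  have -> : (fun m => hnorm (unit_map (xi m))) = (fun m => hnorm (xi m)) by
    apply/funext => m; rewrite unit_map_norm.
  exact: cxi.
move=> eps eps0 x0; have e2 : 0 < eps / 2 by rewrite divr_gt0.
have [zeta [_ sz] near1] := axi (s x0) _ e2.
have [al sal near2] := sz (s x0) _ e2.
exists al => //.
have near12 : nbhs (s x0) [set n | hnorm (lift_sec Pb E1 xi n - zeta (lJ b n)) < eps / 2 /\
    hnorm (lift_sec Pa E zeta n - al (lJ a n)) < eps / 2].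
  exact: (filterI near1 near2).
have on := open_map_nbhs (pr_open Pb) near12.
have sx : lJ a (s x0) = x0 := base_liftK Pb x0; rewrite sx in on.
apply: (@filterS _ (nbhs x0) _ _ _ _ on) => _ [n [h1 h2] <-].
rewrite -(unit_map_lift xi (base_lift_fiber Pa n)).
apply: le_lt_trans (hnormB_tri (lift_sec Pa E zeta n) _ _) _.
rewrite (splitr eps) ltrD//.
by rewrite /lift_sec -rhoB rho_norm.
Qed.

(** Transporting the lift back to [E] recovers [xi], so the comparison with [zeta] is one between
    continuous lifts that agree at [n0]. *)
Lemma counit_map_sec (xi : forall m, E m) : field_sec xi ->
  @field_sec _ _ E2 (fun m => counit_map (xi m)).
Proof.
move=> sxi; split.
  have -> : (fun m => hnorm (counit_map (xi m))) = (fun m => hnorm (xi m)) by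
    apply/funext => m; rewrite counit_map_norm.
  exact: field_C0.
move=> n0 eps eps0; set u := lift_sec _ _ _.
have [zeta sz zn0] := @field_full _ _ E1 _ (u n0).
exists zeta => //.
have ue n : transport (E := E) Pa (base_lift_fiber Pa n) (u n) = xi (lJ a n).
  by rewrite unit_map_lift counit_mapK.
have : \forall n \near n0, hnorm (xi (lJ a n) - lift_sec Pa E zeta n) < eps.
  apply: (@approx_near _ _ E _ (nbhs n0) _ (lJ a) n0) => //.
  - by move=> Q /nbhs_singleton.
  - exact: lJ_continuous.
  - exact: approx_sec.
  - by have [_] := sz; exact.
  - by rewrite -ue -zn0.
apply: (@filterS _ (nbhs n0)) => n.
by rewrite -ue /lift_sec -rhoB rho_norm.
Qed.

Definition unit_hom : rep_hom E2 E := @RepHom R G E2 E unit_map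
  unit_map_linear unit_map_sec (fun m =>
    @isometry_bounded E2 E unit_map m unit_map_norm) unit_map_intertwine.

Lemma counit_map_intertwine (g : G) (v : E (gsrc g)) :
  counit_map (rep_pi v) = @rep_pi _ _ E2 g (counit_map v).
Proof.
by rewrite -[RHS]unit_mapK unit_map_intertwine counit_mapK.
Qed.

Definition counit_hom : rep_hom E E2 := @RepHom R G E E2 counit_map
  counit_map_linear counit_map_sec (fun m => @isometry_bounded E E2 counit_map m counit_map_norm)
  counit_map_intertwine.

End component.

Lemma transfer_unit :
  naturally_isomorphic
    (functor_comp (@transfer R G H lamH fsH N a b Pb invG comm)
                  (@transfer R H G lamG fsG N b a Pa invH commV))
    (functor_id (Rep R G)).
Proof.
exists unit_hom, counit_hom; split.
- by move=> E F f; apply: rep_hom_eq => m v; rewrite /= /thom_map; exact/esym/rh_rho.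
- by move=> E; apply: rep_hom_eq => m v; exact: unit_mapK.
- by move=> E; apply: rep_hom_eq => m v; exact: counit_mapK.
Qed.

End natural_isomorphism.

(** * Morita bibundles *)

Local Open Scope quotient_scope.

(** Trades the homeomorphism for properties of [J] on [N] itself, so that class representatives
    disappear from later arguments. *)
Lemma quotient_homeomorphism (N X : topologicalType) (e : equiv_rel N) (J : N -> X) :
  (forall n n', e n n' -> J n = J n') ->
  homeomorphism (fun q : quotient_topology {eq_quot e} => J (repr q)) ->
  [/\ forall x, exists n, J n = x,
      forall n n', J n = J n' -> e n n'
    & forall A : set X, open (J @^-1` A) -> open A].
Proof.
move=> Je [cJ [f [cf fK Kf]]].
have Jpi n : J (repr (\pi_(quotient_topology {eq_quot e}) n)) = J n.
  by apply: Je; apply/eqquotP; exact: (@reprK _ (quotient_topology {eq_quot e})).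
split.
- by move=> x; exists (repr (f x)); exact: Kf.
- move=> n n' nn'; apply/eqquotP.
  have h1 := fK (\pi_(quotient_topology {eq_quot e}) n).
  have h2 := fK (\pi_(quotient_topology {eq_quot e}) n').
  rewrite Jpi nn' -(Jpi n') h2 in h1; exact: (esym h1).
- move=> A oA.
  have -> : A = f @^-1` [set q | A (J (repr q))].
    by apply/seteqP; split => x /=; rewrite Kf.
  move/continuousP : cf; apply.
  have -> : open [set q : quotient_topology {eq_quot e} | A (J (repr q))] = open (J @^-1` A) =>
    //.
  rewrite /open/= /quotient_open; congr open.
  by apply/seteqP; split => n /=; rewrite Jpi.
Qed.

(** The saturation of an open set is open: if [h] moves [n] into [U], openness of the source gives,
    for each [m] near [n], an arrow near [h] that acts on [m] and moves it into [U]. *)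
Lemma orbit_map_open (H : continuous_groupoid) (N X : topologicalType) (b : left_action H N)
    (J : N -> X) : open_map (@gsrc H) ->
  (forall h n, gsrc h = lJ b n -> J (lact b h n) = J n) ->
  (forall n n', J n = J n' -> exists h, gsrc h = lJ b n /\ lact b h n = n') ->
  (forall A : set X, open (J @^-1` A) -> open A) -> open_map J.
Proof.
move=> so Jinv Jorb Jq U oU; apply: Jq; rewrite openE => n [n' Un' /esym nn'].
have [h [hn hnn']] := Jorb _ _ nn'.
have nU : nbhs (lact b h n) U by apply: open_nbhs_nbhs; rewrite hnn'.
have [P [V [nP nV PV]]] := lact_nbhs hn nU.
have nS : nbhs (lJ b n) (@gsrc H @` P) by rewrite -hn; exact: open_map_nbhs.
apply: (@filterS2 _ (nbhs n) _ _ _ _ _ nV (@lJ_continuous _ _ b n _ nS)) => m Vm [k Pk km].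
by exists (lact b k m); [exact: PV|exact: Jinv].
Qed.

Lemma left_dirac_full_support (R : realType) (G : continuous_groupoid)
    (lam : right_haar_system R G) (N : topologicalType) (a : left_action G N) :
  (forall m, exists n, lJ a n = m) -> left_dirac lam a -> full_support lam.
Proof.
move=> as_ dirac m U oU U1; have [n nm] := as_ m; subst m.
have [d [_ md d1 dU]] := dirac n.
apply: (dirac_full_support (d := fun k (g : src_fiber (lJ a n)) => d k (lact a (set_val g) n))
  md d1) => //.
exact: (dU U oU U1 1 ltr01).
Qed.

Lemma fiber_inv_continuous (G : continuous_groupoid) (m : gbase G) :
  continuous (@fiber_inv G m).
Proof.
move=> g; apply: (cvg_initial (F := nbhs g)).
exact: (cvg_comp _ (@ginv G) (@set_val_src_continuous G m g) (@ginv_continuous G (set_val g))).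
Qed.

(** The Dirac condition concerns target fibres with the inverted measure; inversion carries
    neighbourhoods of the unit back to source fibres. *)
Lemma right_dirac_full_support (R : realType) (H : continuous_groupoid)
    (lam : right_haar_system R H) (N : topologicalType) (b : right_action H N) :
  (forall m, exists n, rJ b n = m) -> right_dirac lam b -> full_support lam.
Proof.
move=> bs dirac m U oU U1; have [n nm] := bs m; subst m.
have [d [_ md d1 dU]] := dirac n.
have mphi := borel_map_measurable (@fiber_inv_continuous H (rJ b n)).
pose mu := measure_function_pushforward__canonical__measure_function_Measure (lam (rJ b n)) mphi.
have tinv (h : tgt_fiber (rJ b n)) : gsrc (ginv (set_val h)) = rJ b n.
  by rewrite gsrc_inv; exact: (set_mem (proj2_sig h)).
pose psi (h : tgt_fiber (rJ b n)) : src_fiber (rJ b n) := src_fiber_of (tinv h).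
have psi_cont : continuous psi.
  move=> h; apply: (cvg_initial (F := nbhs h)).
  have vc : (fun h : tgt_fiber (rJ b n) => set_val h) @ nbhs h --> set_val h.
    exact: (@initial_continuous _ _ _ h).
  exact: (cvg_comp _ (@ginv H) vc (@ginv_continuous H (set_val h))).
have oV : open (psi @^-1` U) by apply: open_comp => // h _; exact: psi_cont.
have V1 : (psi @^-1` U) (tgt_fiber1 (rJ b n)).
  have -> : psi @^-1` U = [set h | U (psi h)] by [].
  have e : psi (tgt_fiber1 (rJ b n)) = src_fiber1 (rJ b n).
    by apply: val_inj; exact: ginv_unit.
  by rewrite /= e.
have := dirac_full_support (mu := mu)
  (d := fun k (h : tgt_fiber (rJ b n)) =>
    d k (ract b n (set_val h))) md d1 (dU _ oV V1 1 ltr01) oV.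
have -> : mu (psi @^-1` U) = lam (rJ b n) (@fiber_inv H (rJ b n) @^-1` (psi @^-1` U)) by [].
have psiK g : psi (fiber_inv g) = g by apply: val_inj; exact: ginvK.
by congr (lam _ _ != _); apply/seteqP; split => g /=; rewrite psiK.
Qed.

Section opposite_action.
Variables (H : continuous_groupoid) (N : topologicalType) (r : right_action H N).

Lemma opp_lJ_act h n : gsrc h = rJ r n -> rJ r (ract r n (ginv h)) = gtgt h.
Proof. by move=> hn; rewrite rJ_act ?gsrc_inv// gtgt_inv. Qed.

Lemma opp_lact1 n : ract r n (ginv (gunit (rJ r n))) = n.
Proof. by rewrite ginv_unit ract1. Qed.

Lemma opp_lactM g h n : gsrc g = gtgt h -> gsrc h = rJ r n ->
  ract r n (ginv (gmul g h)) = ract r (ract r n (ginv h)) (ginv g).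
Proof. by move=> gh hn; rewrite ginv_mul// ractM ?gtgt_inv// gsrc_inv. Qed.

Lemma opp_lact_continuous : {within [set x : H * N | gsrc x.1 = rJ r x.2],
  continuous (fun x : H * N => ract r x.2 (ginv x.1))}.
Proof.
apply/subspace_continuousP => -[h n] /= hn; set F := within _ _.
have A : \forall x \near F, gtgt (ginv x.1) = rJ r x.2.
  by apply: (@filterS _ F _ _ _ _ (withinT _ _)) => x; rewrite gtgt_inv.
have c : (x.2, ginv x.1) @[x --> F] --> (n, ginv h).
  apply: cvg_within_filter; apply: cvg_pair; first exact: cvg_snd.
  exact: (cvg_comp fst (@ginv H) cvg_fst (@ginv_continuous H h)).
have hn' : gtgt (ginv h) = rJ r n by rewrite gtgt_inv.
exact: (within_continuous_cvg (t := (n, ginv h)) (@ract_continuous _ _ r) hn' c A).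
Qed.

Definition opposite_action : left_action H N := @LeftAction H N (rJ r)
  (fun h n => ract r n (ginv h)) opp_lJ_act opp_lact1 opp_lactM (@rJ_continuous _ _ r)
  opp_lact_continuous.

End opposite_action.

Lemma principal_left (G : continuous_groupoid) (N X : topologicalType) (a : left_action G N)
    (J : N -> X) : open_map (@gsrc G) -> left_principal a -> continuous J ->
  (forall g n, gsrc g = lJ a n -> J (lact a g n) = J n) ->
  homeomorphism (fun q : left_quotient a => J (repr q)) -> principal a J.
Proof.
move=> so [_ _ /cid[f [cf fBA fK Kf]]] cJ Jinv hom.
have Je n n' : lorbit_equiv a n n' -> J n = J n' by move=> /asboolP[g [gn <-]]; rewrite Jinv.
have [Js Jorb Jq] := quotient_homeomorphism Je hom.
(* Pairs with the same class are pairs with the same [J], so the inverse of the principal map is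
   defined on the fibred square of [J]; its first component is division. *)
have BE : [set y : N * N | \pi_(left_quotient a) y.1 = \pi_(left_quotient a) y.2] =
    [set y | J y.1 = J y.2].
  apply/seteqP; split => y /= h; first by apply: Je; apply/eqquotP; exact: h.
  by have h2 : y.1 = y.2 %[mod {eq_quot lorbit_equiv a}] by [apply/eqquotP; exact: Jorb];
    exact: h2.
rewrite BE in cf fBA Kf.
have fE n' n (e : J n' = J n) :
    [/\ gsrc (f (n', n)).1 = lJ a n, lact a (f (n', n)).1 n = n' & (f (n', n)).2 = n].
  have := Kf (n', n) (mem_set e); have /= := fBA (n', n) e.
  by case: (f (n', n)) => g m /= + [gm mn]; rewrite mn in gm *.
apply: (@Principal _ _ a X J cJ Js Jinv (fun n' n => (f (n', n)).1)).
- by move=> n' n /fE[].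
- by move=> n' n /fE[].
- by move=> g n gn; have /= -> := fK (g, n) (mem_set gn).
- have -> : (fun y : N * N => (f (y.1, y.2)).1) = fst \o f by apply/funext => -[].
  apply/subspace_continuousP => y e; move/subspace_continuousP : cf => /(_ y e) c.
  exact: (cvg_comp f fst c cvg_fst).
- apply: (orbit_map_open so Jinv _ Jq) => n n' /Jorb/asboolP[g [gn gn']].
  by exists g.
Qed.

Lemma principal_right (H : continuous_groupoid) (N X : topologicalType) (r : right_action H N)
    (J : N -> X) : open_map (@gsrc H) -> right_principal r -> continuous J ->
  (forall n h, gtgt h = rJ r n -> J (ract r n h) = J n) ->
  homeomorphism (fun q : right_quotient r => J (repr q)) -> principal (opposite_action r) J.
Proof.
move=> so [_ _ /cid[f [cf fBA fK Kf]]] cJ Jinv hom.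
have Je n n' : rorbit_equiv r n n' -> J n = J n' by move=> /asboolP[h [hn <-]]; rewrite Jinv.
have [Js Jorb Jq] := quotient_homeomorphism Je hom.
have BE : [set y : N * N | \pi_(right_quotient r) y.1 = \pi_(right_quotient r) y.2] =
    [set y | J y.1 = J y.2].
  apply/seteqP; split => y /= h; first by apply: Je; apply/eqquotP; exact: h.
  by have h2 : y.1 = y.2 %[mod {eq_quot rorbit_equiv r}] by [apply/eqquotP; exact: Jorb];
    exact: h2.
rewrite BE in cf fBA Kf.
have fE n' n (e : J n' = J n) :
    [/\ gtgt (f (n, n')).2 = rJ r n, ract r n (f (n, n')).2 = n' & (f (n, n')).1 = n].
  have := Kf (n, n') (mem_set (esym e)); have /= := fBA (n, n') (esym e).
  by case: (f (n, n')) => m h /= + [mn hm]; rewrite mn in hm *.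
have Jinv' h n : gsrc h = lJ (opposite_action r) n -> J (lact (opposite_action r) h n) = J n.
  by move=> hn; apply: Jinv; rewrite gtgt_inv.
(* The second component is the k with n·k = n'. In the opposite left action it is the inverse of k
   that takes n to n'. *)
apply: (@Principal _ _ (opposite_action r) X J cJ Js Jinv' (fun n' n => ginv (f (n, n')).2)).
- by move=> n' n /fE[h _ _]; rewrite gsrc_inv.
- by move=> n' n /fE[_ h _]; rewrite /= ginvK.
- move=> h n hn; have hA : gtgt (ginv h) = rJ r n by rewrite gtgt_inv.
  by have /= -> := fK (n, ginv h) (mem_set hA); rewrite /= ginvK.
- apply/subspace_continuousP => -[n' n] /= e; set F := within _ _.
  have sw : (y.2, y.1) @[y --> F] --> (n, n').
    by apply: cvg_within_filter; apply: cvg_pair; [exact: cvg_snd|exact: cvg_fst].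
  have A : \forall y \near F, J y.2 = J y.1 by apply: (@filterS _ F _ _ _ _ (withinT _ _)) => y.
  have c : f (y.2, y.1) @[y --> F] --> f (n, n').
    exact: (within_continuous_cvg (t := (n, n')) cf (esym e) sw A).
  have c2 : (f (y.2, y.1)).2 @[y --> F] --> (f (n, n')).2.
    exact: (cvg_comp (fun y : N * N => f (y.2, y.1)) snd c cvg_snd).
  by apply: (cvg_comp (fun y : N * N => (f (y.2, y.1)).2) (@ginv H) c2); exact: ginv_continuous.
- apply: (orbit_map_open so Jinv' _ Jq) => n n' /Jorb/asboolP[h [hn hn']].
  by exists (ginv h); rewrite /= gsrc_inv ginvK.
Qed.

Theorem theorem3p38 (R : realType) (G H : continuous_groupoid)
    (lamG : right_haar_system R G) (lamH : right_haar_system R H) :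
  morita_equivalent G H ->
  (exists N : bibundle G H,
     [/\ is_morita N, left_dirac lamG (bileft N) & right_dirac lamH (biright N)]) ->
  equivalent_categories (Rep R G) (Rep R H).
Proof.
move=> _ [N [[lp rp homG homH] dG dH]].
pose a := bileft N; pose b := opposite_action (biright N).
have lJs x : exists n, lJ a n = x.
  have rJe n n' : rorbit_equiv (biright N) n n' -> lJ a n = lJ a n'.
    by move=> /asboolP[h [hn <-]]; rewrite bi_lJ_ract.
  by have [+ _ _] := quotient_homeomorphism rJe homG; exact.
have rJs x : exists n, rJ (biright N) n = x.
  have lJe n n' : lorbit_equiv a n n' -> rJ (biright N) n = rJ (biright N) n'.
    by move=> /asboolP[g [gn <-]]; rewrite bi_rJ_lact.
  by have [+ _ _] := quotient_homeomorphism lJe homH; exact.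
have fsG := left_dirac_full_support lJs dG.
have fsH := right_dirac_full_support rJs dH.
have Pa : principal a (lJ b).
  by apply: (principal_left (gsrc_open fsG) lp) => //; [exact: rJ_continuous|exact: bi_rJ_lact].
have Pb : principal b (lJ a).
  by apply: (principal_right (gsrc_open fsH) rp) => //; [exact: lJ_continuous|exact: bi_lJ_ract].
have comm g n h : gsrc g = lJ a n -> gsrc h = lJ b n ->
    lact b h (lact a g n) = lact a g (lact b h n).
  by move=> gn hn; rewrite /= bi_commute// gtgt_inv.
have commV h n g : gsrc h = lJ b n -> gsrc g = lJ a n ->
    lact a g (lact b h n) = lact b h (lact a g n).
  by move=> hn gn; rewrite comm.
exists (@transfer R H G lamG fsG N b a Pa (fun h n => pr_inv Pb (n := n)) commV).
exists (@transfer R G H lamH fsH N a b Pb (fun g n => pr_inv Pa (n := n)) comm).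
split; first exact: (transfer_unit fsG fsH Pa Pb comm commV).
exact: (transfer_unit fsH fsG Pb Pa commV comm).
Qed.
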